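(* Let $(G_1,G_2)\sim\mathcal G(n,d,\rho,r)$ with latent bijection $\pi^*$. (Possibility) If $d=\omega(\log n)$ and $n\log\left(\frac1{1-\rho^2}\right)+2d\log\left(\frac1{1-r^2}\right)\ge(4+\epsilon)\log n$ for some constant $\epsilon>0$, then there exists an estimator $\hat\pi$ such that, for any fixed constant $0<\delta<1$ and any $\pi^*\in\mathcal S_n$, $$\mathbb P\left[\mathrm{overlap}(\hat\pi,\pi^* )\ge\delta\right]=1-o(1).$$ (Impossibility) Conversely, for any constant $0<\delta<1$, if $n\log\left(\frac1{1-\rho^2}\right)+2d\log\left(\frac1{1-r^2}\right)\le c\log n$ for some constant $c$, then for any estimator $\hat\pi$ (and all sufficiently large $n$), $$\mathbb P\left[\mathrm{overlap}(\hat\pi,\pi^* )<\delta\right]\ge1-\frac{c}{4\delta},$$ where $\pi^*$ is uniformly distributed over $\mathcal S_n$.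
   Context: Featured correlated Gaussian Wigner model $\mathcal G(n,d,\rho,r)$, with $n,d\in\mathbb N$ and $\rho,r\in(0,1)$: $G_1,G_2$ are weighted complete graphs with vertex sets $V(G_1),V(G_2)$ of size $n$; $E(G_i)$ is the set of unordered pairs of distinct vertices; $\beta_e(G_i)\in\mathbb R$ is the weight of edge $e$; each $u\in V(G_1)$ carries a feature $\bm{x}_u\in\mathbb R^d$ and each $v\in V(G_2)$ a feature $\bm{y}_v\in\mathbb R^d$. Given a latent bijection $\pi^*:V(G_1)\to V(G_2)$ (acting on edges by $\pi^*(uv)=\pi^*(u)\pi^*(v)$): the pairs $(\beta_e(G_1),\beta_{\pi^*(e)}(G_2))$, $e\in E(G_1)$, are i.i.d. pairs of standard normals with correlation $\rho$; the pairs $(\bm{x}_u,\bm{y}_{\pi^*(u)})$, $u\in V(G_1)$, are i.i.d. $\mathcal N(0,\Sigma_d)$ with $\Sigma_d=\begin{bmatrix} I_d & r I_d \\ r I_d & I_d \end{bmatrix}$; features are independent of edge weights. $\mathcal S_n$ is the set of bijections $V(G_1)\to V(G_2)$, and $\mathrm{overlap}(\pi,\pi')=\frac1n|\{v\in V(G_1):\pi(v)=\pi'(v)\}|$. An estimator $\hat\pi=\hat\pi(G_1,G_2)$ is an $\mathcal S_n$-valued function of the observed weights and features of $G_1,G_2$ (it may depend on the known parameters $n,d,\rho,r$). Asymptotics are as $n\to\infty$; $d,\rho,r$ may depend on $n$. *)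

(* Defs.v *)
From HB Require Import structures.
From mathcomp Require Import all_boot all_order all_algebra all_fingroup.
From mathcomp Require Import all_classical all_reals all_analysis.

Set Implicit Arguments.
Unset Strict Implicit.
Unset Printing Implicit Defensive.

Import Order.TTheory GRing.Theory Num.Theory.
Import numFieldNormedType.Exports.

Local Open Scope classical_set_scope.
Local Open Scope ring_scope.

Section lebesgue_tuple.
Context {R : realType}.
Local Open Scope ereal_scope.

Let consp m (p : measurableTypeR R * m.-tuple R) : m.+1.-tuple R := [tuple of p.1 :: p.2].
Let unconsp m (t : m.+1.-tuple R) : measurableTypeR R * m.-tuple R :=
  (thead t, [tuple of behead t]).

Let measurable_consp m : measurable_fun setT (@consp m).
Proof. exact: measurable_cons. Qed.

Let measurable_unconsp m : measurable_fun setT (@unconsp m).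
Proof.
apply: measurable_fun_pair; last exact: measurable_behead.
exact: measurable_tnth.
Qed.

Let unconspK m : cancel (@unconsp m) (@consp m).
Proof. by move=> t; rewrite /consp/= -tuple_eta. Qed.

Let conspK m : cancel (@consp m) (@unconsp m).
Proof. by case=> x t; congr (_, _); apply/val_inj. Qed.

Section step.
Variables (m : nat) (mu : {sigma_finite_measure set (m.-tuple R) -> \bar R}).

Definition lebesgue_cons : set (m.+1.-tuple R) -> \bar R :=
  pushforward (lebesgue_measure \x mu)
    (fun p : measurableTypeR R * m.-tuple R => [tuple of p.1 :: p.2] : m.+1.-tuple R).

Let lebesgue_cons0 : lebesgue_cons set0 = 0.
Proof. by rewrite /lebesgue_cons /pushforward preimage_set0 measure0. Qed.

Let lebesgue_cons_ge0 A : 0 <= lebesgue_cons A.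
Proof. by rewrite /lebesgue_cons /pushforward. Qed.

Let lebesgue_cons_sigma_additive : semi_sigma_additive lebesgue_cons.
Proof.
have mc (A : set (m.+1.-tuple R)) : measurable A ->
    measurable (@consp m @^-1` A).
  by move=> mA; rewrite -[X in measurable X]setTI; exact: measurable_consp.
move=> F mF tF mUF; rewrite /lebesgue_cons /pushforward preimage_bigcup.
apply: measure_semi_sigma_additive.
- by move=> i; exact: mc.
- apply/trivIsetP => /= i j _ _ ij; rewrite -preimage_setI.
  by move/trivIsetP : tF => /(_ _ _ _ _ ij) ->//; rewrite preimage_set0.
- by rewrite -preimage_bigcup; exact: mc.
Qed.

HB.instance Definition _ := isMeasure.Build _ _ _ lebesgue_cons
  lebesgue_cons0 lebesgue_cons_ge0 lebesgue_cons_sigma_additive.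

Let lebesgue_cons_sigma_finite : sigma_finite setT lebesgue_cons.
Proof.
have /sigma_finiteP[F [TF ndF Foo]] := sigma_finiteT (@lebesgue_measure R).
have /sigma_finiteP[G [TG ndG Goo]] := sigma_finiteT mu.
exists (fun i => @unconsp m @^-1` (F i `*` G i)).
  rewrite -preimage_bigcup -(preimage_setT (@unconsp m)); congr preimage.
  rewrite -setXTT TF TG predeqE => -[x y]; split.
    move=> [/= [i _ Fix] [k _ Gky]]; exists (maxn i k) => //; split.
    - by move: x Fix; exact/subsetPset/ndF/leq_maxl.
    - by move: y Gky; exact/subsetPset/ndG/leq_maxr.
  by move=> [i _ []/= ? ?]; split; exists i.
move=> i; have [mF Fi] := Foo i; have [mG Gi] := Goo i; split.
  rewrite -[X in measurable X]setTI; apply: measurable_unconsp => //.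
  exact: measurableX.
rewrite /lebesgue_cons /pushforward -comp_preimage.
rewrite (_ : _ \o _ = id); last by apply/funext => p /=; exact: conspK.
by rewrite preimage_id product_measure1E// lte_mul_pinfty// ge0_fin_numE.
Qed.

HB.instance Definition _ := Measure_isSigmaFinite.Build _ _ _ lebesgue_cons
  lebesgue_cons_sigma_finite.

End step.

(* Lebesgue measure on R^m: the iterated product of lebesgue_measure,
   transported along R * R^m ~ R^m.+1; on R^0 it is the unit point mass. *)
Fixpoint lebesgue_tuple (m : nat) :
    {sigma_finite_measure set (m.-tuple R) -> \bar R} :=
  match m with
  | 0 => \d_([tuple])
  | m'.+1 => lebesgue_cons (lebesgue_tuple m')
  end.

End lebesgue_tuple.

Section gaussian.
Context {R : realType}.

Definition mvnormal_pdf (m : nat) (Sigma : 'M[R]_m) (t : m.-tuple R) : R :=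
  let x := \row_(i < m) tnth t i in
  (Num.sqrt ((2 * pi) ^+ m * \det Sigma))^-1 *
  expR (- (x *m invmx Sigma *m x^T) 0 0 / 2).

(* [[I_d, r I_d], [r I_d, I_d]]; for d = 1, the covariance matrix of a pair of
   standard normals with correlation r *)
Definition corr_cov (d : nat) (r : R) : 'M[R]_(d + d) :=
  block_mx 1%:M r%:M r%:M 1%:M.

Definition tuple_pair (d : nat) (x y : d.-tuple R) : (d + d).-tuple R :=
  [tuple of x ++ y].

End gaussian.

(* The following take an arbitrary set function P, so that they apply both to a
   probability and to a conditional probability P( . | B). *)
Section random_elements.
Context {d : measure_display} {Omega : measurableType d} {R : realType}.
Variable P : set Omega -> \bar R.
Local Open Scope ereal_scope.

Definition cond_prob (B : set Omega) : set Omega -> \bar R :=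
  fun A => (fine (P (A `&` B)) / fine (P B))%R%:E.

Definition mutually_independent {d' : measure_display}
    {T : measurableType d'} (I : finType) (X : I -> Omega -> T) :=
  forall (J : {set I}) (A : I -> set T), (forall i, measurable (A i)) ->
    P (\bigcap_(i in [set` J]) X i @^-1` A i) =
    \prod_(i in J) P (X i @^-1` A i).

Definition independent {d1 d2 : measure_display}
    {T1 : measurableType d1} {T2 : measurableType d2}
    (X : Omega -> T1) (Y : Omega -> T2) :=
  forall A B, measurable A -> measurable B ->
    P (X @^-1` A `&` Y @^-1` B) = P (X @^-1` A) * P (Y @^-1` B).

(* X ~ N(0, Sigma), meaningful for a positive definite Sigma only *)
Definition centered_normal (m : nat) (Sigma : 'M[R]_m)
    (X : Omega -> m.-tuple R) :=
  forall A, measurable A ->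
    P (X @^-1` A) = \int[lebesgue_tuple m]_(t in A) (mvnormal_pdf Sigma t)%:E.

Definition iid_centered_normal (I : finType) (m : nat) (Sigma : 'M[R]_m)
    (X : I -> Omega -> m.-tuple R) :=
  mutually_independent X /\ forall i, centered_normal Sigma (X i).

End random_elements.

Section edges.
Variable n : nat.

Definition edge : finType := {e : {set 'I_n} | #|e| == 2%N}.

Fact card_edge_image (s : 'S_n) (e : edge) : #|s @: val e| == 2%N.
Proof. by rewrite card_imset ?(valP e)//; exact: perm_inj. Qed.

Definition edge_image (s : 'S_n) (e : edge) : edge :=
  exist _ (s @: val e) (card_edge_image s e).

End edges.

(* A weighted complete graph with features, as a pair: the edge weights, listed
   along the enumeration of edge n, then the features of the vertices. Both
   vertex sets are labelled by 'I_n, so that the bijections V(G_1) -> V(G_2)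
   are the elements of 'S_n. *)
Definition featured_graph (R : realType) (n d : nat) : Type :=
  #|edge n|.-tuple R * n.-tuple (d.-tuple R).

Definition edge_weights (R : realType) (n d : nat) (G : featured_graph R n d) := G.1.

Definition features (R : realType) (n d : nat) (G : featured_graph R n d) := G.2.

Definition weight (R : realType) (n d : nat) (G : featured_graph R n d) (e : edge n)
  : R := tnth (edge_weights G) (enum_rank e).

Definition feature (R : realType) (n d : nat) (G : featured_graph R n d) (u : 'I_n)
  : d.-tuple R := tnth (features G) u.

HB.instance Definition _ (R : realType) (n d : nat) :=
  Measurable.on (featured_graph R n d).

(* (G_1, G_2) ~ G(n, d, rho, r) under P, with latent bijection s *)
Definition correlated_wigner {dOmega : measure_display}
    {Omega : measurableType dOmega} {R : realType} (P : set Omega -> \bar R)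
    (n d : nat) (rho r : R) (s : 'S_n)
    (G : Omega -> featured_graph R n d * featured_graph R n d) : Prop :=
  [/\ iid_centered_normal P (corr_cov 1 rho)
        (fun (e : edge n) w =>
          [tuple weight (G w).1 e; weight (G w).2 (edge_image s e)]),
      iid_centered_normal P (corr_cov d r)
        (fun (u : 'I_n) w =>
          tuple_pair (feature (G w).1 u) (feature (G w).2 (s u))) &
      independent P
        (fun w => (edge_weights (G w).1, edge_weights (G w).2))
        (fun w => (features (G w).1, features (G w).2))].

Definition overlap (R : realType) (n : nat) (s s' : 'S_n) : R :=
  #|[pred v | s v == s' v]|%:R / n%:R.

(* 'S_n carries the discrete sigma-algebra *)
Definition measurable_to_perm {d : measure_display} {T : measurableType d}
    (n : nat) (f : T -> 'S_n) :=
  forall s, measurable (f @^-1` [set s]).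

Definition uniform_perm {d : measure_display} {Omega : measurableType d}
    {R : realType} (P : set Omega -> \bar R) (n : nat) (S : Omega -> 'S_n) :=
  measurable_to_perm S /\
  forall s, P (S @^-1` [set s]) = ((#|{: 'S_n}|%:R)^-1 : R)%:E.

Definition signal {R : realType} (n d : nat) (rho r : R) : R :=
  n%:R * ln (1 / (1 - rho ^+ 2)) + 2 * d%:R * ln (1 / (1 - r ^+ 2)).

(* Main.v *)
(* Impossibility. In the coordinates aligned by the latent bijection s, the pair
   of graphs has density [lik] with respect to i.i.d. standard normals, so that
   all the laws, for all s, have densities relative to one and the same null
   law Q. Under Q the two graphs are independent, and the average over s of the
   probability that an estimator agrees with s on k vertices is at most 1/k!.
   The change of measure costs a factor exp(tau), where log [lik] exceeds tau
   with small probability, by Markov's inequality for the moment of order 1 + t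
   of [lik] under Q, which is explicit. If c < 4 delta, a suitable tau makes both
   terms at most exp(-n).

   Possibility. The estimator maximizes the likelihood. If it errs on a set of k
   vertices, with s the permutation relating it to the truth, then the score of s
   is at least that of the identity. Given the first graph, the score is Gaussian,
   hence [drift] is the logarithm of an exponential martingale, and the comparison
   of the scores reduces to the concentration of quadratic forms in the first
   graph; the form sum_c x_c x_(s c) is treated by decoupling. The quantities that
   depend on the moved set only are controlled by a union bound over at most 2^n
   sets, and the others by a union bound over permutations, where the k! <= n^k
   permutations with a given support are absorbed by (4 + e) ln n <= signal. *)

Require Import Defs.
From HB Require Import structures.
From mathcomp Require Import all_boot all_order all_algebra all_fingroup.
From mathcomp Require Import all_classical all_reals all_analysis.
From mathcomp Require Import measurable_realfun ring lra.

Set Implicit Arguments.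
Unset Strict Implicit.
Unset Printing Implicit Defensive.

Import Order.TTheory GRing.Theory Num.Theory.
Import numFieldNormedType.Exports.

Local Open Scope classical_set_scope.
Local Open Scope ring_scope.

(** Both thresholds come from a count. One pair of entries with correlation [q] carries information
    [- ln (1 - q ^+ 2) / 2], so the two graphs share at most [n / 4 * signal], whereas a blind guess
    reaches overlap [delta] with probability about [exp (- delta * n * ln n)]: hence [c / 4] is
    compared with [delta]. For the likelihood estimator, a permutation that moves [k] vertices
    touches at least [k (n - 1) / 2] edges and exactly [k d] features, so the sum [energy] of their
    signal-to-noise ratios is at least about [k / 2 * signal]. The true score exceeds the
    conditional mean of the wrong one by about [energy], and the conditional variance of the wrong
    one is also about [energy]; the Gaussian tail [exp (- energy / 2)] beats [n ^ k] once [signal]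
    exceeds [4 ln n]. The obstacle is the uniform control of quadratic forms over [n ^ k]
    permutations: the forms in the edges have of order [k n] terms, those in the features only
    [k d], and this is where [d] must dominate [log n]. *)

Lemma big_enum_valT (C : finType) (S : Type) (idx : S) (op : Monoid.com_law idx)
    (f : C -> S) :
  \big[op/idx]_(i < #|C|) f (enum_val i) = \big[op/idx]_c f c.
Proof.
rewrite [RHS](reindex (fun i : 'I_#|C| => enum_val i))//=.
by apply: onW_bij; exact: enum_val_bij.
Qed.

(** * The standard Gaussian measure on tuples and Lebesgue measure *)

Section gauss_tuple.
Context {R : realType}.
Local Open Scope ereal_scope.

Definition gauss1 : probability (measurableTypeR R) R := normal_prob 0 1.

Definition consp m (p : measurableTypeR R * m.-tuple R) : m.+1.-tuple R :=
  [tuple of p.1 :: p.2].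

Lemma measurable_consp m : measurable_fun setT (@consp m).
Proof. exact: measurable_cons. Qed.

Section step.
Variables (m : nat) (mu : probability (m.-tuple R) R).

Definition gauss_cons : set (m.+1.-tuple R) -> \bar R :=
  pushforward (gauss1 \x mu) (@consp m).

Let gauss_cons_measure : {measure set (m.+1.-tuple R) -> \bar R} :=
  measure_function_pushforward__canonical__measure_function_Measure
    (gauss1 \x mu) (@measurable_consp m).

HB.instance Definition _ := Measure.copy gauss_cons gauss_cons_measure.

Let gauss_consT : gauss_cons setT = 1.
Proof.
rewrite /gauss_cons /pushforward preimage_setT -setXTT product_measure1E//.
by rewrite -[RHS]mule1; congr (_ * _); exact: probability_setT.
Qed.

HB.instance Definition _ := @Measure_isProbability.Build _ _ R gauss_cons gauss_consT.

End step.

Fixpoint gauss_tuple (m : nat) : probability (m.-tuple R) R :=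
  match m with
  | 0 => \d_([tuple])
  | m'.+1 => gauss_cons (gauss_tuple m')
  end.

(** [g] and the Radon-Nikodym derivative of [nu] have the same integral over every measurable set,
    hence agree almost everywhere, and the change of variables for the derivative applies. *)
Lemma ge0_integral_density dT (T : measurableType dT)
    (nu : {finite_measure set T -> \bar R})
    (mu : {sigma_finite_measure set T -> \bar R}) (g : T -> \bar R) :
  mu.-integrable setT g ->
  (forall A, measurable A -> nu A = \int[mu]_(x in A) g x) ->
  forall f : T -> \bar R, measurable_fun [set: T] f -> (forall x, 0 <= f x) ->
  \int[nu]_x f x = \int[mu]_x (f x * g x).
Proof.
move=> intg nuE f mf f0.
have numu : nu `<< mu.
  apply/null_content_dominatesP => A mA muA0; rewrite nuE//.
  apply: null_set_integral => //.
  exact: measurable_funTS (measurable_int _ intg).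
rewrite -(Radon_Nikodym_SigmaFinite.change_of_variables numu)//.
have intRN := Radon_Nikodym_SigmaFinite.f_integrable numu.
apply: ae_eq_integral => //.
- exact: emeasurable_funM mf (measurable_int _ intRN).
- exact: emeasurable_funM mf (measurable_int _ intg).
apply: ae_eqe_mul2l; apply: integral_ae_eq => //.
  exact: measurable_int intg.
move=> E _ mE; rewrite -nuE//.
by rewrite -Radon_Nikodym_SigmaFinite.f_integral.
Qed.

Lemma ge0_integral_gauss1 (f : R -> \bar R) :
  measurable_fun setT f -> (forall x, 0 <= f x) ->
  \int[gauss1]_x f x = \int[lebesgue_measure]_x (f x * (normal_pdf 0 1 x)%:E).
Proof.
move=> mf f0; apply: (@ge0_integral_density _ _ gauss1 lebesgue_measure _ _ _ f) => //.
exact: integrable_normal_pdf.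
Qed.

Lemma ge0_integral_gauss_cons m (f : m.+1.-tuple R -> \bar R) :
  measurable_fun setT f -> (forall t, 0 <= f t) ->
  \int[gauss_tuple m.+1]_t f t =
  \int[gauss1]_x \int[gauss_tuple m]_t f (consp (x, t)).
Proof.
move=> mf f0.
rewrite [LHS](ge0_integral_pushforward (@measurable_consp m))//.
rewrite preimage_setT fubini_tonelli1//; last by move=> p; exact: f0.
by apply: measurableT_comp => //; exact: measurable_consp.
Qed.

Lemma ge0_integral_lebesgue_cons m (f : m.+1.-tuple R -> \bar R) :
  measurable_fun setT f -> (forall t, 0 <= f t) ->
  \int[lebesgue_tuple m.+1]_t f t =
  \int[lebesgue_measure]_x \int[lebesgue_tuple m]_t f (consp (x, t)).
Proof.
move=> mf f0.
rewrite [LHS](ge0_integral_pushforward (@measurable_consp m))//.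
rewrite preimage_setT fubini_tonelli1//; last by move=> p; exact: f0.
by apply: measurableT_comp => //; exact: measurable_consp.
Qed.

Lemma emeasurable_prod dT (T : measurableType dT) (I : Type) (s : seq I)
    (h : I -> T -> \bar R) : (forall i, measurable_fun setT (h i)) ->
  measurable_fun setT (fun x => \prod_(i <- s) h i x).
Proof.
move=> mh; elim: s => [|i s IHs].
  by under eq_fun do rewrite big_nil; exact: measurable_cst.
by under eq_fun do rewrite big_cons; exact: emeasurable_funM.
Qed.

Lemma measurable_tnth_prod m (f : 'I_m -> R -> \bar R) :
  (forall i, measurable_fun setT (f i)) ->
  measurable_fun setT (fun t : m.-tuple R => \prod_(i < m) f i (tnth t i)).
Proof.
move=> mf; apply: emeasurable_prod => i.
by apply: measurableT_comp => //; exact: measurable_tnth.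
Qed.

Lemma ge0_integral_gauss_prod m (f : 'I_m -> R -> \bar R) :
  (forall i, measurable_fun setT (f i)) -> (forall i x, 0 <= f i x) ->
  \int[gauss_tuple m]_t \prod_(i < m) f i (tnth t i) =
  \prod_(i < m) \int[gauss1]_x f i x.
Proof.
elim: m f => [|m IHm] f mf f0.
  rewrite big_ord0; under eq_integral do rewrite big_ord0.
  by rewrite integral_cst// mul1e; exact: probability_setT.
rewrite ge0_integral_gauss_cons//; last 2 first.
- exact: measurable_tnth_prod.
- by move=> t; exact: prode_ge0.
rewrite big_ord_recl -IHm//.
rewrite -ge0_integralZr//; last 2 first.
- exact: mf.
- by apply: integral_ge0 => t _; exact: prode_ge0.
apply: eq_integral => x _; rewrite -ge0_integralZl//; last 2 first.
- by apply: (@measurable_tnth_prod _ (fun i => f (lift ord0 i))).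
- by move=> t _; exact: prode_ge0.
apply: eq_integral => t _; rewrite big_ord_recl; congr (_ * _).
by apply: eq_bigr => i _; rewrite tnthS.
Qed.

(** The head coordinate is peeled off on both sides by Tonelli. This links the Lebesgue densities of
    the statement to the Gaussian reference measure used from here on. *)
Lemma lebesgue_gauss_tuple m (f : m.-tuple R -> \bar R) :
  measurable_fun setT f -> (forall t, 0 <= f t) ->
  \int[lebesgue_tuple m]_t
     (f t * (\prod_(i < m) normal_pdf 0 1 (tnth t i))%R%:E) =
  \int[gauss_tuple m]_t f t.
Proof.
elim: m f => [|m IHm] f mf f0.
  by under eq_integral do rewrite big_ord0 mule1.
have mpdf k : measurable_fun setT
    (fun t : k.-tuple R => (\prod_(i < k) normal_pdf 0 1 (tnth t i))%:E).
  apply/measurable_EFinP; apply: measurable_prod => i _.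
  by apply: measurableT_comp; [exact: measurable_normal_pdf|exact: measurable_tnth].
have pdf0 k (t : k.-tuple R) :
    0 <= (\prod_(i < k) normal_pdf 0 1 (tnth t i))%:E.
  by rewrite lee_fin prodr_ge0// => i _; exact: normal_pdf_ge0.
have mf' : measurable_fun setT (f \o @consp m).
  by apply: measurableT_comp => //; exact: measurable_consp.
have mfx x : measurable_fun setT (fun t => f (consp (x, t))).
  exact: (measurableT_comp mf' (pair1_measurable x)).
rewrite ge0_integral_gauss_cons// ge0_integral_lebesgue_cons; last 2 first.
- exact: (emeasurable_funM mf (mpdf _)).
- by move=> t; exact: mule_ge0.
rewrite ge0_integral_gauss1; last 2 first.
- apply: (@measurable_fun_fubini_tonelli_F _ _ _ _ _ (gauss_tuple m)
      (f \o @consp m)) => //.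
  by move=> p; exact: f0.
- by move=> x; apply: integral_ge0 => t _; exact: f0.
apply: eq_integral => x _.
rewrite -IHm// -ge0_integralZr//; last 3 first.
- exact: (emeasurable_funM (mfx x) (mpdf _)).
- by move=> t _; exact: mule_ge0.
- by rewrite lee_fin normal_pdf_ge0.
apply: eq_integral => t _; rewrite -muleA; congr (_ * _).
rewrite big_ord_recl -EFinM mulrC; congr (_ * _)%:E.
by apply: eq_bigr => i _; rewrite tnthS.
Qed.

Lemma measurable_cat_tuple a b : measurable_fun setT
  (fun p : a.-tuple R * b.-tuple R => [tuple of p.1 ++ p.2] : (a + b).-tuple R).
Proof.
apply/measurable_fun_tnthP => i; rewrite -[i]splitK.
case: (fintype.split i) => j /=.
  rewrite (_ : _ \o _ = (fun p => tnth p.1 j)); last first.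
    by apply/funext => p /=; rewrite tnth_lshift.
  by apply: (measurableT_comp (measurable_tnth j)).
rewrite (_ : _ \o _ = (fun p => tnth p.2 j)); last first.
  by apply/funext => p /=; rewrite tnth_rshift.
by apply: (measurableT_comp (measurable_tnth j)).
Qed.

Lemma lebesgue_tuple_cat a b (f : (a + b).-tuple R -> \bar R) :
  measurable_fun setT f -> (forall t, 0 <= f t) ->
  \int[lebesgue_tuple (a + b)]_t f t =
  \int[lebesgue_tuple a]_x \int[lebesgue_tuple b]_y f [tuple of x ++ y].
Proof.
elim: a f => [|a IHa] f mf f0.
  have mF : measurable_fun setT (fun x : 0.-tuple R =>
      \int[lebesgue_tuple b]_y f [tuple of x ++ y]).
    apply: (@measurable_fun_fubini_tonelli_F _ _ _ _ _ (lebesgue_tuple b)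
      (fun p : 0.-tuple R * b.-tuple R => f [tuple of p.1 ++ p.2])) => //.
    by apply: measurableT_comp => //; exact: measurable_cat_tuple.
  rewrite [RHS]integral_dirac// diracT mul1e.
  by apply: eq_integral => t _; congr f; exact/val_inj.
rewrite [LHS](@ge0_integral_lebesgue_cons (a + b))//.
rewrite ge0_integral_lebesgue_cons; last 2 first.
- apply: (@measurable_fun_fubini_tonelli_F _ _ _ _ _ (lebesgue_tuple b)
      (fun p : a.+1.-tuple R * b.-tuple R => f [tuple of p.1 ++ p.2])) => //.
  by apply: measurableT_comp => //; exact: measurable_cat_tuple.
- by move=> t; exact: integral_ge0.
have mf' : measurable_fun setT (f \o @consp (a + b)).
  by apply: (measurableT_comp mf); exact: measurable_consp.
apply: eq_integral => x _.
have /IHa IHx : measurable_fun setT (fun t : (a + b).-tuple R => f (consp (x, t))).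
  exact: (measurableT_comp mf' (pair1_measurable x)).
apply: (eq_trans (IHx (fun t => f0 _))).
apply: eq_integral => t _; apply: eq_integral => u _.
by congr f; exact/val_inj.
Qed.

End gauss_tuple.

(** * One-dimensional Gaussian integrals *)

Section gaussian_integrals.
Context {R : realType}.

(** Completion of the square: the tilted density is again normal, with mean [b / (1 - u)] and
    variance [1 / (1 - u)]. *)
Lemma expR_quadratic_normal_pdf (u b x : R) : u < 1 ->
  expR (u * x ^+ 2 / 2 + b * x) * normal_pdf 0 1 x =
  (Num.sqrt (1 - u))^-1 * expR (b ^+ 2 / (2 * (1 - u))) *
    normal_pdf (b / (1 - u)) (Num.sqrt (1 - u))^-1 x.
Proof.
move=> u1; have u1' : 0 < 1 - u by rewrite subr_gt0.
have su : 0 < Num.sqrt (1 - u) by rewrite sqrtr_gt0.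
rewrite !normal_pdfE ?oner_neq0 ?invr_eq0 ?gt_eqF//= /normal_peak /normal_fun.
rewrite exprVn sqr_sqrtr ?ltW// expr1n subr0.
have -> : Num.sqrt ((1 - u)^-1 * pi *+ 2) =
    (Num.sqrt (1 - u))^-1 * Num.sqrt (1 * pi *+ 2).
  by rewrite -mulrnAr sqrtrM ?invr_ge0 ?ltW// sqrtrV ?mul1r// ltW.
rewrite [in RHS](invfM _^-1) invrK mulrACA mulKf ?gt_eqF// [LHS]mulrCA -!expRD.
by congr (_ * expR _); rewrite -mulr_natr; field; rewrite gt_eqF.
Qed.

Lemma expR_half_ln (v : R) : 0 < v -> (Num.sqrt v)^-1 = expR (- (ln v / 2)).
Proof.
move=> v0; rewrite expRN; congr (_^-1); apply/eqP.
rewrite -(@eqrXn2 _ 2)// ?expR_ge0// sqr_sqrtr ?ltW// -expRM_natr.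
by rewrite -mulr_natr divfK// lnK.
Qed.

(** All the exponential moments below reduce to this integral. *)
Lemma gauss1_expR_quadratic (a u b : R) : u < 1 ->
  (\int[gauss1]_x (expR (a + u * x ^+ 2 / 2 + b * x))%:E =
   (expR (a + b ^+ 2 / (2 * (1 - u)) - ln (1 - u) / 2))%:E)%E.
Proof.
move=> u1; under eq_integral do rewrite -addrA expRD EFinM.
have mq : measurable_fun setT (fun x : R => (expR (u * x ^+ 2 / 2 + b * x))%:E).
  apply/measurable_EFinP; apply: measurableT_comp => //.
  by apply: measurable_funD; do ?apply: measurable_funM.
rewrite ge0_integralZl_EFin//.
rewrite ge0_integral_gauss1//.
under eq_integral do rewrite -EFinM expR_quadratic_normal_pdf// EFinM.
rewrite ge0_integralZl_EFin//; last 2 first.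
- by move=> x _; rewrite lee_fin normal_pdf_ge0.
- by apply/measurable_EFinP; exact: measurable_normal_pdf.
rewrite integral_normal_pdf mule1 -EFinM expR_half_ln ?subr_gt0// -!expRD.
by congr (expR _)%:E; ring.
Qed.

(* The logarithm of the density of a pair of standard normals with correlation
   [q], relative to a pair of independent standard normals. *)
Definition lell (q x y : R) : R := - (ln (1 - q ^+ 2) / 2) +
  (2 * q * x * y - q ^+ 2 * x ^+ 2 - q ^+ 2 * y ^+ 2) / (2 * (1 - q ^+ 2)).

Lemma measurable_lell q : measurable_fun [set: R * R] (fun p => lell q p.1 p.2).
Proof.
apply: measurable_funD => //; apply: measurable_funM => //.
apply: measurable_funB; last first.
  by apply: measurable_funM => //; apply: measurable_funX.
apply: measurable_funB; last first.
  by apply: measurable_funM => //; apply: measurable_funX.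
by do ?apply: measurable_funM.
Qed.

Lemma sq_lt1 (q : R) : 0 < q < 1 -> 0 < 1 - q ^+ 2.
Proof. by move=> /andP[q0 q1]; rewrite subr_gt0 expr_lt1// ltW. Qed.

(** Weighting by [expR (lell q x y)] makes [y] normal with mean [q * x] and variance [1 - q ^+ 2];
    the right side is its moment generating function, equal to 1 at [b = 0]. *)
Lemma gauss1_lell (q x b : R) : 0 < q < 1 ->
  (\int[gauss1]_y (expR (lell q x y + b * y))%:E =
   (expR (b * q * x + b ^+ 2 * (1 - q ^+ 2) / 2))%:E)%E.
Proof.
move=> q01; have k0 := sq_lt1 q01; have kn0 := lt0r_neq0 k0.
pose u := - (q ^+ 2 / (1 - q ^+ 2)).
have u1 : u < 1.
  by rewrite (@lt_trans _ _ 0)// oppr_lt0 divr_gt0// exprn_gt0//; case/andP: q01.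
have e1u : 1 - u = (1 - q ^+ 2)^-1 by rewrite /u; field.
pose a : R := - (ln (1 - q ^+ 2) / 2) - q ^+ 2 * x ^+ 2 / (2 * (1 - q ^+ 2)).
have E (y : R) : lell q x y + b * y =
    a + u * y ^+ 2 / 2 + (q * x / (1 - q ^+ 2) + b) * y.
  by rewrite /lell /a /u; field.
under eq_integral do rewrite E.
rewrite gauss1_expR_quadratic// e1u lnV ?posrE// /a.
by congr (expR _)%:E; field.
Qed.

(** The integral over [y] leaves the exponential of a quadratic in [x], so the same formula applies
    twice. *)
Lemma gauss1_lell_renyi (q t : R) : 0 < q < 1 -> 0 <= t < 1 ->
  (\int[gauss1]_x \int[gauss1]_y (expR ((1 + t) * lell q x y))%:E =
   (expR (- (t * ln (1 - q ^+ 2) / 2) - ln (1 - t ^+ 2 * q ^+ 2) / 2))%:E)%E.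
Proof.
move=> q01 /andP[t0 t1]; have k0 := sq_lt1 q01; have kn0 := lt0r_neq0 k0.
have q20 : 0 < q ^+ 2 by rewrite exprn_gt0//; case/andP: q01.
have tq0 : 0 < 1 + t * q ^+ 2 by rewrite ltr_pwDl// mulr_ge0// ltW.
have tqn0 := lt0r_neq0 tq0.
have t2q : 0 < 1 - t ^+ 2 * q ^+ 2.
  have t21 : t ^+ 2 <= 1 by rewrite expr_le1// ltW.
  by move: (t21) (q20) (k0); clear; nra.
pose u := - ((1 + t) * q ^+ 2 / (1 - q ^+ 2)).
have u1 : u < 1.
  by rewrite (@lt_trans _ _ 0)// oppr_lt0 divr_gt0// mulr_gt0// ltr_wpDr.
have e1u : 1 - u = (1 + t * q ^+ 2) / (1 - q ^+ 2) by rewrite /u; field.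
pose a (x : R) : R := - ((1 + t) * ln (1 - q ^+ 2) / 2) -
  (1 + t) * q ^+ 2 * x ^+ 2 / (2 * (1 - q ^+ 2)).
have E (x y : R) : (1 + t) * lell q x y =
    a x + u * y ^+ 2 / 2 + ((1 + t) * q * x / (1 - q ^+ 2)) * y.
  by rewrite /lell /a /u; field.
under eq_integral => x _.
  under eq_integral do rewrite E.
  rewrite gauss1_expR_quadratic// e1u lnM ?lnV ?posrE ?invr_gt0//; over.
(* The coefficient of [x ^+ 2 / 2] once [y] is integrated out; [U < 1] amounts to
   [t ^+ 2 * q ^+ 2 < 1]. *)
pose U := (1 + t) * t * q ^+ 2 / (1 + t * q ^+ 2).
have e1U : 1 - U = (1 - t ^+ 2 * q ^+ 2) / (1 + t * q ^+ 2) by rewrite /U; field.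
have U1 : U < 1 by rewrite -subr_gt0 e1U divr_gt0.
pose A := - (t * ln (1 - q ^+ 2) / 2) - ln (1 + t * q ^+ 2) / 2.
have E' (x : R) : a x +
   ((1 + t) * q * x / (1 - q ^+ 2)) ^+ 2 / (2 * ((1 + t * q ^+ 2) / (1 - q ^+ 2))) -
   (ln (1 + t * q ^+ 2) - ln (1 - q ^+ 2)) / 2 = A + U * x ^+ 2 / 2 + 0 * x.
  by rewrite /a /A /U; field; rewrite ?kn0 ?tqn0.
under eq_integral do rewrite E'.
rewrite gauss1_expR_quadratic// e1U lnM ?lnV ?posrE ?invr_gt0// /A.
by congr (expR _)%:E; rewrite expr0n mul0r addr0; field.
Qed.

End gaussian_integrals.

(** * Densities and laws on pairs of tuples *)

Section density_measure.
Context d (T : measurableType d) (R : realType) (mu : {measure set T -> \bar R}).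
Local Open Scope ereal_scope.

(* The proofs are arguments so that the measure structure can be inferred. *)
Definition density_measure (f : T -> \bar R) (mf : measurable_fun setT f)
  (f0 : forall x, 0 <= f x) (A : set T) : \bar R := \int[mu]_(x in A) f x.

Variable f : T -> \bar R.
Hypotheses (mf : measurable_fun setT f) (f0 : forall x, 0 <= f x).
Let nu := density_measure mf f0.

Let density0 : nu set0 = 0.
Proof. by rewrite /nu /density_measure integral_set0. Qed.

Let density_ge0 A : 0 <= nu A.
Proof. exact: integral_ge0. Qed.

Let density_sigma_additive : semi_sigma_additive nu.
Proof. exact: semi_sigma_additive_nng_induced. Qed.

HB.instance Definition _ := isMeasure.Build _ _ _ (density_measure mf f0)
  density0 density_ge0 density_sigma_additive.

End density_measure.

Section boxes.
Context {R : realType} (N : nat).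
Local Open Scope ereal_scope.
Local Notation T := (N.-tuple R).

Definition box (A B : 'I_N -> set R) : set (T * T) :=
  [set p | forall i, A i (tnth p.1 i) /\ B i (tnth p.2 i)].

Lemma boxE A B : box A B = \bigcap_(i in [set: 'I_N])
  ([set p | A i (tnth p.1 i)] `&` [set p | B i (tnth p.2 i)]).
Proof. by apply/seteqP; split=> p /= H i; [move=> _|]; apply: H. Qed.

Lemma measurable_box A B : (forall i, measurable (A i)) ->
  (forall i, measurable (B i)) -> measurable (box A B).
Proof.
move=> mA mB; rewrite boxE; apply: fin_bigcap_measurable => // i _.
apply: measurableI.
- have mt : measurable_fun setT (fun p : T * T => tnth p.1 i).
    exact: (measurableT_comp (measurable_tnth i)).
  by rewrite -[X in measurable X]setTI; apply: mt.
- have mt : measurable_fun setT (fun p : T * T => tnth p.2 i).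
    exact: (measurableT_comp (measurable_tnth i)).
  by rewrite -[X in measurable X]setTI; apply: mt.
Qed.

Let boxes : set (set (T * T)) :=
  [set X | exists A B, [/\ forall i, measurable (A i),
    forall i, measurable (B i) & X = box A B]].

(** A constraint on a single coordinate is a box whose other sides are full, so both projections are
    measurable for the sigma-algebra generated by the boxes, and so is the identity. *)
Let boxes_generate : measurable = <<s boxes >>.
Proof.
apply/seteqP; split; last first.
  apply: smallest_sub; first exact: sigma_algebra_measurable.
  by move=> _ [A [B [mA mB ->]]]; exact: measurable_box.
pose T' := g_sigma_algebraType boxes.
suff mid : measurable_fun [set: T'] (fun p : T' => (p.1, p.2) : T * T).
  move=> X mX; have := mid measurableT X mX; rewrite setTI.
  by rewrite (_ : _ @^-1` X = X)//; apply/seteqP; split=> -[].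
apply: measurable_fun_pair; apply/measurable_fun_tnthP => i _ A mA; rewrite setTI.
- apply: sub_sigma_algebra.
  exists (fun j => if j == i then A else setT), (fun=> setT).
  split=> // [j|]; first by case: ifP.
  apply/seteqP; split=> p /=.
  + by move=> Ap j; split=> //; case: eqP => // ->.
  + by move=> /(_ i); rewrite eqxx => -[].
- apply: sub_sigma_algebra.
  exists (fun=> setT), (fun j => if j == i then A else setT).
  split=> // [j|]; first by case: ifP.
  apply/seteqP; split=> p /=.
  + by move=> Ap j; split=> //; case: eqP => // ->.
  + by move=> /(_ i); rewrite eqxx => -[].
Qed.

(** The boxes are closed under intersection and include the whole space, so the uniqueness theorem
    for finite measures applies. *)
Lemma measure_eq_boxes (m1 m2 : {measure set (T * T) -> \bar R}) :
  m1 setT < +oo ->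
  (forall A B, (forall i, measurable (A i)) -> (forall i, measurable (B i)) ->
     m1 (box A B) = m2 (box A B)) ->
  forall X, measurable X -> m1 X = m2 X.
Proof.
move=> m1oo m12; apply: (measure_unique boxes (fun=> setT)) => //.
- move=> _ _ [A [B [mA mB ->]]] [A' [B' [mA' mB' ->]]].
  exists (fun i => A i `&` A' i), (fun i => B i `&` B' i); split.
  + by move=> i; exact: measurableI.
  + by move=> i; exact: measurableI.
  apply/seteqP; split=> p /=.
  + by move=> [H H'] i; have [] := H i; have [] := H' i.
  + by move=> H; split=> i; have [[? ?] [? ?]] := H i.
- move=> _; exists (fun=> setT), (fun=> setT); split=> //.
  by apply/seteqP; split.
- by rewrite bigcup_const.
- by move=> _ [A [B [mA mB ->]]]; exact: m12.
Qed.

Lemma measurable_tnth_pair i :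
  measurable_fun [set: T * T] (fun p => (tnth p.1 i, tnth p.2 i)).
Proof.
apply: measurable_fun_pair.
  exact: (measurableT_comp (measurable_tnth i)).
exact: (measurableT_comp (measurable_tnth i)).
Qed.

Lemma ge0_integral_gauss_prod2 (g : 'I_N -> R -> R -> \bar R) :
  (forall i, measurable_fun setT (fun p : R * R => g i p.1 p.2)) ->
  (forall i x y, 0 <= g i x y) ->
  \int[gauss_tuple N \x gauss_tuple N]_p \prod_(i < N) g i (tnth p.1 i) (tnth p.2 i) =
  \prod_(i < N) \int[gauss1]_x \int[gauss1]_y g i x y.
Proof.
move=> mg g0.
have mg1 i x : measurable_fun setT (g i x).
  exact: (measurableT_comp (mg i) (pair1_measurable x)).
rewrite fubini_tonelli1/=; last 2 first.
- apply: emeasurable_prod => i.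
  exact: (measurableT_comp (mg i) (measurable_tnth_pair i)).
- by move=> p; exact: prode_ge0.
rewrite -(@ge0_integral_gauss_prod _ N (fun i x => \int[gauss1]_y g i x y)).
- apply: eq_integral => x _; rewrite /fubini_F/=.
  exact: (ge0_integral_gauss_prod (f := fun i y => g i (tnth x i) y)).
- move=> j; apply: (@measurable_fun_fubini_tonelli_F _ _ _ _ _ gauss1
    (fun p : R * R => g j p.1 p.2)).
  - exact: mg.
  - by move=> p; exact: g0.
- by move=> j x; exact: integral_ge0.
Qed.

Definition lik (q : 'I_N -> R) (p : T * T) : R :=
  (\prod_(i < N) expR (lell (q i) (tnth p.1 i) (tnth p.2 i)))%R.

Lemma lik_ge0 q p : (0 <= lik q p)%R.
Proof. by apply: prodr_ge0 => i _; exact: expR_ge0. Qed.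

Lemma measurable_lik q : measurable_fun setT (fun p => (lik q p)%:E).
Proof.
apply/measurable_EFinP; apply: measurable_prod => i _.
apply: (measurableT_comp (@measurable_expR R)).
exact: (measurableT_comp (measurable_lell (q i)) (measurable_tnth_pair i)).
Qed.

(* The probability that a pair of standard normals with correlation [q] lies in
   [A `*` B]. *)
Definition corr_rect (q : R) (A B : set R) : \bar R :=
  \int[gauss1]_x \int[gauss1]_y (expR (lell q x y) * (\1_A x * \1_B y))%:E.

Lemma lik_box q A B : (forall i, measurable (A i)) ->
  (forall i, measurable (B i)) ->
  \int[gauss_tuple N \x gauss_tuple N]_(p in box A B) (lik q p)%:E =
  \prod_(i < N) corr_rect (q i) (A i) (B i).
Proof.
move=> mA mB.
rewrite /corr_rect -(ge0_integral_gauss_prod2 (g := fun i x y =>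
  (expR (lell (q i) x y) * (\1_(A i) x * \1_(B i) y))%:E)); last 2 first.
- move=> i; apply/measurable_EFinP; apply: measurable_funM.
    apply: (measurableT_comp (@measurable_expR R)); exact: measurable_lell.
  apply: measurable_funM.
    exact: (measurableT_comp (measurable_indic (mA i))).
  exact: (measurableT_comp (measurable_indic (mB i))).
- by move=> i x y; rewrite lee_fin !mulr_ge0 ?expR_ge0.
rewrite integral_mkcond; apply: eq_integral => p _.
rewrite patchE prodEFin /lik big_split/=.
case: ifPn => [|]; rewrite ?inE ?notin_setE => Hp.
  rewrite [X in (_ * X)%R]big1 ?mulr1// => i _; have [Ai Bi] := Hp i.
  by rewrite !indicE !mem_set// mulr1.
have [i Hi] : exists i, ~ (A i (tnth p.1 i) /\ B i (tnth p.2 i)).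
  exact/existsNP.
rewrite [X in (_ * X)%R](bigD1 i)//= !indicE.
case/not_andP: Hi => Hi.
  by rewrite (memNset Hi) !mul0r mulr0.
by rewrite (memNset Hi) mulr0 !mul0r mulr0.
Qed.

Lemma law_lik dO (Omega : measurableType dO) (P : {measure set Omega -> \bar R})
    (Z : Omega -> T * T) (q : 'I_N -> R) :
  measurable_fun setT Z -> P setT < +oo ->
  (forall A B, (forall i, measurable (A i)) -> (forall i, measurable (B i)) ->
     P (Z @^-1` box A B) = \prod_(i < N) corr_rect (q i) (A i) (B i)) ->
  forall X, measurable X ->
    P (Z @^-1` X) = \int[gauss_tuple N \x gauss_tuple N]_(p in X) (lik q p)%:E.
Proof.
move=> mZ Poo PZ X mX.
pose m1 : {measure set (T * T) -> \bar R} :=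
  measure_function_pushforward__canonical__measure_function_Measure P mZ.
have l0 p : 0 <= (lik q p)%:E by rewrite lee_fin lik_ge0.
pose m2 : {measure set (T * T) -> \bar R} :=
  density_measure (gauss_tuple N \x gauss_tuple N) (measurable_lik q) l0.
apply: (@measure_eq_boxes m1 m2) => // A B mA mB.
by rewrite [LHS]PZ// -lik_box.
Qed.

End boxes.

(** * The normal density with covariance [corr_cov] *)

Section corr_cov.
Context {R : realType}.

Lemma corr_cov_decomp d (r : R) : corr_cov d r =
  block_mx 1%:M 0 r%:M 1%:M *m block_mx 1%:M r%:M 0 (1 - r ^+ 2)%:M.
Proof.
rewrite /corr_cov mulmx_block !mul1mx !mul0mx !mulmx1 !addr0.
by rewrite -scalar_mxM -raddfD/= expr2 subrKC.
Qed.

Lemma det_corr_cov d (r : R) : \det (corr_cov d r) = (1 - r ^+ 2) ^+ d.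
Proof.
by rewrite corr_cov_decomp det_mulmx det_lblock det_ublock !det1 det_scalar !mul1r.
Qed.

Lemma invmx_corr_cov d (r : R) : 1 - r ^+ 2 != 0 -> invmx (corr_cov d r) =
  (1 - r ^+ 2)^-1 *: block_mx 1%:M (- r%:M) (- r%:M) 1%:M.
Proof.
move=> k0; set K := _ *: _.
have KS : corr_cov d r *m K = 1%:M.
  rewrite /K -scalemxAr /corr_cov mulmx_block !mul1mx !mulmx1.
  rewrite !mulmxN -scalar_mxM -expr2 addrC addNr addrN [- _ + 1%:M]addrC.
  rewrite -raddfB/= scale_block_mx !scaler0 scale_scalar_mx [- _ + 1]addrC mulVf//.
  by rewrite -scalar_mx_block.
have [uS _] := mulmx1_unit KS.
by rewrite -[RHS]mul1mx -(mulVmx uS) -mulmxA KS mulmx1.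
Qed.

(** The blocks of the covariance are scalar matrices, so [tnth x i] interacts with [tnth y i] only
    and the density is a product over [i]. The order of the factors lets Lebesgue measure be
    replaced by the Gaussian one in [y], then in [x]. *)
Lemma mvnormal_pdf_corr_cov d (r : R) (x y : d.-tuple R) : 0 < r < 1 ->
  mvnormal_pdf (corr_cov d r) [tuple of x ++ y] =
  lik (fun=> r) (x, y) * (\prod_(i < d) normal_pdf 0 1 (tnth y i)) *
    (\prod_(i < d) normal_pdf 0 1 (tnth x i)).
Proof.
move=> r01; have k0 := sq_lt1 r01; have kn0 := lt0r_neq0 k0.
have sk0 : 0 < Num.sqrt (1 - r ^+ 2) by rewrite sqrtr_gt0.
have pi0 := pi_gt0 R.
rewrite /mvnormal_pdf det_corr_cov invmx_corr_cov//.
rewrite (_ : \row_(i < d + d) _ = row_mx (\row_i tnth x i) (\row_i tnth y i)); last first.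
  apply/rowP => i; rewrite -[i]splitK; case: (fintype.split i) => j /=.
    by rewrite row_mxEl !mxE tnth_lshift.
  by rewrite row_mxEr !mxE tnth_rshift.
rewrite -scalemxAr -scalemxAl mul_row_block !mulmx1 !mulmxN !mul_mx_scalar.
rewrite tr_row_mx mul_row_col !mulmxDl !mulNmx -!scalemxAl.
have dot (a b : d.-tuple R) : (\row_i tnth a i *m (\row_i tnth b i)^T) 0 0 =
    \sum_i tnth a i * tnth b i.
  by rewrite mxE; apply: eq_bigr => i _; rewrite !mxE.
have lin (a b : R) (A B C D : 'M[R]_1) :
    (a *: (A - b *: B + (- (b *: C) + D))) 0 0 =
    a * (A 0 0 - b * B 0 0 + (- (b * C 0 0) + D 0 0)).
  by rewrite !mxE.
rewrite lin !dot.
pose k := (1 - r ^+ 2)^-1.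
pose g i := - (k / 2) * (tnth x i * tnth x i) + r * k / 2 * (tnth y i * tnth x i) +
  r * k / 2 * (tnth x i * tnth y i) - k / 2 * (tnth y i * tnth y i).
transitivity (\prod_(i < d) ((2 * pi * Num.sqrt (1 - r ^+ 2))^-1 * expR (g i))).
  rewrite big_split/= prodr_const card_ord exprVn; congr (_^-1 * _).
    rewrite exprD -!exprMn -[X in X ^+ d](_ : (2 * pi * Num.sqrt (1 - r ^+ 2)) ^+ 2 = _).
      by rewrite exprAC sqrtr_sqr ger0_norm// exprn_ge0// !mulr_ge0// ltW.
    by rewrite exprMn sqr_sqrtr ?expr2// ltW.
  rewrite -expR_sum; congr expR.
  rewrite /g !big_split/= sumrN -!mulr_sumr.
  by rewrite -/k; field.
rewrite /lik -!big_split/=; apply: eq_bigr => i _.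
rewrite !normal_pdfE ?oner_neq0//= /normal_peak /normal_fun expr1n !subr0 mul1r.
set c := Num.sqrt (pi *+ 2).
have -> : (2 * pi * Num.sqrt (1 - r ^+ 2))^-1 =
    expR (- (ln (1 - r ^+ 2) / 2)) * (c^-1 * c^-1).
  rewrite -expR_half_ln// -!invfM; congr (_^-1).
  have pi0w := ltW pi0; rewrite -[c * c]expr2 sqr_sqrtr; last exact: mulrn_wge0.
  by rewrite mulrC -[pi *+ 2]mulr_natl.
rewrite [in RHS]/lell [in RHS]expRD; set F := expR (_ / (2 * _)).
have -> : expR (g i) = F * expR (- tnth y i ^+ 2 / 2) * expR (- tnth x i ^+ 2 / 2).
  by rewrite -!expRD; congr expR; rewrite /g /k; field.
by ring.
Qed.

(** Used with [d = 1] for an edge and with the feature dimension for a vertex; both then become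
    products of the same [corr_rect]. *)
Lemma integral_corr_cov_rect d (r : R) (A B : 'I_d -> set R) : 0 < r < 1 ->
  (forall i, measurable (A i)) -> (forall i, measurable (B i)) ->
  (\int[lebesgue_tuple (d + d)]_(t in [set t | forall i,
      A i (tnth t (lshift d i)) /\ B i (tnth t (rshift d i))])
     (mvnormal_pdf (corr_cov d r) t)%:E =
   \prod_(i < d) corr_rect r (A i) (B i))%E.
Proof.
move=> r01 mA mB.
pose F (p : d.-tuple R * d.-tuple R) : R := lik (fun=> r) p * \1_(box A B) p.
have mbox : measurable (box A B) by exact: measurable_box.
have mF : measurable_fun setT (EFin \o F).
  apply/measurable_EFinP; apply: measurable_funM.
    by apply/measurable_EFinP; exact: measurable_lik.
  exact: measurable_indic.
have F0 p : (0 <= (F p)%:E)%E by rewrite lee_fin mulr_ge0 ?lik_ge0.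
have mpdf : measurable_fun setT
    (fun t : d.-tuple R => (\prod_(i < d) normal_pdf 0 1 (tnth t i))%:E).
  apply/measurable_EFinP; apply: measurable_prod => i _.
  by apply: measurableT_comp; [exact: measurable_normal_pdf|exact: measurable_tnth].
have pdf0 (t : d.-tuple R) : (0 <= (\prod_(i < d) normal_pdf 0 1 (tnth t i))%:E)%E.
  by rewrite lee_fin prodr_ge0// => i _; exact: normal_pdf_ge0.
have inner (x : d.-tuple R) : (\int[lebesgue_tuple d]_y
    ((F (x, y))%:E * (\prod_(i < d) normal_pdf 0 1 (tnth y i))%:E) =
    \int[gauss_tuple d]_y (F (x, y))%:E)%E.
  apply: (lebesgue_gauss_tuple (f := fun y => (F (x, y))%:E)) => //.
  exact: (measurableT_comp mF (pair1_measurable x)).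
transitivity (\int[lebesgue_tuple d]_x ((\int[gauss_tuple d]_y (F (x, y))%:E) *
    (\prod_(i < d) normal_pdf 0 1 (tnth x i))%:E))%E; last first.
  rewrite lebesgue_gauss_tuple; last 2 first.
  - exact: (measurable_fun_fubini_tonelli_F (m2 := gauss_tuple d) _ mF F0).
  - by move=> x; exact: integral_ge0.
  rewrite -(lik_box (fun=> r))// [RHS]integral_mkcond.
  apply: (eq_trans (esym (fubini_tonelli1 (m1 := gauss_tuple d)
    (m2 := gauss_tuple d) _ mF F0))).
  apply: eq_integral => p _; rewrite patchE /F /= indicE.
  by case: ifP => _; rewrite ?mulr1 ?mulr0.
pose D := [set t : (d + d).-tuple R | forall i,
      A i (tnth t (lshift d i)) /\ B i (tnth t (rshift d i))].
pose H (t : (d + d).-tuple R) := (mvnormal_pdf (corr_cov d r) t * \1_D t)%:E.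
pose un (t : (d + d).-tuple R) : d.-tuple R * d.-tuple R :=
  ([tuple tnth t (lshift d i) | i < d], [tuple tnth t (rshift d i) | i < d]).
have unK (x y : d.-tuple R) : un [tuple of x ++ y] = (x, y).
  rewrite /un; congr pair; apply: eq_from_tnth => i; rewrite tnth_mktuple.
    by rewrite tnth_lshift.
  by rewrite tnth_rshift.
have catK t : t = [tuple of (un t).1 ++ (un t).2].
  apply: eq_from_tnth => i; rewrite -[i]splitK; case: (fintype.split i) => j /=.
    by rewrite tnth_lshift tnth_mktuple.
  by rewrite tnth_rshift tnth_mktuple.
have HE (x y : d.-tuple R) : H [tuple of x ++ y] =
    ((F (x, y))%:E * (\prod_(i < d) normal_pdf 0 1 (tnth y i))%:E *
      (\prod_(i < d) normal_pdf 0 1 (tnth x i))%:E)%E.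
  rewrite /H mvnormal_pdf_corr_cov// -!EFinM; congr EFin; rewrite /F.
  have -> : \1_D [tuple of x ++ y] = \1_(box A B) (x, y) :> R.
    rewrite !indicE; have -> : ([tuple of x ++ y] \in D) = ((x, y) \in box A B) => //.
    apply/idP/idP => /set_mem Hi; apply/mem_set => i; have := Hi i => /=.
    - by rewrite tnth_lshift tnth_rshift.
    - by rewrite tnth_lshift tnth_rshift.
  by ring.
have H0 t : (0 <= H t)%E by rewrite (catK t) HE !mule_ge0.
have mun : measurable_fun setT un.
  apply: measurable_fun_pair; apply/measurable_fun_tnthP => i.
    rewrite (_ : _ \o _ = (fun t => tnth t (lshift d i))).
      exact: measurable_tnth.
    by apply/funext => t /=; rewrite tnth_mktuple.
  rewrite (_ : _ \o _ = (fun t => tnth t (rshift d i))).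
    exact: measurable_tnth.
  by apply/funext => t /=; rewrite tnth_mktuple.
have mH : measurable_fun setT H.
  rewrite (_ : H = fun t => ((F (un t))%:E *
      (\prod_(i < d) normal_pdf 0 1 (tnth (un t).2 i))%:E *
      (\prod_(i < d) normal_pdf 0 1 (tnth (un t).1 i))%:E)%E); last first.
    by apply/funext => t; rewrite [in LHS](catK t) HE.
  apply: emeasurable_funM; first apply: emeasurable_funM.
  - exact: (measurableT_comp mF mun).
  - by apply: (measurableT_comp mpdf); exact: (measurableT_comp measurable_snd mun).
  - by apply: (measurableT_comp mpdf); exact: (measurableT_comp measurable_fst mun).
transitivity (\int[lebesgue_tuple (d + d)]_t H t)%E.
  rewrite [LHS]integral_mkcond; apply: eq_integral => t _.
  rewrite patchE /H indicE -/D.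
  by case: ifP => _; rewrite ?mulr1 ?mulr0.
rewrite lebesgue_tuple_cat//; apply: eq_integral => x _.
rewrite -inner -ge0_integralZr//; last 2 first.
- apply: emeasurable_funM => //.
  exact: (measurableT_comp mF (pair1_measurable x)).
- by move=> y _; exact: mule_ge0.
by apply: eq_integral => y _; exact: HE.
Qed.

End corr_cov.

(** * Graphs as families of real entries *)

Section coordinates.
Context {R : realType} (n d : nat).

(** Edge weights and feature coordinates are put on the same footing: they differ only in their
    correlation and in how a permutation of the vertices moves them. *)
Definition entry : finType := (edge n + 'I_n * 'I_d)%type.

Definition entry_val (G : featured_graph R n d) (c : entry) : R :=
  match c with inl e => weight G e | inr p => tnth (feature G p.1) p.2 end.

Definition entry_perm (s : 'S_n) (c : entry) : entry :=
  match c with inl e => inl (edge_image s e) | inr p => inr (s p.1, p.2) end.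

Definition mkgraph (x : entry -> R) : featured_graph R n d :=
  ([tuple x (inl (enum_val i)) | i < #|edge n|],
   [tuple [tuple x (inr (u, i)) | i < d] | u < n]).

Lemma entry_val_mkgraph x c : entry_val (mkgraph x) c = x c.
Proof.
case: c => [e|[u i]] /=.
  by rewrite /weight /edge_weights/= tnth_mktuple enum_rankK.
by rewrite /feature /features/= !tnth_mktuple.
Qed.

Lemma mkgraph_entry_val G : mkgraph (entry_val G) = G.
Proof.
case: G => a b; congr pair; apply: eq_from_tnth => i; rewrite tnth_mktuple.
  by rewrite /= /weight /edge_weights/= enum_valK.
by apply: eq_from_tnth => j; rewrite tnth_mktuple.
Qed.

Lemma edge_imageM (s t : 'S_n) (e : edge n) :
  edge_image (s * t)%g e = edge_image t (edge_image s e).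
Proof.
apply/val_inj => /=; rewrite -imset_comp; apply: eq_imset => u /=.
by rewrite permM.
Qed.

Lemma edge_image1 (e : edge n) : edge_image 1%g e = e.
Proof.
apply/val_inj => /=; rewrite -[RHS]imset_id; apply: eq_imset => u /=.
by rewrite perm1.
Qed.

Lemma entry_permM (s t : 'S_n) c :
  entry_perm (s * t)%g c = entry_perm t (entry_perm s c).
Proof. by case: c => [e|[u i]] /=; rewrite ?edge_imageM ?permM. Qed.

Lemma entry_perm1 c : entry_perm 1%g c = c.
Proof. by case: c => [e|[u i]] /=; rewrite ?edge_image1 ?perm1. Qed.

Lemma entry_permK s : cancel (entry_perm s) (entry_perm s^-1%g).
Proof. by move=> c; rewrite -entry_permM mulgV entry_perm1. Qed.

Lemma entry_permKV s : cancel (entry_perm s^-1%g) (entry_perm s).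
Proof. by move=> c; rewrite -entry_permM mulVg entry_perm1. Qed.

Local Notation N := #|entry|.
Local Notation T := (N.-tuple R).
Local Notation GG := (featured_graph R n d * featured_graph R n d)%type.

(** Entries matched by [s] sit at equal indices, so that the correlated pairs are the pairs of equal
    index, whatever [s] is. *)
Definition aligned (s : 'S_n) (G : GG) : T * T :=
  ([tuple entry_val G.1 (enum_val i) | i < N],
   [tuple entry_val G.2 (entry_perm s (enum_val i)) | i < N]).

Definition unaligned (s : 'S_n) (p : T * T) : GG :=
  (mkgraph (fun c => tnth p.1 (enum_rank c)),
   mkgraph (fun c => tnth p.2 (enum_rank (entry_perm s^-1%g c)))).

Lemma alignedK s : cancel (aligned s) (unaligned s).
Proof.
move=> [G1 G2]; congr pair => /=.
  rewrite -[RHS]mkgraph_entry_val; congr mkgraph; apply/funext => c.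
  by rewrite tnth_mktuple enum_rankK.
rewrite -[RHS]mkgraph_entry_val; congr mkgraph; apply/funext => c.
by rewrite tnth_mktuple enum_rankK entry_permKV.
Qed.

Lemma measurable_mktuple dT (X : measurableType dT) dY (Y : measurableType dY) m
    (f : 'I_m -> X -> Y) : (forall i, measurable_fun setT (f i)) ->
  measurable_fun setT (fun x => [tuple f i x | i < m]).
Proof.
move=> mf; apply/measurable_fun_tnthP => i.
rewrite (_ : _ \o _ = f i)//.
by apply/funext => x /=; rewrite tnth_mktuple.
Qed.

Lemma measurable_mkgraph dT (X : measurableType dT) (f : entry -> X -> R) :
  (forall c, measurable_fun setT (f c)) ->
  measurable_fun setT (fun x => mkgraph (fun c => f c x)).
Proof.
move=> mf; apply: measurable_fun_pair; apply: measurable_mktuple => i //.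
exact: measurable_mktuple.
Qed.

Lemma measurable_entry_val c : measurable_fun setT (fun G : featured_graph R n d => entry_val G c).
Proof.
case: c => [e|[u i]] /=.
  exact: (measurableT_comp (measurable_tnth (enum_rank e)) measurable_fst).
apply: (measurableT_comp (measurable_tnth i)).
exact: (measurableT_comp (measurable_tnth u) measurable_snd).
Qed.

Lemma measurable_aligned s : measurable_fun setT (aligned s).
Proof.
apply: measurable_fun_pair; apply: measurable_mktuple => i.
  exact: (measurableT_comp (measurable_entry_val _) measurable_fst).
exact: (measurableT_comp (measurable_entry_val _) measurable_snd).
Qed.

Lemma measurable_unaligned s : measurable_fun setT (unaligned s).
Proof.
apply: measurable_fun_pair; apply: measurable_mkgraph => c.
  exact: (measurableT_comp (measurable_tnth _) measurable_fst).
exact: (measurableT_comp (measurable_tnth _) measurable_snd).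
Qed.

End coordinates.

Lemma measurable_preimageT dX (X : measurableType dX) dY (Y : measurableType dY)
    (f : X -> Y) (A : set Y) :
  measurable_fun setT f -> measurable A -> measurable (f @^-1` A).
Proof. by move=> mf mA; rewrite -[X in measurable X]setTI; exact: mf. Qed.

Lemma measurable_forall dX (X : measurableType dX) (I : finType) (S : I -> set X) :
  (forall i, measurable (S i)) -> measurable [set x | forall i, S i x].
Proof.
move=> mS; rewrite (_ : [set x | _] = \bigcap_(i in [set: I]) S i).
  by apply: fin_bigcap_measurable => // i _; exact: mS.
by apply/seteqP; split=> x /= H i; [move=> _|]; exact: H.
Qed.

(** * The law of the pair of graphs *)

Section wigner_law.
Context {R : realType} (n d : nat) (rho r : R).
Hypotheses (rho01 : 0 < rho < 1) (r01 : 0 < r < 1).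
Context dO (Omega : measurableType dO) (P : {measure set Omega -> \bar R}).
Variables (s : 'S_n)
  (G : Omega -> featured_graph R n d * featured_graph R n d).
Hypotheses (mG : measurable_fun setT G) (cwG : correlated_wigner P rho r s G).
Local Notation N := #|entry n d|.
Local Open Scope ereal_scope.

Definition entry_corr (c : entry n d) : R := if c is inl _ then rho else r.

(** A box is an event on the edges intersected with one on the features. The three clauses of the
    model split its probability in turn: edges from features, edge from edge, vertex from vertex;
    the normal density then splits a feature into its coordinates. *)
Lemma wigner_box (A B : 'I_N -> set R) :
  (forall i, measurable (A i)) -> (forall i, measurable (B i)) ->
  P ((@aligned R n d s \o G) @^-1` box A B) =
  \prod_(i < N) corr_rect (entry_corr (enum_val i)) (A i) (B i).
Proof.
move=> mA mB; have [[Eind Enorm] [Find Fnorm] EFind] := cwG.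
pose A' c := A (enum_rank c); pose B' c := B (enum_rank c).
pose RE (e : edge n) := [set t : (1 + 1).-tuple R | forall i : 'I_1,
  A' (inl e) (tnth t (lshift 1 i)) /\ B' (inl e) (tnth t (rshift 1 i))].
pose RF (u : 'I_n) := [set t : (d + d).-tuple R | forall i : 'I_d,
  A' (inr (u, i)) (tnth t (lshift d i)) /\ B' (inr (u, i)) (tnth t (rshift d i))].
have mRE e : measurable (RE e).
  apply: measurable_forall => i; apply: measurableI.
    exact: (measurable_preimageT (measurable_tnth _) (mA _)).
  exact: (measurable_preimageT (measurable_tnth _) (mB _)).
have mRF u : measurable (RF u).
  apply: measurable_forall => i; apply: measurableI.
    exact: (measurable_preimageT (measurable_tnth _) (mA _)).
  exact: (measurable_preimageT (measurable_tnth _) (mB _)).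
pose AE := [set p : #|edge n|.-tuple R * #|edge n|.-tuple R | forall e,
  A' (inl e) (tnth p.1 (enum_rank e)) /\
  B' (inl e) (tnth p.2 (enum_rank (edge_image s e)))].
pose AF := [set p : n.-tuple (d.-tuple R) * n.-tuple (d.-tuple R) |
  forall c : 'I_n * 'I_d, A' (inr c) (tnth (tnth p.1 c.1) c.2) /\
  B' (inr c) (tnth (tnth p.2 (s c.1)) c.2)].
have mAE : measurable AE.
  apply: measurable_forall => i; apply: measurableI.
    apply: (measurable_preimageT _ (mA _)).
    exact: (measurableT_comp (measurable_tnth _) measurable_fst).
  apply: (measurable_preimageT _ (mB _)).
  exact: (measurableT_comp (measurable_tnth _) measurable_snd).
have mAF : measurable AF.
  apply: measurable_forall => i; apply: measurableI.
    apply: (measurable_preimageT _ (mA _)).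
    apply: (measurableT_comp (measurable_tnth _)).
    exact: (measurableT_comp (measurable_tnth _) measurable_fst).
  apply: (measurable_preimageT _ (mB _)).
  apply: (measurableT_comp (measurable_tnth _)).
  exact: (measurableT_comp (measurable_tnth _) measurable_snd).
transitivity (P ((fun w => (edge_weights (G w).1, edge_weights (G w).2)) @^-1` AE `&`
    (fun w => (features (G w).1, features (G w).2)) @^-1` AF)).
  congr (P _); apply/seteqP; split=> w /=.
    move=> H; split=> c.
      have := H (enum_rank (inl c : entry n d)).
      by rewrite /= !tnth_mktuple enum_rankK.
    have := H (enum_rank (inr c : entry n d)).
    by rewrite /= !tnth_mktuple enum_rankK; case: c.
  move=> [HE HF] i; rewrite /= !tnth_mktuple.
  case: (enum_val i) (enum_valK i) => [e <-|c <-].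
    exact: HE.
  exact: HF.
rewrite EFind//.
have -> : (fun w => (edge_weights (G w).1, edge_weights (G w).2)) @^-1` AE =
    \bigcap_(e in [set` [set: edge n]%SET])
      (fun w => [tuple weight (G w).1 e; weight (G w).2 (edge_image s e)]) @^-1` RE e.
  apply/seteqP; split=> w /= H.
    by move=> e _ i; rewrite ord1; exact: H.
  by move=> e; have := H e (finset.in_setT _) ord0.
rewrite Eind//.
have -> : (fun w => (features (G w).1, features (G w).2)) @^-1` AF =
    \bigcap_(u in [set` [set: 'I_n]%SET])
      (fun w => tuple_pair (feature (G w).1 u) (feature (G w).2 (s u))) @^-1` RF u.
  apply/seteqP; split=> w /= H.
    by move=> u _ i; rewrite /= /tuple_pair tnth_lshift tnth_rshift; exact: (H (u, i)).
  move=> [u i]; have := H u (finset.in_setT _) i.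
  by rewrite /tuple_pair tnth_lshift tnth_rshift.
rewrite Find//.
transitivity (\prod_(c : entry n d) corr_rect (entry_corr c) (A' c) (B' c)); last first.
  by rewrite -big_enum_valT; apply: eq_bigr => i _; rewrite /A' /B' enum_valK.
rewrite big_sumType/=; congr (_ * _).
  apply: eq_big => e; rewrite ?finset.in_setT// => _.
  rewrite (Enorm e _ (mRE e)) (integral_corr_cov_rect (d := 1) (A := fun=> A' (inl e))
    (B := fun=> B' (inl e)))//.
  - by rewrite big_ord1.
  - by move=> _; exact: mA.
  - by move=> _; exact: mB.
transitivity (\prod_u \prod_i corr_rect r (A' (inr (u, i))) (B' (inr (u, i)))).
  apply: eq_big => u; rewrite ?finset.in_setT// => _.
  rewrite (Fnorm u _ (mRF u)) (integral_corr_cov_rect (A := fun i => A' (inr (u, i)))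
    (B := fun i => B' (inr (u, i))))// => i; first exact: mA.
  exact: mB.
rewrite pair_bigA/=; apply: eq_bigr => -[u i] _ //.
Qed.

Lemma wigner_law X : P setT < +oo -> measurable X ->
  P (G @^-1` X) = \int[gauss_tuple N \x gauss_tuple N]_(p in unaligned s @^-1` X)
    (lik (fun i => entry_corr (enum_val i)) p)%:E.
Proof.
move=> Poo mX.
have mZ : measurable_fun setT (@aligned R n d s \o G).
  exact: (measurableT_comp (measurable_aligned s) mG).
have mX' : measurable (@unaligned R n d s @^-1` X).
  exact: (measurable_preimageT (measurable_unaligned s)).
rewrite -(law_lik mZ Poo wigner_box mX').
by congr (P _); apply/seteqP; split=> w /=; rewrite alignedK.
Qed.

End wigner_law.

(** * Moments of the likelihood and the change of measure *)

Section renyi.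
Context {R : realType} (N : nat).
Local Notation T := (N.-tuple R).
Local Notation Q := (@gauss_tuple R N \x @gauss_tuple R N)%E.

Definition loglik (q : 'I_N -> R) (p : T * T) : R :=
  \sum_(i < N) lell (q i) (tnth p.1 i) (tnth p.2 i).

Lemma likE q p : lik q p = expR (loglik q p).
Proof. by rewrite /lik /loglik expR_sum. Qed.

(** Concavity of the logarithm, as [1 - t ^+ 2 * q ^+ 2] is the average of [1 - q ^+ 2] and 1 with
    weights [t ^+ 2] and [1 - t ^+ 2]. *)
Lemma ln_sq_concave (q t : R) : 0 < q < 1 -> 0 <= t <= 1 ->
  t ^+ 2 * ln (1 - q ^+ 2) <= ln (1 - t ^+ 2 * q ^+ 2).
Proof.
move=> q01 /andP[t0 t1]; have k0 := sq_lt1 q01.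
have t21 : t ^+ 2 <= 1 by rewrite expr_le1.
have v0 : 0 < 1 - t ^+ 2 * q ^+ 2.
  have := sqr_ge0 t; have := sqr_ge0 q.
  by move: (t21) (k0); clear; set a := t ^+ 2; set b := q ^+ 2; nra.
(* Jensen's inequality for the exponential, through its tangent at 0 *)
pose a := ln (1 - q ^+ 2); pose v := ln (1 - t ^+ 2 * q ^+ 2).
have h1 := expR_ge1Dx (a - v); have h2 := expR_ge1Dx (- v).
have ea : expR a = 1 - q ^+ 2 by rewrite lnK.
have ev : expR v = 1 - t ^+ 2 * q ^+ 2 by rewrite lnK.
have ev0 := expR_gt0 v.
have h1' : (1 + (a - v)) * expR v <= expR a.
  have -> : expR a = expR (a - v) * expR v by rewrite -expRD subrK.
  by rewrite ler_pM2r.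
have h2' : (1 + - v) * expR v <= 1.
  rewrite [leRHS](_ : 1 = expR (- v) * expR v); first by rewrite ler_pM2r.
  by rewrite -expRD addNr expR0.
rewrite -/a -/v.
have t20 := sqr_ge0 t.
have : t ^+ 2 * ((1 + (a - v)) * expR v) + (1 - t ^+ 2) * ((1 + - v) * expR v) <=
  t ^+ 2 * expR a + (1 - t ^+ 2) * 1.
  by apply: lerD; apply: ler_wpM2l => //; rewrite subr_ge0.
have -> : t ^+ 2 * ((1 + (a - v)) * expR v) + (1 - t ^+ 2) * ((1 + - v) * expR v) =
  expR v + (t ^+ 2 * a - v) * expR v by ring.
have -> : t ^+ 2 * expR a + (1 - t ^+ 2) * 1 = expR v by rewrite ea ev; ring.
rewrite gerDl => h; rewrite -subr_le0.
by rewrite -(pmulr_lle0 _ ev0).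
Qed.

(** The moment is a product over the coordinates. Concavity bounds the second logarithm of each
    factor, so that only the total information remains, with coefficient [t + t ^+ 2]; the excess
    over [t] is of second order, which lets a small [t] win. *)
Lemma lik_renyi_le (q : 'I_N -> R) (t : R) : (forall i, 0 < q i < 1) -> 0 <= t < 1 ->
  (\int[Q]_p (expR ((1 + t) * loglik q p))%:E <=
   (expR ((t + t ^+ 2) * \sum_(i < N) - (ln (1 - q i ^+ 2) / 2)))%:E)%E.
Proof.
move=> q01 t01.
under eq_integral do rewrite /loglik mulr_sumr expR_sum -prodEFin.
rewrite (ge0_integral_gauss_prod2 (g := fun i x y =>
  (expR ((1 + t) * lell (q i) x y))%:E)); last 2 first.
- move=> i; apply/measurable_EFinP.
  apply: (measurableT_comp (@measurable_expR R)).
  by apply: measurable_funM => //; exact: measurable_lell.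
- by move=> i x y; rewrite lee_fin expR_ge0.
under eq_bigr do rewrite gauss1_lell_renyi//.
rewrite prodEFin lee_fin -expR_sum ler_expR mulr_sumr ler_sum// => i _.
have := @ln_sq_concave (q i) t (q01 i).
case/andP: t01 => t0 t1; rewrite t0 ltW// => /(_ isT).
set a := ln _; set b := ln _; lra.
Qed.

(** Pointwise, [lik] is at most [expR tau] where [loglik] is at most [tau], and elsewhere at most
    [expR ((1 + t) * loglik - t * tau)]. *)
Lemma lik_change_of_measure (q : 'I_N -> R) (t tau : R) (X : set (T * T)) :
  (forall i, 0 < q i < 1) -> 0 <= t < 1 -> measurable X ->
  (\int[Q]_(p in X) (lik q p)%:E <=
   (expR ((t + t ^+ 2) * (\sum_(i < N) - (ln (1 - q i ^+ 2) / 2)) - t * tau))%:E +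
   (expR tau)%:E * Q X)%E.
Proof.
move=> q01 t01 mX.
have mloglik : measurable_fun setT (loglik q).
  apply: measurable_sum => i.
  exact: (measurableT_comp (measurable_lell (q i)) (measurable_tnth_pair i)).
have m1 : measurable_fun setT (fun p : T * T => (expR ((1 + t) * loglik q p))%:E).
  apply/measurable_EFinP; apply: (measurableT_comp (@measurable_expR R)).
  by apply: measurable_funM.
rewrite integral_mkcond.
apply: (@le_trans _ _ (\int[Q]_p ((expR (- (t * tau)))%:E *
    (expR ((1 + t) * loglik q p))%:E + (expR tau)%:E * (\1_X p)%:E))%E).
  apply: ge0_le_integral => //.
  - by move=> p _; rewrite patchE; case: ifP => // _; rewrite lee_fin lik_ge0.
  - by apply/(measurable_restrictT _ mX); exact: measurable_funTS (measurable_lik q).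
  - apply: emeasurable_funD; apply: measurable_funeM => //.
    by apply/measurable_EFinP; exact: measurable_indic.
  move=> p _; rewrite -!EFinM -EFinD patchE indicE.
  case: ifP => _; rewrite lee_fin ?mulr0 ?addr0 ?mulr1; last first.
    by rewrite mulr_ge0 ?expR_ge0.
  rewrite likE -expRD; case/andP: t01 => t0 _.
  have [le|/ltW ge] := leP (loglik q p) tau.
    by rewrite ler_wpDl ?expR_ge0// ler_expR.
  rewrite ler_wpDr ?expR_ge0// ler_expR.
  have : 0 <= t * (loglik q p - tau) by rewrite mulr_ge0// subr_ge0.
  by lra.
rewrite ge0_integralD//; last 2 first.
- exact: measurable_funeM.
- by apply: measurable_funeM; apply/measurable_EFinP; exact: measurable_indic.
rewrite !ge0_integralZl_EFin ?expR_ge0//; last first.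
  by apply/measurable_EFinP; exact: measurable_indic.
rewrite integral_indic// setIT; apply: leeD2r.
rewrite (addrC _ (- (t * tau))) expRD EFinM.
by apply: lee_wpmul2l; [rewrite lee_fin expR_ge0|exact: lik_renyi_le].
Qed.

End renyi.

(** * Counting permutations by their agreement with a given one *)

Section card_agree.
Local Open Scope set_scope.

(** The permutations that agree with [t] on a fixed [k]-set form a coset of those that fix this set,
    of size [(n - k)!]. The union over the [k]-sets has at most ['C(n, k) * (n - k)!] elements,
    which is [n! / k!]. *)
Lemma card_agree_perm n (t : 'S_n) (k : nat) :
  (#|[set s : 'S_n | k <= #|[pred v | t v == s v]|]| * k`! <= n`!)%N.
Proof.
have [kn|nk] := leqP k n; last first.
  rewrite (_ : [set s | _] = finset.set0) ?cards0//.
  apply/setP => s; rewrite !inE; apply/negbTE; rewrite -ltnNge.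
  by rewrite (leq_ltn_trans (max_card _))// card_ord.
pose F (A : {set 'I_n}) := [set s : 'S_n | perm_on (~: A) (s * t^-1)%g].
have cF (A : {set 'I_n}) : #|A| = k -> #|F A| = (n - k)`!.
  move=> Ak; have -> : F A = (fun s => s * t)%g @: [set s : 'S_n | perm_on (~: A) s].
    apply/setP => s; rewrite inE; apply/idP/imsetP => [h|[u + ->]].
      by exists (s * t^-1)%g; rewrite ?inE// mulgKV.
    by rewrite inE mulgK.
  rewrite card_imset; last exact: mulIg.
  by rewrite cardsE card_perm cardsCs finset.setCK card_ord Ak.
have sub : [set s : 'S_n | (k <= #|[pred v | t v == s v]|)%N] \subset
    \bigcup_(A in [set A : {set 'I_n} | #|A| == k]) F A.
  apply/fintype.subsetP => s; rewrite inE => ks.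
  have [A /andP[/eqP Ak /fintype.subsetP sA]] : exists A : {set 'I_n},
      (#|A| == k) && (A \subset [set v | t v == s v]).
    have : (0 < #|[set A : {set 'I_n} | A \subset [set v | t v == s v] & #|A| == k]|)%N.
      by rewrite cards_draws bin_gt0 cardsE.
    by case/card_gt0P => A; rewrite inE => /andP[? ?]; exists A; apply/andP.
  apply/finset.bigcupP; exists A; rewrite ?inE ?Ak//.
  apply/fintype.subsetP => v; rewrite !inE permM; apply: contra => vA.
  have := sA v vA; rewrite inE => /eqP <-.
  by rewrite permK.
have cU : (#|[set s : 'S_n | (k <= #|[pred v | t v == s v]|)%N]| <=
    'C(n, k) * (n - k)`!)%N.
  apply: (leq_trans (subset_leq_card sub)).
  apply: (@leq_trans (\sum_(A in [set A : {set 'I_n} | #|A| == k]) #|F A|)).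
    elim/big_rec2: _ => [|A B m _ le]; first by rewrite cards0.
    by rewrite (leq_trans (leq_card_setU _ _))// leq_add2l.
  rewrite (eq_bigr (fun=> (n - k)`!)) => [|A]; last by rewrite inE => /eqP /cF.
  by rewrite sum_nat_const cardsE -[X in 'C(X, _)]card_ord -card_draws cardsE.
rewrite -(bin_fact kn) [(k`! * _)%N]mulnC mulnA.
by rewrite leq_mul2r cU orbT.
Qed.

End card_agree.

Lemma measure_bigsetU_le d (T : measurableType d) (R : realType)
    (P : {measure set T -> \bar R}) (I : Type) (s : seq I) (F : I -> set T) :
  (forall i, measurable (F i)) ->
  (P (\big[setU/set0]_(i <- s) F i) <= \sum_(i <- s) P (F i))%E.
Proof.
move=> mF; elim: s => [|i s IHs]; first by rewrite !big_nil measure0.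
rewrite !big_cons; apply: (le_trans (measureU2 _ _ _)) => //.
  exact: bigsetU_measurable.
exact: leeD2l.
Qed.

(** * Invariance of the null law under permutations of the coordinates *)

Section rearrange.
Context {R : realType} (N : nat).
Local Notation T := (N.-tuple R).
Local Notation Q := (@gauss_tuple R N \x @gauss_tuple R N)%E.

(** [bool * 'I_N] numbers all the [2 N] coordinates of a pair of tuples, [true] standing for the
    first tuple. *)
Definition pick_coord (p : T * T) (j : bool * 'I_N) : R :=
  tnth (if j.1 then p.1 else p.2) j.2.

Definition rearrange (f : bool * 'I_N -> bool * 'I_N) (p : T * T) : T * T :=
  ([tuple pick_coord p (f (true, i)) | i < N],
   [tuple pick_coord p (f (false, i)) | i < N]).

Lemma measurable_pick_coord j : measurable_fun setT (pick_coord ^~ j).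
Proof.
case: j => [[] i]; rewrite /pick_coord/=.
  exact: (measurableT_comp (measurable_tnth i) measurable_fst).
exact: (measurableT_comp (measurable_tnth i) measurable_snd).
Qed.

Lemma measurable_rearrange f : measurable_fun setT (rearrange f).
Proof.
by apply: measurable_fun_pair; apply: measurable_mktuple => i;
  exact: measurable_pick_coord.
Qed.

Lemma gauss_box (A : bool * 'I_N -> set R) : (forall j, measurable (A j)) ->
  (Q [set p | forall j, A j (pick_coord p j)] = \prod_j gauss1 (A j))%E.
Proof.
move=> mA.
have mb : measurable [set p | forall j, A j (pick_coord p j)].
  apply: measurable_forall => j.
  exact: (measurable_preimageT (measurable_pick_coord j)).
rewrite -[in LHS](setIT [set p | _]) -integral_indic//.
transitivity (\int[Q]_p \prod_(i < N) (\1_(A (true, i)) (tnth p.1 i) *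
    \1_(A (false, i)) (tnth p.2 i))%:E)%E.
  apply: eq_integral => p _; rewrite prodEFin indicE; congr EFin.
  case: (pselect (forall j, A j (pick_coord p j))) => Hp.
    rewrite mem_set// big1// => i _.
    by rewrite !indicE !mem_set ?mulr1.
  rewrite memNset//; move/existsNP : Hp => [[b i] Hi].
  rewrite (bigD1 i)//= !indicE.
  by case: b Hi => Hi; rewrite (memNset Hi) ?mulr0 !mul0r.
rewrite (ge0_integral_gauss_prod2 (g := fun i x y =>
  (\1_(A (true, i)) x * \1_(A (false, i)) y)%:E)); last 2 first.
- move=> i; apply/measurable_EFinP; apply: measurable_funM.
    exact: (measurableT_comp (measurable_indic (mA _))).
  exact: (measurableT_comp (measurable_indic (mA _))).
- by move=> i x y; rewrite lee_fin mulr_ge0.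
have -> : (\prod_j gauss1 (A j) = \prod_(i < N) \prod_(b : bool) gauss1 (A (b, i)))%E.
  rewrite exchange_big pair_bigA/=; by apply: eq_bigr => -[b i].
apply: eq_bigr => i _; rewrite big_bool/=.
under eq_integral => x _.
  under eq_integral do rewrite EFinM.
  rewrite ge0_integralZl_EFin//; last first.
    by apply/measurable_EFinP; exact: (measurable_indic (mA _)).
  rewrite integral_indic ?setIT; [|exact: measurableT|exact: mA]; over.
rewrite /= ge0_integralZr//; last first.
  by apply/measurable_EFinP; exact: (measurable_indic (mA _)).
by rewrite integral_indic ?setIT//; exact: mA.
Qed.

(** The [2 N] coordinates are i.i.d., so a bijection of the indices only permutes the factors of the
    probability of a box. It serves to realign the second graph and to exchange blocks in the
    decoupling. *)
Lemma gauss_rearrange f g X : cancel f g -> cancel g f -> measurable X ->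
  Q (rearrange f @^-1` X) = Q X.
Proof.
move=> fK gK mX.
pose m1 : {measure set (T * T) -> \bar R} :=
  measure_function_pushforward__canonical__measure_function_Measure
    Q (measurable_rearrange f).
have Q1 : Q setT = 1%E.
  transitivity (Q ([set: T] `*` [set: T])); first by rewrite setXTT.
  rewrite product_measure1E// -[RHS]mule1.
  by congr (_ * _)%E; exact: probability_setT.
apply: (@measure_eq_boxes _ _ m1 Q) => //.
  by rewrite /m1 /= /pushforward preimage_setT Q1 ltry.
move=> A B mA mB.
pose C (j : bool * 'I_N) := if j.1 then A j.2 else B j.2.
have mC j : measurable (C j) by rewrite /C; case: ifP.
have -> : box A B = [set p | forall j, C j (pick_coord p j)].
  apply/seteqP; split=> p /= H.
    by move=> [[] i]; have [] := H i.
  by move=> i; split; [exact: (H (true, i))|exact: (H (false, i))].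
apply: (eq_trans _ (esym (gauss_box mC))); rewrite /m1/= /pushforward.
have -> : rearrange f @^-1` [set p | forall j, C j (pick_coord p j)] =
    [set p | forall j, C (g j) (pick_coord p j)].
  apply/seteqP; split=> p /= H j.
    have := H (g j); case gj : (g j) => [[] i]; rewrite /pick_coord/= tnth_mktuple.
      by rewrite -gj gK.
    by rewrite -gj gK.
  case: j => -[] i; rewrite /pick_coord/= tnth_mktuple.
    by rewrite -[X in C X](fK (true, i)); exact: H.
  by rewrite -[X in C X](fK (false, i)); exact: H.
rewrite (gauss_box (fun j => mC (g j))) (reindex f)/=; last by exists g => j _.
by apply: eq_bigr => j _; rewrite fK.
Qed.

End rearrange.

Lemma sum_pred_card (R : realType) (I : finType) (b : pred I) :
  \sum_i (b i)%:R = #|[pred i | b i]|%:R :> R.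
Proof.
rewrite -sum1_card natr_sum [RHS]big_mkcond/=; apply: eq_bigr => i _.
by rewrite inE; case: (b i).
Qed.

(** * Impossibility: success under the null law and under the model *)

Section converse.
Context {R : realType} (n d : nat) (rho r : R).
Hypotheses (rho01 : 0 < rho < 1) (r01 : 0 < r < 1).
Local Notation N := #|entry n d|.
Local Notation T := (N.-tuple R).
Local Notation Q := (@gauss_tuple R N \x @gauss_tuple R N)%E.
Local Notation GG := (featured_graph R n d * featured_graph R n d)%type.

(** A change of alignment only permutes the coordinates of the second tuple. *)
Lemma gauss_unaligned (s : 'S_n) (X : set GG) : measurable X ->
  Q (unaligned s @^-1` X) = Q (unaligned 1%g @^-1` X).
Proof.
move=> mX.
pose f (j : bool * 'I_N) := if j.1 then j else
  (j.1, enum_rank (entry_perm s^-1%g (enum_val j.2))).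
pose g (j : bool * 'I_N) := if j.1 then j else
  (j.1, enum_rank (entry_perm s (enum_val j.2))).
have fK : cancel f g.
  by move=> [[] i]; rewrite /f /g//= enum_rankK entry_permKV enum_valK.
have gK : cancel g f.
  by move=> [[] i]; rewrite /f /g//= enum_rankK entry_permK enum_valK.
have mX' : measurable ((@unaligned R n d 1%g) @^-1` X).
  exact: (measurable_preimageT (measurable_unaligned _)).
have -> : @unaligned R n d s = unaligned 1%g \o rearrange f.
  apply/funext => p; congr pair; congr mkgraph; apply/funext => c;
    rewrite tnth_mktuple /pick_coord /f//=.
  by rewrite invg1 entry_perm1 enum_rankK.
exact: (gauss_rearrange fK gK mX').
Qed.

Variable hatpi : GG -> 'S_n.
Hypothesis mhatpi : measurable_to_perm hatpi.

Lemma measurable_hatpi (S : pred 'S_n) : measurable [set g | S (hatpi g)].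
Proof.
rewrite (_ : [set g | _] = \big[setU/set0]_(s <- enum S) hatpi @^-1` [set s]).
  by apply: bigsetU_measurable => s _; exact: mhatpi.
rewrite -bigcup_seq; apply/seteqP; split=> g /=.
  by move=> Sg; exists (hatpi g) => //=; rewrite mem_enum.
by move=> [s + ->]; rewrite /= mem_enum.
Qed.

Variables (delta : R) (k : nat).
Hypothesis kdelta : forall m : nat, delta <= m%:R / n%:R -> (k <= m)%N.

Definition success (s : 'S_n) : set GG :=
  [set g | delta <= overlap R (hatpi g) s].

Lemma measurable_success s : measurable (success s).
Proof. exact: (measurable_hatpi (fun t => delta <= overlap R t s)). Qed.

(** With sum and integral exchanged, the graphs are fixed and the estimator outputs a single
    permutation; at most [n! / k!] permutations agree with it on [k] vertices. *)
Lemma sum_success_le :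
  (\sum_(s : 'S_n) Q (unaligned 1%g @^-1` success s) <=
   ((n`!)%:R / (k`!)%:R)%:E)%E.
Proof.
have mS s : measurable (@unaligned R n d 1%g @^-1` success s).
  exact: (measurable_preimageT (measurable_unaligned _) (measurable_success s)).
have Q1 : Q setT = 1%E.
  transitivity (Q ([set: T] `*` [set: T])); first by rewrite setXTT.
  rewrite product_measure1E// -[RHS]mule1.
  by congr (_ * _)%E; exact: probability_setT.
under eq_bigr => s _ do rewrite -[X in Q X]setIT -integral_indic//.
rewrite -ge0_integral_sum//; last first.
  by move=> s; apply/measurable_EFinP; exact: measurable_indic.
apply: (@le_trans _ _ (\int[Q]_p (((n`!)%:R / (k`!)%:R)%:E : \bar R))%E); last first.
  by rewrite integral_cst//= Q1 mule1.
apply: ge0_le_integral => //.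
- by move=> p _; apply: sume_ge0 => s _; rewrite lee_fin.
- by apply: emeasurable_sum => s; apply/measurable_EFinP; exact: measurable_indic.
move=> p _; rewrite sumEFin lee_fin ler_pdivlMr ?ltr0n ?fact_gt0//.
have -> : \sum_(s : 'S_n) \1_(unaligned 1%g @^-1` success s) p =
    #|[pred s : 'S_n | delta <= overlap R (hatpi (unaligned 1%g p)) s]|%:R :> R.
  rewrite -sum_pred_card; apply: eq_bigr => s _; rewrite indicE.
  by congr ((nat_of_bool _)%:R); apply/idP/idP; rewrite inE.
rewrite -natrM ler_nat; apply: leq_trans (card_agree_perm (hatpi (unaligned 1%g p)) k).
rewrite leq_mul2r; apply/orP; right; apply: subset_leq_card.
by apply/fintype.subsetP => s; rewrite !inE; exact: kdelta.
Qed.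

End converse.

Section correlated_wigner_ext.
Context {R : realType} (n d : nat) (rho r : R) dO (Omega : measurableType dO).
Variables (s : 'S_n)
  (G : Omega -> featured_graph R n d * featured_graph R n d).
Hypothesis mG : measurable_fun setT G.
Variables P1 P2 : set Omega -> \bar R.
Hypothesis P12 : forall A, measurable A -> P1 A = P2 A.

Let mentry1 c : measurable_fun setT (fun w => entry_val (G w).1 c).
Proof.
apply: (measurableT_comp (measurable_entry_val c)).
exact: (measurableT_comp measurable_fst mG).
Qed.

Let mentry2 c : measurable_fun setT (fun w => entry_val (G w).2 c).
Proof.
apply: (measurableT_comp (measurable_entry_val c)).
exact: (measurableT_comp measurable_snd mG).
Qed.

Let medge e : measurable_fun setT
  (fun w => [tuple weight (G w).1 e; weight (G w).2 (edge_image s e)]).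
Proof.
apply/measurable_fun_tnthP => -[[|[|//]] i].
  exact: (mentry1 (inl e)).
exact: (mentry2 (inl (edge_image s e))).
Qed.

Let mfeature u : measurable_fun setT
  (fun w => tuple_pair (feature (G w).1 u) (feature (G w).2 (s u))).
Proof.
have mpair : measurable_fun setT (fun w => (feature (G w).1 u, feature (G w).2 (s u))).
  apply: measurable_fun_pair; apply/measurable_fun_tnthP => i.
    exact: (mentry1 (inr (u, i))).
  exact: (mentry2 (inr (s u, i))).
exact: (measurableT_comp (@measurable_cat_tuple R d d) mpair).
Qed.

Let mutually_independent_ext (I : finType) dT (T : measurableType dT)
    (X : I -> Omega -> T) : (forall i, measurable_fun setT (X i)) ->
  mutually_independent P1 X -> mutually_independent P2 X.
Proof.
move=> mX ind J A mA.
have mXA i : measurable (X i @^-1` A i) by exact: measurable_preimageT.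
rewrite -P12; last first.
  by apply: fin_bigcap_measurable => [|i _]; [exact: finite_finset|exact: mXA].
by rewrite ind//; apply: eq_bigr => i _; exact: P12.
Qed.

(** [cond_prob] is a bare set function, whereas the law of the graphs is computed for a measure. The
    model transfers to a measure with the same values on measurable sets. *)
Lemma correlated_wigner_ext :
  correlated_wigner P1 rho r s G -> correlated_wigner P2 rho r s G.
Proof.
move=> [[Eind Enorm] [Find Fnorm] EF]; split.
- split; first exact: mutually_independent_ext Eind.
  by move=> e A mA; rewrite -P12 ?Enorm//; exact: measurable_preimageT.
- split; first exact: mutually_independent_ext Find.
  by move=> u A mA; rewrite -P12 ?Fnorm//; exact: measurable_preimageT.
have mew : measurable_fun setT (fun w => (edge_weights (G w).1, edge_weights (G w).2)).
  apply: measurable_fun_pair; apply: (measurableT_comp measurable_fst).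
    exact: (measurableT_comp measurable_fst mG).
  exact: (measurableT_comp measurable_snd mG).
have mft : measurable_fun setT (fun w => (features (G w).1, features (G w).2)).
  apply: measurable_fun_pair; apply: (measurableT_comp measurable_snd).
    exact: (measurableT_comp measurable_fst mG).
  exact: (measurableT_comp measurable_snd mG).
move=> A B mA mB.
have mA' := measurable_preimageT mew mA; have mB' := measurable_preimageT mft mB.
by rewrite -!P12 ?EF//; exact: measurableI.
Qed.

End correlated_wigner_ext.

Section converse_probability.
Context {R : realType} (n d : nat) (rho r : R).
Hypotheses (rho01 : 0 < rho < 1) (r01 : 0 < r < 1).
Local Notation N := #|entry n d|.
Local Notation Q := (@gauss_tuple R N \x @gauss_tuple R N)%E.
Local Notation GG := (featured_graph R n d * featured_graph R n d)%type.
Context dO (Omega : measurableType dO) (P : probability Omega R).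
Variables (pistar : Omega -> 'S_n) (G : Omega -> GG).
Hypotheses (mG : measurable_fun setT G) (upi : uniform_perm P pistar).
Hypothesis cwG : forall s,
  correlated_wigner (cond_prob P (pistar @^-1` [set s])) rho r s G.

Let mB s : measurable (pistar @^-1` [set s]).
Proof. by have [H _] := upi; exact: H. Qed.

Let nf : {nonneg R} := ((n`!)%:R : R)%:nng.

(** The conditional probability given [pistar = s] as a measure: the event has probability [1 / n!],
    so the restriction of [P] to it is multiplied by [n!]. *)
Let Ps s : {measure set Omega -> \bar R} := mscale nf (mrestr P (mB s)).

Let PsE s A : measurable A -> Ps s A = cond_prob P (pistar @^-1` [set s]) A.
Proof.
move=> mA; have [_ upiE] := upi.
rewrite /Ps /= /mscale /mrestr /cond_prob upiE/= invrK mulrC EFinM fineK//.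
  by rewrite card_Sn.
by apply: fin_num_measure; exact: measurableI.
Qed.

Let PsT s : Ps s setT = 1%E.
Proof.
have [_ upiE] := upi.
by rewrite PsE// /cond_prob setTI divff// upiE/= gt_eqF// invr_gt0 ltr0n card_Sn fact_gt0.
Qed.

Variable hatpi : GG -> 'S_n.
Hypothesis mhatpi : measurable_to_perm hatpi.
Variables (delta : R) (k : nat).
Hypothesis kdelta : forall m : nat, delta <= m%:R / n%:R -> (k <= m)%N.

(** The mutual information of the two aligned graphs: each summand is that of two standard normals
    with the given correlation. *)
Definition total_info : R :=
  \sum_(i < N) - (ln (1 - entry_corr rho r (enum_val i) ^+ 2) / 2).

(** The event is split by the value of [pistar]. For each value the change of measure applies, with
    a null event whose alignment no longer depends on [s], so that the average over [s] is a
    count. *)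
Lemma prob_success_le (t tau : R) : 0 <= t < 1 ->
  (P [set w | (delta <= overlap R (hatpi (G w)) (pistar w))%R] <=
   (expR ((t + t ^+ 2) * total_info - t * tau) + expR tau / (k`!)%:R)%R%:E)%E.
Proof.
move=> t01.
pose S s := @success R n d hatpi delta s.
have mS s : measurable (S s) by exact: measurable_success.
pose F s := G @^-1` S s `&` pistar @^-1` [set s].
have mGS s : measurable (G @^-1` S s) by exact: measurable_preimageT.
have mF s : measurable (F s) by exact: measurableI.
have q01 i : 0 < entry_corr rho r (enum_val i : entry n d) < 1.
  by rewrite /entry_corr; case: (enum_val i).
rewrite (_ : [set w | _] = \big[setU/set0]_(s <- enum 'S_n) F s); last first.
  rewrite -bigcup_seq; apply/seteqP; split=> w /=.
    by move=> H; exists (pistar w) => //=; rewrite mem_enum inE.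
  by move=> [s _ [+ ws]]; rewrite /S /success/= ws.
apply: (le_trans (measure_bigsetU_le _ _ mF)); rewrite big_enum/=.
set E0 := expR _.
have nfact0 : (n`!)%:R != 0 :> R by rewrite pnatr_eq0 -lt0n fact_gt0.
have bound s : (P (F s) <= (((n`!)%:R)^-1)%:E *
    (E0%:E + (expR tau)%:E * Q (unaligned 1%g @^-1` S s)))%E.
  have -> : P (F s) = (((n`!)%:R)^-1%:E * Ps s (G @^-1` S s))%E.
    by rewrite /Ps /= /mscale /mrestr muleA -EFinM mulVf// mul1e.
  apply: lee_wpmul2l; first by rewrite lee_fin invr_ge0.
  rewrite (@wigner_law _ _ _ rho r _ _ _ _ (Ps s) s)//; last 2 first.
  - by apply: correlated_wigner_ext (cwG s) => // A mA; rewrite PsE.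
  - by rewrite PsT ltry.
  rewrite -(gauss_unaligned s)//; apply: lik_change_of_measure => //.
  exact: (measurable_preimageT (measurable_unaligned _)).
apply: (le_trans (lee_sum _ (fun s _ => bound s))).
rewrite -ge0_sume_distrr; last first.
  by move=> s _; rewrite adde_ge0// ?mule_ge0// lee_fin expR_ge0.
rewrite big_split/= -ge0_sume_distrr//.
rewrite sumEFin sumr_const -[#|_|]/#|{: 'S_n}| card_Sn.
rewrite EFinD muleDr//; apply: leeD.
  by rewrite -EFinM lee_fin -[E0 *+ _]mulr_natl mulKf.
apply: (@le_trans _ _ (((n`!)%:R^-1)%:E * ((expR tau)%:E *
    ((n`!)%:R / (k`!)%:R)%:E))%E).
  apply: lee_wpmul2l; first by rewrite lee_fin invr_ge0.
  by apply: lee_wpmul2l; [rewrite lee_fin expR_ge0|exact: sum_success_le].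
have kfact0 : (k`!)%:R != 0 :> R by rewrite pnatr_eq0 -lt0n fact_gt0.
rewrite -!EFinM lee_fin le_eqVlt; apply/orP; left; apply/eqP; field.
by rewrite nfact0 kfact0.
Qed.

End converse_probability.

(** * Impossibility: estimates as [n] grows *)

Section total_info.
Context {R : realType}.

Lemma card_edge n : #|edge n| = 'C(n, 2).
Proof.
rewrite card_sig -[X in 'C(X, _)]card_ord -card_draws.
by apply: eq_card => A; rewrite !inE.
Qed.

(** The feature parts of the two sides are equal; the edges use ['C(n, 2) <= n ^ 2 / 2]. *)
Lemma total_info_le n d (rho r : R) : 0 < rho < 1 -> 0 < r < 1 ->
  @total_info R n d rho r <= n%:R / 4 * signal n d rho r.
Proof.
move=> rho01 r01.
have L q : 0 < q < 1 -> ln (1 / (1 - q ^+ 2)) = - ln (1 - q ^+ 2) :> R.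
  by move=> q01; rewrite div1r lnV// posrE sq_lt1.
have Lge0 q : 0 < q < 1 -> 0 <= - ln (1 - q ^+ 2) :> R.
  move=> q01; rewrite oppr_ge0 ln_le0// lerBlDr lerDl sqr_ge0//.
rewrite /total_info (big_enum_valT _
  (fun c : entry n d => - (ln (1 - entry_corr rho r c ^+ 2) / 2))).
rewrite big_sumType/= !sumr_const card_edge card_prod !card_ord /signal !L//.
have n2 : ('C(n, 2))%:R * 2 <= n%:R * n%:R :> R.
  rewrite -natrM -natrM ler_nat bin2 muln2.
  rewrite (@leq_trans (n * n.-1))//; last by rewrite leq_mul2l leq_pred orbT.
  by rewrite -[leqRHS]odd_double_half leq_addl.
have h := ler_wpM2r (Lge0 _ rho01) n2.
have key (m a b nn dd : R) : m * 2 * - a <= nn * nn * - a ->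
    m * - (a / 2) + nn * dd * - (b / 2) <= nn / 4 * (nn * - a + 2 * dd * - b).
  move=> hm; rewrite -subr_ge0.
  rewrite (_ : _ - _ = (nn * nn * - a - m * 2 * - a) / 4); last by field.
  by rewrite divr_ge0// subr_ge0.
rewrite -[X in X + _ <= _]mulr_natl -[X in _ + X <= _]mulr_natl natrM.
exact: key.
Qed.

End total_info.

Section asymptotics.
Context {R : realType}.

Lemma near_ln_ge (K : R) : \forall n \near \oo, K <= ln (n%:R : R).
Proof.
near=> n; have ne : expR K <= n%:R by near: n; exact: nbhs_infty_ger.
by rewrite -[leLHS]expRK ler_ln ?posrE ?expR_gt0// (lt_le_trans (expR_gt0 _) ne).
Unshelve. all: by end_near. Qed.

(** The single term [k ^ k / k!] of the series of [expR k] gives the elementary Stirling bound. *)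
Lemma inv_fact_le (k : nat) : (0 < k)%N ->
  ((k`!)%:R)^-1 <= expR (k%:R - k%:R * ln k%:R) :> R.
Proof.
case: k => // k _; have k0 : 0 < k.+1%:R :> R by rewrite ltr0n.
have f0 : 0 < (k.+1`!)%:R :> R by rewrite ltr0n fact_gt0.
have := expR_ge1Dxn k (ltW k0).
rewrite expRB -lerBrDl => h.
have {h} : k.+1%:R ^+ k.+1 / (k.+1`!)%:R <= expR k.+1%:R :> R.
  by rewrite (le_trans h)// lerBlDr lerDl.
rewrite ler_pdivrMr// => h.
rewrite expRM_natl lnK ?posrE// ler_pdivlMr ?exprn_gt0//.
by rewrite mulrC ler_pdivrMr.
Qed.

Lemma expR_Nnat_le (n : nat) : expR (- n%:R) <= (1 + n%:R)^-1 :> R.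
Proof.
by rewrite expRN lef_pV2 ?posrE ?expR_gt0 ?expR_ge1Dx// ltr_pwDl.
Qed.

End asymptotics.

Lemma signal_gt0 (R : realType) n d (rho r : R) : (0 < n)%N ->
  0 < rho < 1 -> 0 < r < 1 -> 0 < signal n d rho r.
Proof.
move=> n0 rho01 r01.
have L q : 0 < q < 1 -> 0 < ln (1 / (1 - q ^+ 2)) :> R.
  move=> q01; rewrite div1r lnV ?posrE ?sq_lt1// oppr_gt0 ln_lt0// sq_lt1//=.
  by rewrite ltrBlDr ltrDl exprn_gt0//; case/andP: q01.
apply: ltr_wpDr; first by rewrite mulr_ge0// ltW// L.
by rewrite mulr_gt0 ?ltr0n ?L.
Qed.

Section impossibility.
Context {R : realType}.

(** As [c / 4 = delta - 2 * g], the level [tau = (delta - g) * n * ln n] lies midway between the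
    bound [c / 4 * n * ln n] on the information and the leading term [delta * n * ln n] of [ln k!].
    With [t = g / 2] the second-order term of the moment is at most half of the gap. *)
Lemma prob_success_asymp (n d : nat) (rho r c delta : R) :
  0 < rho < 1 -> 0 < r < 1 -> 0 < delta < 1 -> 0 < c -> c < 4 * delta ->
  let g := (delta - c / 4) / 2 in
  signal n d rho r <= c * ln n%:R ->
  1 <= delta * n%:R -> 1 <= ln (delta * n%:R) ->
  1 <= g / 2 * (g / 2) * ln n%:R ->
  1 <= g * ln n%:R + delta * (ln delta - 1) ->
  8 * delta / c <= n%:R ->
  forall hatpi : featured_graph R n d * featured_graph R n d -> 'S_n,
  measurable_to_perm hatpi ->
  forall dO (Omega : measurableType dO) (P : probability Omega R)
    (pistar : Omega -> 'S_n) (G : Omega -> featured_graph R n d * featured_graph R n d),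
  measurable_fun setT G -> uniform_perm P pistar ->
  (forall s, correlated_wigner (cond_prob P (pistar @^-1` [set s])) rho r s G) ->
  (P [set w | (delta <= overlap R (hatpi (G w)) (pistar w))%R] <=
   (c / (4 * delta))%R%:E)%E.
Proof.
move=> rho01 r01 /andP[d0 d1] c0 c4 g sig dn ldn n1 n2 n3 hatpi mhatpi dO Omega P
  pistar G mG upi cwG.
have n0 : 0 < n%:R :> R.
  by rewrite -(pmulr_rgt0 _ d0) (lt_le_trans ltr01).
have gE : g = (delta - c / 4) / 2 by [].
move: g gE n1 n2 => g gE n1 n2.
have g0 : 0 < g by rewrite gE divr_gt0// subr_gt0 ltr_pdivrMr// mulrC.
have g1 : g < 1 by rewrite gE; lra.
(* The least number of agreements that gives overlap [delta]. *)
have [k kceil] : exists k : nat, Num.ceil (delta * n%:R) = k.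
  exists `|Num.ceil (delta * n%:R)|%N; rewrite gez0_abs//.
  by rewrite -(ler_int R) (le_trans _ (ceil_ge _))// mulr_ge0 ?ltW.
have kge : delta * n%:R <= k%:R by rewrite (le_trans (ceil_ge _))// kceil.
have kdelta (m : nat) : delta <= m%:R / n%:R -> (k <= m)%N.
  rewrite ler_pdivlMr// => h.
  by rewrite -lez_nat -kceil ceil_le_int.
set nl := n%:R * ln n%:R : R.
have t01 : 0 <= g / 2 < 1 by lra.
apply: (le_trans (prob_success_le rho01 r01 mG upi cwG mhatpi kdelta
  ((delta - g) * nl) t01)).
rewrite lee_fin.
have info : @total_info R n d rho r <= c / 4 * nl.
  rewrite (le_trans (total_info_le _ _ _ _))//.
  rewrite (le_trans (ler_wpM2l _ sig)) ?divr_ge0//.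
  by rewrite /nl le_eqVlt; apply/orP; left; apply/eqP; field.
have lnn0 : 0 < ln n%:R :> R.
  have gg : 0 < g / 2 * (g / 2) by rewrite mulr_gt0// divr_gt0.
  by rewrite -(pmulr_rgt0 _ gg) (lt_le_trans ltr01 n1).
have nl0 : 0 < nl by rewrite mulr_gt0.
have e1 : expR ((g / 2 + (g / 2) ^+ 2) * @total_info R n d rho r -
    g / 2 * ((delta - g) * nl)) <= expR (- n%:R).
  rewrite ler_expR.
  apply: (@le_trans _ _ ((g / 2 + (g / 2) ^+ 2) * (c / 4 * nl) -
    g / 2 * ((delta - g) * nl))).
    by rewrite lerD2r ler_wpM2l// addr_ge0 ?sqr_ge0// ltW// divr_gt0.
  have -> : (g / 2 + (g / 2) ^+ 2) * (c / 4 * nl) - g / 2 * ((delta - g) * nl) =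
      - (g / 2 * nl * (g - g / 2 * (c / 4))) by rewrite gE; field.
  rewrite lerN2; apply: (@le_trans _ _ (g / 2 * nl * (g / 2))).
    have -> : g / 2 * nl * (g / 2) = n%:R * (g / 2 * (g / 2) * ln n%:R).
      by rewrite /nl; ring.
    by rewrite ler_peMr// ltW.
  have gnl : 0 <= g / 2 * nl by rewrite mulr_ge0 ?divr_ge0// ltW.
  apply: (ler_wpM2l gnl).
  have : g / 2 * (c / 4) <= g / 2 by rewrite ler_piMr ?divr_ge0 ?(ltW g0)//; lra.
  by lra.
have k0 : (0 < k)%N by rewrite -(ltr0n R) (lt_le_trans _ kge)// mulr_gt0.
have e2 : expR ((delta - g) * nl) / (k`!)%:R <= expR (- n%:R).
  rewrite (le_trans (ler_wpM2l (expR_ge0 _) (@inv_fact_le R k k0)))//.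
  rewrite -expRD ler_expR.
  have lk : ln (delta * n%:R) <= ln k%:R by rewrite ler_ln ?posrE ?ltr0n ?mulr_gt0.
  apply: (@le_trans _ _ ((delta - g) * nl - delta * n%:R * (ln (delta * n%:R) - 1))).
    rewrite (_ : k%:R - _ = - (k%:R * (ln k%:R - 1))); last by ring.
    rewrite lerD2l lerN2.
    apply: ler_pM => //; first by rewrite mulr_ge0// ltW.
      by rewrite subr_ge0.
    by rewrite lerD2r.
  rewrite lnM ?posrE//.
  have -> : (delta - g) * nl - delta * n%:R * (ln delta + ln n%:R - 1) =
    - (n%:R * (g * ln n%:R + delta * (ln delta - 1))) by rewrite /nl; ring.
  by rewrite lerN2 ler_peMr// ltW.
(* Each of the two error terms receives half of [c / (4 * delta)]. *)
have e3 : expR (- n%:R) <= c / (8 * delta) :> R.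
  have h : 8 * delta <= n%:R * c by rewrite -ler_pdivrMr.
  rewrite (le_trans (@expR_Nnat_le R n))// -div1r ler_pdivrMr ?addr_gt0//.
  rewrite mulrAC ler_pdivlMr ?mulr_gt0// mul1r mulrDr mulr1 [c * _]mulrC.
  by rewrite ler_wpDl// ltW.
apply: (le_trans (lerD e1 e2)); apply: (le_trans (lerD e3 e3)).
by rewrite le_eqVlt; apply/orP; left; apply/eqP; field; rewrite gt_eqF.
Qed.

End impossibility.

Lemma measurable_overlap (R : realType) n d (hatpi : featured_graph R n d *
    featured_graph R n d -> 'S_n) dO (Omega : measurableType dO)
    (pistar : Omega -> 'S_n) (G : Omega -> featured_graph R n d * featured_graph R n d)
    (B : pred R) :
  measurable_to_perm hatpi -> measurable_to_perm pistar -> measurable_fun setT G ->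
  measurable [set w | B (overlap R (hatpi (G w)) (pistar w))].
Proof.
move=> mh mp mG.
rewrite (_ : [set w | _] = \big[setU/set0]_(s <- enum 'S_n)
  (G @^-1` [set g | B (overlap R (hatpi g) s)] `&` pistar @^-1` [set s])).
  apply: bigsetU_measurable => s _; apply: measurableI; last exact: mp.
  apply: (measurable_preimageT mG).
  exact: (measurable_hatpi mh (fun t => B (overlap R t s))).
rewrite -bigcup_seq; apply/seteqP; split=> w /=.
  by move=> H; exists (pistar w) => //=; rewrite mem_enum inE.
by move=> [s _ [+ ws]] /=; rewrite ws.
Qed.

Lemma impossibility (R : realType) (d : nat -> nat) (rho r : nat -> R)
    (hrho : forall n, 0 < rho n < 1) (hr : forall n, 0 < r n < 1)
    (delta : R) : 0 < delta < 1 ->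
  forall c : R,
  (\forall n \near \oo, signal n (d n) (rho n) (r n) <= c * ln n%:R) ->
  forall hatpi : forall n, featured_graph R n (d n) * featured_graph R n (d n) -> 'S_n,
  (forall n, measurable_to_perm (hatpi n)) ->
  forall (dOmega : nat -> measure_display)
    (Omega : forall n, measurableType (dOmega n))
    (P : forall n, probability (Omega n) R)
    (pistar : forall n, Omega n -> 'S_n)
    (G : forall n, Omega n -> featured_graph R n (d n) * featured_graph R n (d n)),
  (forall n, measurable_fun setT (G n)) ->
  (forall n, uniform_perm (P n) (pistar n)) ->
  (forall n s, correlated_wigner
     (cond_prob (P n) (pistar n @^-1` [set s])) (rho n) (r n) s (G n)) ->
  \forall n \near \oo,
    ((1 - c / (4 * delta))%R%:E <=
     P n [set w | (overlap R (hatpi n (G n w)) (pistar n w) < delta)%R])%E.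
Proof.
move=> d01 c hsig hatpi mhatpi dOmega Omega P pistar G mG upi cwG.
have d0 : 0 < delta by case/andP: d01.
(* The signal is positive, so [c <= 0] contradicts the hypothesis for large [n]; for
   [c >= 4 * delta] the claimed lower bound is at most 0. *)
have [c0|c0] := leP c 0.
  near=> n; have n2 : (2 <= n)%N by near: n; exists 2%N.
  have : signal n (d n) (rho n) (r n) <= c * ln n%:R by near: n.
  rewrite leNgt => /negP[]; apply: (@le_lt_trans _ _ 0).
    by rewrite mulr_le0_ge0// ln_ge0// ler1n ltnW.
  by apply: signal_gt0 => //; rewrite ltnW.
have [dc|cd] := leP (4 * delta) c.
  near=> n; apply: (@le_trans _ _ 0%E); last exact: measure_ge0.
  by rewrite lee_fin subr_le0 ler_pdivlMr ?mul1r// mulr_gt0.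
pose g := (delta - c / 4) / 2.
have g0 : 0 < g by rewrite /g divr_gt0// subr_gt0 ltr_pdivrMr// mulrC.
have gg0 : 0 < g / 2 * (g / 2) by rewrite mulr_gt0// divr_gt0.
near=> n.
pose S := [set w | delta <= overlap R (hatpi n (G n w)) (pistar n w)].
have mS : measurable S.
  exact: (measurable_overlap (fun x => delta <= x) (mhatpi n) (proj1 (upi n)) (mG n)).
have -> : [set w | overlap R (hatpi n (G n w)) (pistar n w) < delta] = ~` S.
  by apply/seteqP; split=> w /=; rewrite ltNge => /negP.
rewrite probability_setC// EFinB; apply: leeB => //.
have l1 : 1 / (g / 2 * (g / 2)) <= ln (n%:R : R) by near: n; exact: near_ln_ge.
have l2 : (1 - delta * (ln delta - 1)) / g <= ln (n%:R : R).
  by near: n; exact: near_ln_ge.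
have l3 : 1 - ln delta <= ln (n%:R : R) by near: n; exact: near_ln_ge.
have l4 : 1 / delta <= n%:R :> R by near: n; exact: nbhs_infty_ger.
have l5 : 8 * delta / c <= n%:R :> R by near: n; exact: nbhs_infty_ger.
have n0 : 0 < n%:R :> R by rewrite (lt_le_trans _ l4)// divr_gt0.
apply: (prob_success_asymp (hrho n) (hr n) d01 c0 cd _ _ _ _ _ _ (mhatpi n) (mG n)
  (upi n) (cwG n)) => //.
- by near: n.
- by rewrite mulrC -ler_pdivrMr.
- by rewrite lnM ?posrE// -lerBlDl.
- by rewrite mulrC -ler_pdivrMr.
- by rewrite -lerBlDr [leRHS]mulrC -ler_pdivrMr.
Unshelve. all: by end_near. Qed.

(** * Exponential moments under the likelihood *)

Section gaussian_family.
Context {R : realType} (C : finType).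
Local Notation N := #|C|.
Local Notation T := (N.-tuple R).
Local Notation Q := (@gauss_tuple R N \x @gauss_tuple R N)%E.

Definition at_ (x : T) (c : C) : R := tnth x (enum_rank c).

Lemma measurable_at c : measurable_fun setT (at_ ^~ c).
Proof. exact: measurable_tnth. Qed.

Lemma ge0_integral_at_prod (f : C -> R -> \bar R) :
  (forall c, measurable_fun setT (f c)) -> (forall c x, (0 <= f c x)%E) ->
  (\int[gauss_tuple N]_x \prod_c f c (at_ x c) = \prod_c \int[gauss1]_y f c y)%E.
Proof.
move=> mf f0; rewrite -big_enum_valT -ge0_integral_gauss_prod//.
apply: eq_integral => x _; rewrite -big_enum_valT.
by apply: eq_bigr => i _; rewrite /at_ enum_valK.
Qed.

Lemma gauss_expR_linear (b : C -> R) :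
  (\int[gauss_tuple N]_x (expR (\sum_c b c * at_ x c))%:E =
   (expR (\sum_c b c ^+ 2 / 2))%:E)%E.
Proof.
under eq_integral do rewrite expR_sum -prodEFin.
rewrite (ge0_integral_at_prod (f := fun c y => (expR (b c * y))%:E)); last 2 first.
- move=> c; apply/measurable_EFinP; apply: (measurableT_comp (@measurable_expR R)).
  by apply: measurable_funM.
- by move=> c x; rewrite lee_fin expR_ge0.
rewrite expR_sum -prodEFin; apply: eq_bigr => c _.
have E (y : R) : b c * y = 0 + 0 * y ^+ 2 / 2 + b c * y by ring.
under eq_integral do rewrite E.
by rewrite gauss1_expR_quadratic ?ltr01// subr0 ln1 mulr1 mul0r subr0 add0r.
Qed.

(** The moment generating function of a chi-square variable with [#|D|] degrees of freedom. *)
Lemma gauss_expR_sumsq (u : R) (D : pred C) : u < 1 ->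
  (\int[gauss_tuple N]_x (expR (u / 2 * \sum_(c | D c) at_ x c ^+ 2))%:E =
   (expR (- (#|D|%:R * (ln (1 - u) / 2))))%:E)%E.
Proof.
move=> u1.
pose v c : R := if D c then u else 0.
have v1 c : v c < 1 by rewrite /v; case: ifP.
have E (x : T) : u / 2 * (\sum_(c | D c) at_ x c ^+ 2) =
    \sum_c (0 + v c * at_ x c ^+ 2 / 2 + 0 * at_ x c).
  rewrite mulr_sumr big_mkcond/=; apply: eq_bigr => c _; rewrite /v.
  by case: ifP => _; ring.
under eq_integral do rewrite E expR_sum -prodEFin.
rewrite (ge0_integral_at_prod
  (f := fun c y => (expR (0 + v c * y ^+ 2 / 2 + 0 * y))%:E)); last 2 first.
- move=> c; apply/measurable_EFinP; apply: (measurableT_comp (@measurable_expR R)).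
  by apply: measurable_funD; do ?apply: measurable_funD; do ?apply: measurable_funM.
- by move=> c x; rewrite lee_fin expR_ge0.
under eq_bigr do rewrite gauss1_expR_quadratic//.
rewrite prodEFin -expR_sum; congr (expR _)%:E.
rewrite mulr_natl -mulNrn -sumr_const [RHS]big_mkcond/=; apply: eq_bigr => c _.
rewrite /v unfold_in; case: ifP => _; last by rewrite subr0 ln1; field.
by field; rewrite subr_eq0 eq_sym lt_eqF.
Qed.

Variable q : C -> R.
Hypothesis q01 : forall c, 0 < q c < 1.
Local Notation likC := (lik (fun i => q (enum_val i))).

Lemma likCE (x w : T) : likC (x, w) = expR (\sum_c lell (q c) (at_ x c) (at_ w c)).
Proof.
rewrite likE /loglik; congr expR; rewrite -(@big_enum_valT C); apply: eq_bigr => i _.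
by rewrite /at_ enum_valK.
Qed.

Lemma lik_expR_linear (x : T) (b : C -> R) :
  (\int[gauss_tuple N]_w (likC (x, w) * expR (\sum_c b c * at_ w c))%:E =
   (expR (\sum_c (b c * q c * at_ x c + b c ^+ 2 * (1 - q c ^+ 2) / 2)))%:E)%E.
Proof.
under eq_integral do rewrite likCE -expRD -big_split/= expR_sum -prodEFin.
rewrite (ge0_integral_at_prod
  (f := fun c y => (expR (lell (q c) (at_ x c) y + b c * y))%:E)); last 2 first.
- move=> c; apply/measurable_EFinP; apply: (measurableT_comp (@measurable_expR R)).
  apply: measurable_funD; last exact: measurable_funM.
  exact: (measurableT_comp (measurable_lell (q c)) (pair1_measurable (at_ x c))).
- by move=> c y; rewrite lee_fin expR_ge0.
under eq_bigr do rewrite gauss1_lell//.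
by rewrite prodEFin -expR_sum.
Qed.

(** For fixed [x] the likelihood integrates to 1 in [w]: events on the first graph alone can be
    bounded under the standard Gaussian measure. *)
Lemma integral_lik_fst (f : T -> \bar R) :
  measurable_fun setT f -> (forall x, (0 <= f x)%E) ->
  (\int[Q]_p ((likC p)%:E * f p.1) = \int[gauss_tuple N]_x f x)%E.
Proof.
move=> mf f0.
have mlf : measurable_fun setT (fun p : T * T => ((likC p)%:E * f p.1)%E).
  apply: emeasurable_funM; first exact: measurable_lik.
  exact: (measurableT_comp mf measurable_fst).
have lf0 p : (0 <= (likC p)%:E * f p.1)%E by rewrite mule_ge0// lee_fin lik_ge0.
rewrite (fubini_tonelli1 (m1 := gauss_tuple N) (m2 := gauss_tuple N) _ mlf lf0).
apply: eq_integral => x _; rewrite /fubini_F/=.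
rewrite ge0_integralZr//; last 2 first.
- exact: (measurableT_comp (measurable_lik _) (pair1_measurable x)).
- by move=> w _; rewrite lee_fin lik_ge0.
have /= := lik_expR_linear x (fun=> 0); rewrite [in RHS]big1 => [|c _]; last by ring.
have z (w : T) : \sum_c 0 * at_ w c = 0 :> R by rewrite big1// => c _; rewrite mul0r.
under eq_integral do rewrite z expR0 mulr1.
by rewrite expR0 => ->; rewrite mul1e.
Qed.

(** [wgt] is the coefficient of the product in [lell]. Given [x], the variable
    [wgt c * at_ x c * at_ w c] has mean and variance both equal to [lam c * at_ x c ^+ 2]: [lam] is
    a signal-to-noise ratio. *)
Definition lam c : R := q c ^+ 2 / (1 - q c ^+ 2).
Definition wgt c : R := q c / (1 - q c ^+ 2).

(* The exponential martingale of the score, given the first graph. *)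
Definition drift (s : C -> C) (D : pred C) (t : R) (x w : T) : R :=
  t * \sum_(c | D c) (wgt c * at_ x c * at_ w (s c) - lam c * at_ x c * at_ x (s c)) -
  t ^+ 2 / 2 * \sum_(c | D c) lam c * at_ x c ^+ 2.

Lemma measurable_at1 c : measurable_fun [set: T * T] (fun p => at_ p.1 c).
Proof. exact: (measurableT_comp (measurable_at c) measurable_fst). Qed.

Lemma measurable_at2 c : measurable_fun [set: T * T] (fun p => at_ p.2 c).
Proof. exact: (measurableT_comp (measurable_at c) measurable_snd). Qed.

Lemma measurable_sum_cond dX (X : measurableType dX) (I : finType) (D : pred I)
    (f : I -> X -> R) : (forall i, measurable_fun setT (f i)) ->
  measurable_fun setT (fun x => \sum_(i | D i) f i x).
Proof.
move=> mf; under eq_fun do rewrite big_mkcond; apply: measurable_sum => i.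
by case: (D i).
Qed.

Lemma measurable_drift s D t : measurable_fun [set: T * T] (fun p => drift s D t p.1 p.2).
Proof.
have m1 := measurable_at1; have m2 := measurable_at2.
apply: measurable_funB; apply: measurable_funM => //; apply: measurable_sum_cond => c.
  by apply: measurable_funB; do ?apply: measurable_funM.
by apply: measurable_funM => //; apply: measurable_funX.
Qed.

(** Given [x], the entries [at_ w (s c)] are independent normals, distinct as [s] is injective, and
    [q (s c) = q c] makes their means and variances exactly those that [drift] subtracts. The
    expectation is therefore 1 already for each fixed [x]. *)
Lemma integral_expR_drift (s s' : C -> C) (D : pred C) (t : R) :
  cancel s s' -> cancel s' s -> (forall c, q (s c) = q c) ->
  (\int[Q]_p (likC p * expR (drift s D t p.1 p.2))%:E = 1)%E.
Proof.
move=> sK s'K qs.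
pose h (p : T * T) : \bar R := (likC p * expR (drift s D t p.1 p.2))%:E.
have mh : measurable_fun setT h.
  apply/measurable_EFinP; apply: measurable_funM.
    by apply/measurable_EFinP; exact: measurable_lik.
  exact: (measurableT_comp (@measurable_expR R) (measurable_drift s D t)).
have h0 p : (0 <= h p)%E by rewrite lee_fin mulr_ge0 ?lik_ge0 ?expR_ge0.
rewrite (fubini_tonelli1 (m1 := gauss_tuple N) (m2 := gauss_tuple N) _ mh h0).
transitivity (\int[gauss_tuple N]_x (1 : \bar R))%E; last first.
  by rewrite integral_cst// mul1e; exact: probability_setT.
apply: eq_integral => x _; rewrite /fubini_F/h/=.
(* The score as a linear form in [w]: its coefficient at [c] comes from the index that [s] sends to
   [c]. *)
pose b c := if D (s' c) then t * wgt (s' c) * at_ x (s' c) else 0.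
pose f := - (\sum_(c | D c) (t * lam c * at_ x c * at_ x (s c) +
  t ^+ 2 / 2 * lam c * at_ x c ^+ 2)).
have B w : \sum_c b c * at_ w c = \sum_(c | D c) t * wgt c * at_ x c * at_ w (s c).
  rewrite (reindex s)/=; last by exists s' => c _.
  rewrite [RHS]big_mkcond/=; apply: eq_bigr => c _; rewrite /b sK.
  by case: (D c); rewrite ?mul0r.
have E w : drift s D t x w = f + \sum_c b c * at_ w c.
  rewrite B /drift /f !mulr_sumr -!sumrN -!big_split/=.
  by apply: eq_bigr => c _; ring.
under eq_integral do rewrite E expRD mulrCA EFinM.
rewrite ge0_integralZl_EFin ?expR_ge0//; last 2 first.
- by move=> w _; rewrite lee_fin mulr_ge0 ?lik_ge0 ?expR_ge0.
- apply/measurable_EFinP; apply: measurable_funM.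
    apply/measurable_EFinP.
    exact: (measurableT_comp (measurable_lik _) (pair1_measurable x)).
  apply: (measurableT_comp (@measurable_expR R)); apply: measurable_sum => c.
  by apply: measurable_funM => //; exact: measurable_at.
rewrite lik_expR_linear -EFinM -expRD -[RHS](congr1 EFin (expR0 R)).
congr (expR _)%:E; rewrite (reindex s)/=; last by exists s' => c _.
rewrite /f big_mkcond/= addrC; apply/eqP; rewrite subr_eq0; apply/eqP.
apply: eq_bigr => c _; rewrite /b sK qs; case: (D c).
  rewrite /wgt /lam; field; exact: lt0r_neq0 (sq_lt1 (q01 c)).
by rewrite !mul0r expr0n/= mul0r mul0r addr0.
Qed.

End gaussian_family.

(** * Decoupling of quadratic forms *)

Section decoupling.
Context {R : realType} (C : finType).
Local Notation N := #|C|.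
Local Notation T := (N.-tuple R).
Local Notation Q := (@gauss_tuple R N \x @gauss_tuple R N)%E.
Local Notation at_ := (@at_ R C).

Lemma integral_gauss_fst (f : T -> \bar R) :
  measurable_fun setT f -> (forall x, (0 <= f x)%E) ->
  (\int[Q]_p f p.1 = \int[gauss_tuple N]_x f x)%E.
Proof.
move=> mf f0.
have mf1 : measurable_fun setT (fun p : T * T => f p.1).
  exact: (measurableT_comp mf measurable_fst).
rewrite (fubini_tonelli1 (m1 := gauss_tuple N) (m2 := gauss_tuple N) _ mf1)//.
apply: eq_integral => x _; rewrite /fubini_F/=.
rewrite integral_cst// -[RHS]mule1; congr (_ * _)%E; exact: probability_setT.
Qed.

Definition mix (B : pred C) (x z : T) : T :=
  [tuple if B (enum_val i) then tnth x i else tnth z i | i < N].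

Lemma at_mix B x z c : at_ (mix B x z) c = if B c then at_ x c else at_ z c.
Proof. by rewrite /at_ tnth_mktuple enum_rankK. Qed.

(** A vector assembled from two independent standard Gaussian copies is again standard: exchanging
    the copies outside [B] is a bijection of the coordinates. *)
Lemma integral_mix (B : pred C) (f : T -> \bar R) :
  measurable_fun setT f -> (forall x, (0 <= f x)%E) ->
  (\int[Q]_p f (mix B p.1 p.2) = \int[gauss_tuple N]_x f x)%E.
Proof.
move=> mf f0.
pose g (j : bool * 'I_N) := (if B (enum_val j.2) then j.1 else ~~ j.1, j.2).
have gK : cancel g g.
  by move=> [b i]; rewrite /g/=; case: (B _); rewrite ?negbK.
rewrite -integral_gauss_fst//.
have mf1 : measurable_fun setT (fun p : T * T => f p.1).
  exact: (measurableT_comp mf measurable_fst).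
transitivity (\int[pushforward Q (rearrange g)]_p f p.1)%E.
  rewrite (ge0_integral_pushforward (measurable_rearrange g))//.
  rewrite preimage_setT; apply: eq_integral => p _ /=; congr f.
  apply: eq_from_tnth => i; rewrite !tnth_mktuple /pick_coord /g/=.
  by case: (B _).
apply: eq_measure_integral; first exact: measurable_rearrange.
by move=> mg A mA _; exact: (gauss_rearrange gK gK mA).
Qed.

(** In every term one factor lies in [B] and the other outside, so they can be taken from two
    independent copies. Integrating the second copy, in which the form is linear, leaves
    [v ^+ 2 / 2] times a sum of squares of the first. *)
Lemma gauss_expR_bilinear (s s' : C -> C) (D B : pred C) (v : R) :
  cancel s s' -> cancel s' s -> v ^+ 2 < 1 ->
  let D' c := [&& D c, B c & ~~ B (s c)] in
  (\int[gauss_tuple N]_x (expR (v * \sum_(c | D' c) at_ x c * at_ x (s c)))%:E =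
   (expR (- (#|D'|%:R * (ln (1 - v ^+ 2) / 2))))%:E)%E.
Proof.
move=> sK s'K v1 D'.
have mf : measurable_fun setT
    (fun x : T => (expR (v * \sum_(c | D' c) at_ x c * at_ x (s c)))%:E).
  apply/measurable_EFinP; apply: (measurableT_comp (@measurable_expR R)).
  apply: measurable_funM => //; apply: measurable_sum_cond => c.
  by apply: measurable_funM; exact: measurable_at.
rewrite -(integral_mix B)//.
pose h (p : T * T) : \bar R :=
  (expR (v * \sum_(c | D' c) at_ p.1 c * at_ p.2 (s c)))%:E.
have mh : measurable_fun setT h.
  apply/measurable_EFinP; apply: (measurableT_comp (@measurable_expR R)).
  apply: measurable_funM => //; apply: measurable_sum_cond => c.
  by apply: measurable_funM; [exact: measurable_at1|exact: measurable_at2].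
transitivity (\int[Q]_p h p)%E.
  apply: eq_integral => p _; congr (expR (v * _))%:E.
  apply: eq_bigr => c /and3P[_ Bc /negbTE Bsc].
  by rewrite !at_mix Bc Bsc.
have h0 p : (0 <= h p)%E by rewrite lee_fin expR_ge0.
rewrite (fubini_tonelli1 (m1 := gauss_tuple N) (m2 := gauss_tuple N) _ mh h0).
rewrite -gauss_expR_sumsq//; apply: eq_integral => x _; rewrite /fubini_F/h/=.
pose b c := if D' (s' c) then v * at_ x (s' c) else 0.
have E (w : T) : v * (\sum_(c | D' c) at_ x c * at_ w (s c)) = \sum_c b c * at_ w c.
  rewrite [RHS](reindex s)/=; last by exists s' => c _.
  rewrite mulr_sumr big_mkcond/=; apply: eq_bigr => c _; rewrite /b sK.
  by case: (D' c); rewrite ?mul0r// mulrA.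
under eq_integral do rewrite E.
rewrite gauss_expR_linear; congr (expR _)%:E.
rewrite (reindex s)/=; last by exists s' => c _.
rewrite mulr_sumr [RHS]big_mkcond/=; apply: eq_bigr => c _; rewrite /b sK.
by case: (D' c); [field|rewrite expr0n/= mul0r].
Qed.

(** A uniformly random subset contains [c] but not [c'] with probability a quarter; the summand is a
    product over the coordinates, so the sum factors. *)
Lemma avg_separating (c c' : C) : c != c' ->
  \sum_(f : {ffun C -> bool}) (2 ^- #|C| : R) *+ (f c && ~~ f c') = 4^-1.
Proof.
move=> cc'.
pose F (i : C) (b : bool) : R :=
  2^-1 * (if i == c then b else if i == c' then ~~ b else true)%:R.
transitivity (\sum_(f : {ffun C -> bool}) \prod_i F i (f i)).
  apply: eq_bigr => f _.
  rewrite /F big_split/= prodr_const exprVn -[LHS]mulr_natr; congr (_ * _).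
  case: (boolP (f c && ~~ f c')) => [/andP[fc fc']|].
    rewrite big1// => i _.
    by case: eqP => [->|_]; rewrite ?fc//; case: eqP => [->|_]; rewrite ?fc'.
  rewrite negb_and negbK => /orP[fc|fc'].
    by rewrite (bigD1 c)//= eqxx (negbTE fc) mul0r.
  by rewrite (bigD1 c')//= eqxx eq_sym (negbTE cc') fc' mul0r.
rewrite -bigA_distr_bigA (bigD1 c)//= (bigD1 c')/=; last by rewrite eq_sym.
have Fc : \sum_b F c b = 2^-1 by rewrite big_bool /F eqxx /= mulr1 mulr0 addr0.
have Fc' : \sum_b F c' b = 2^-1.
  by rewrite big_bool /F eqxx eq_sym (negbTE cc') /= mulr1 mulr0 add0r.
rewrite Fc Fc' big1 => [|i /andP[ic ic']]; first by field.
by rewrite big_bool /F (negbTE ic) (negbTE ic') /= !mulr1; field.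
Qed.

(** Jensen's inequality, by averaging the tangent of the exponential at the mean [m]. *)
Lemma expR_avg_le (I : finType) (p a : I -> R) :
  (forall i, 0 <= p i) -> \sum_i p i = 1 ->
  expR (\sum_i p i * a i) <= \sum_i p i * expR (a i).
Proof.
move=> p0 p1; set m := \sum_i p i * a i.
rewrite [leLHS](_ : _ = \sum_i p i * (expR m * (1 + (a i - m)))).
  apply: ler_sum => i _; apply: ler_wpM2l => //.
  rewrite [X in _ <= expR X](_ : _ = m + (a i - m)); last by rewrite addrC subrK.
  by rewrite expRD ler_wpM2l ?expR_ge0// expR_ge1Dx.
transitivity (expR m * ((1 - m) * (\sum_i p i) + m)).
  by rewrite p1 mulr1 subrK mulr1.
rewrite /m mulr_sumr -big_split/= mulr_sumr; apply: eq_bigr => i _.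
by rewrite -/m; ring.
Qed.

(* Decoupling: averaging over a random subset [B] of the coordinates turns the
   quadratic form into one between the disjoint blocks [B] and its complement. *)
Lemma gauss_expR_perm_le (s s' : C -> C) (D : pred C) (u : R) :
  cancel s s' -> cancel s' s -> 16 * u ^+ 2 < 1 ->
  (\int[gauss_tuple N]_x
     (expR (u * \sum_(c | D c && (s c != c)) at_ x c * at_ x (s c)))%:E <=
   (expR (- (#|D|%:R * (ln (1 - 16 * u ^+ 2) / 2))))%:E)%E.
Proof.
move=> sK s'K u1.
have v2 : (4 * u) ^+ 2 = 16 * u ^+ 2 by ring.
pose D' (f : {ffun C -> bool}) c := [&& D c, f c & ~~ f (s c)].
pose w : R := 2 ^- #|C|.
have w0 : 0 <= w by rewrite invr_ge0 exprn_ge0.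
have w1 : \sum_(f : {ffun C -> bool}) w = 1.
  by rewrite sumr_const card_ffun card_bool -[LHS]mulr_natr natrX /w mulVf.
(* Each term with [s c != c] survives for a quarter of the subsets [f], hence the factor 4, and the
   condition [16 * u ^+ 2 < 1] afterwards. *)
have jensen x : expR (u * \sum_(c | D c && (s c != c)) at_ x c * at_ x (s c)) <=
    \sum_(f : {ffun C -> bool}) w *
      expR (4 * u * \sum_(c | D' f c) at_ x c * at_ x (s c)).
  apply: le_trans (expR_avg_le (p := fun=> w)
    (fun f => 4 * u * \sum_(c | D' f c) at_ x c * at_ x (s c)) (fun=> w0) w1).
  rewrite ler_expR le_eqVlt.
  apply/orP; left; apply/eqP.
  under [RHS]eq_bigr do rewrite mulrA mulr_sumr big_mkcond/=.
  rewrite exchange_big/= mulr_sumr big_mkcond/=; apply: eq_bigr => c _.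
  case: (boolP (D c)) => Dc /=; last first.
    by rewrite big1// => f _; rewrite /D' (negbTE Dc).
  case: eqP => [sc|/eqP sc] /=.
    by rewrite big1// => f _; rewrite /D' sc andbN andbF.
  rewrite eq_sym in sc; have := avg_separating sc => h.
  transitivity (4 * u * (at_ x c * at_ x (s c)) *
      \sum_(f : {ffun C -> bool}) (2 ^- #|C| : R) *+ (f c && ~~ f (s c))).
    by rewrite h; field.
  rewrite mulr_sumr; apply: eq_bigr => f _; rewrite /D' Dc /= -/w.
  by case: (f c && _); rewrite ?mulr0// mulr1n; ring.
have mquad (P : pred C) v : measurable_fun setT
    (fun x : T => (expR (v * \sum_(c | P c) at_ x c * at_ x (s c)))%:E).
  apply/measurable_EFinP; apply: (measurableT_comp (@measurable_expR R)).
  apply: measurable_funM => //; apply: measurable_sum_cond => c.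
  by apply: measurable_funM; exact: measurable_at.
apply: (@le_trans _ _ (\int[gauss_tuple N]_x
    \sum_(f : {ffun C -> bool}) w%:E *
      (expR (4 * u * \sum_(c | D' f c) at_ x c * at_ x (s c)))%:E)%E).
  apply: ge0_le_integral => //.
  - by apply: emeasurable_sum => f; apply: measurable_funeM; exact: (mquad (D' f) (4 * u)).
  - move=> x _; apply: (@le_trans _ _ (\sum_(f : {ffun C -> bool}) w *
        expR (4 * u * \sum_(c | D' f c) at_ x c * at_ x (s c)))%:E).
      by rewrite lee_fin.
    by rewrite -sumEFin.
rewrite ge0_integral_sum//; last 2 first.
- by move=> f; apply: measurable_funeM; exact: (mquad (D' f) (4 * u)).
- by move=> f x _; rewrite -EFinM lee_fin mulr_ge0 ?expR_ge0.
apply: (@le_trans _ _ (\sum_(f : {ffun C -> bool}) (w *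
    expR (- (#|D|%:R * (ln (1 - 16 * u ^+ 2) / 2))))%:E)%E); last first.
  by rewrite sumEFin -mulr_suml w1 mul1r.
apply: lee_sum => f _; rewrite ge0_integralZl_EFin//.
rewrite EFinM; apply: lee_wpmul2l => //.
rewrite (gauss_expR_bilinear _ (f : pred C) sK s'K) ?v2// lee_fin ler_expR.
have l0 : ln (1 - 16 * u ^+ 2) / 2 <= 0.
  by rewrite mulr_le0_ge0// ln_le0// lerBlDr lerDl mulr_ge0// sqr_ge0.
rewrite lerN2; apply: (ler_wnM2r l0).
by rewrite ler_nat subset_leq_card//; apply/fintype.subsetP => c /and3P[].
Qed.

End decoupling.

(** * Tail bounds under the likelihood *)

Section chernoff.
Context {R : realType} (C : finType).
Local Notation N := #|C|.
Local Notation T := (N.-tuple R).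
Local Notation Q := (@gauss_tuple R N \x @gauss_tuple R N)%E.
Local Notation at_ := (@at_ R C).
Variable q : C -> R.
Hypothesis q01 : forall c, 0 < q c < 1.
Local Notation likC := (lik (fun i => q (enum_val i))).
Local Notation drift := (drift q).

(** Union bound and exponential Markov inequality in one: on [X] some [expR (g j p)] is at least 1,
    so their sum dominates the indicator. *)
Lemma union_chernoff (J : finType) (P : pred J) (g : J -> T * T -> R) (X : set (T * T)) :
  measurable X -> (forall j, measurable_fun setT (g j)) ->
  (forall p, X p -> exists2 j, P j & 0 <= g j p) ->
  (\int[Q]_(p in X) (likC p)%:E <=
   \sum_(j | P j) \int[Q]_p (likC p * expR (g j p))%:E)%E.
Proof.
move=> mX mg Xg.
have mlg j : measurable_fun setT (fun p => (likC p * expR (g j p))%:E).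
  apply/measurable_EFinP; apply: measurable_funM.
    by apply/measurable_EFinP; exact: measurable_lik.
  exact: (measurableT_comp (@measurable_expR R) (mg j)).
have lg0 j p : (0 <= (likC p * expR (g j p))%:E)%E.
  by rewrite lee_fin mulr_ge0 ?lik_ge0 ?expR_ge0.
rewrite -big_enum -ge0_integral_sum// [leLHS]integral_mkcond.
apply: ge0_le_integral => //.
- by move=> p _; rewrite patchE; case: ifP => // _; rewrite lee_fin lik_ge0.
- by apply/(measurable_restrictT _ mX); exact: measurable_funTS (measurable_lik _).
- exact: emeasurable_sum.
move=> p _; rewrite big_enum patchE; case: ifPn => [|_]; last exact: sume_ge0.
rewrite inE => /Xg[j Pj gj]; rewrite (bigD1 j)//=.
apply: (@le_trans _ _ (likC p * expR (g j p))%:E).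
  by rewrite lee_fin ler_peMr ?lik_ge0// -expR0 ler_expR.
by rewrite leeDl// sume_ge0.
Qed.

Lemma integral_lik_fst_expR (f : T -> R) : measurable_fun setT f ->
  (\int[Q]_p (likC p * expR (f p.1))%:E = \int[gauss_tuple N]_x (expR (f x))%:E)%E.
Proof.
move=> mf; under eq_integral do rewrite EFinM.
apply: (integral_lik_fst q01 (f := fun x => (expR (f x))%:E)).
  by apply/measurable_EFinP; exact: (measurableT_comp (@measurable_expR R) mf).
by move=> x; rewrite lee_fin expR_ge0.
Qed.

Lemma integral_expR_shift dX (X : measurableType dX) (mu : {measure set X -> \bar R})
    (f : X -> R) (a : R) : measurable_fun setT f ->
  (\int[mu]_x (expR (a + f x))%:E = (expR a)%:E * \int[mu]_x (expR (f x))%:E)%E.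
Proof.
move=> mf; under eq_integral do rewrite expRD EFinM.
rewrite ge0_integralZl_EFin ?expR_ge0//.
by apply/measurable_EFinP; exact: (measurableT_comp (@measurable_expR R) mf).
Qed.

Lemma measurable_sumsq (D : pred C) :
  measurable_fun [set: T] (fun x => \sum_(c | D c) at_ x c ^+ 2).
Proof.
by apply: measurable_sum_cond => c; apply: measurable_funX; exact: measurable_at.
Qed.

Lemma measurable_quad (s : C -> C) (D : pred C) :
  measurable_fun [set: T] (fun x => \sum_(c | D c) at_ x c * at_ x (s c)).
Proof.
by apply: measurable_sum_cond => c; apply: measurable_funM; exact: measurable_at.
Qed.

(** The multiplier [eta / 4] is the chi-square moment at [u = - (eta / 2)]; the rate follows from
    [ln (1 + eta / 2) >= eta / 2 - eta ^+ 2 / 4]. *)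
Lemma lik_sumsq_low (D : pred C) (eta : R) : 0 < eta < 1 ->
  (\int[Q]_p (likC p * expR (eta / 4 *
     ((1 - eta) * #|D|%:R - \sum_(c | D c) at_ p.1 c ^+ 2)))%:E <=
   (expR (- (#|D|%:R * (eta ^+ 2 / 8))))%:E)%E.
Proof.
move=> /andP[e0 e1].
have mf : measurable_fun setT
    (fun x : T => - (eta / 2) / 2 * \sum_(c | D c) at_ x c ^+ 2).
  by apply: measurable_funM => //; exact: measurable_sumsq.
have E (x : T) : eta / 4 * ((1 - eta) * #|D|%:R - \sum_(c | D c) at_ x c ^+ 2) =
   eta / 4 * ((1 - eta) * #|D|%:R) + - (eta / 2) / 2 * \sum_(c | D c) at_ x c ^+ 2.
  by field.
under eq_integral do rewrite E.
rewrite (integral_lik_fst_expR (f := fun x => eta / 4 * ((1 - eta) * #|D|%:R) +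
  - (eta / 2) / 2 * \sum_(c | D c) at_ x c ^+ 2)); last exact: measurable_funD.
rewrite integral_expR_shift// gauss_expR_sumsq; last by lra.
rewrite -EFinM lee_fin -expRD ler_expR opprK.
have e20 : 0 < 1 + eta / 2 by lra.
have h : - ln (1 + eta / 2) <= - (eta / 2) / (1 + eta / 2).
  rewrite -lnV ?posrE// -[leLHS]/(ln _).
  rewrite [X in ln X](_ : _ = 1 + (- (eta / 2) / (1 + eta / 2))); last by field; lra.
  by apply: le_ln1Dx; rewrite ltr_pdivlMr//; lra.
have h2 : - (eta / 2) / (1 + eta / 2) <= - (eta / 2) + eta ^+ 2 / 4.
  rewrite ler_pdivrMr//.
  have : 0 <= eta ^+ 3 by rewrite exprn_ge0// ltW.
  by lra.
have D0 : 0 <= #|D|%:R :> R by [].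
set k := #|D|%:R in D0 *.
rewrite (_ : _ - _ = k * (eta / 4 * (1 - eta) - ln (1 + eta / 2) / 2)); last by ring.
rewrite -[leRHS]mulrN ler_wpM2l//; lra.
Qed.

(** The chi-square moment at [u = 1/2], bounded crudely. It is meant for the touched edges that are
    nevertheless fixed: there are at most [k] of them, against [a] of order [k n]. *)
Lemma lik_sumsq_high (D : pred C) (a : R) :
  (\int[Q]_p (likC p * expR (4^-1 * \sum_(c | D c) at_ p.1 c ^+ 2 - a))%:E <=
   (expR (#|D|%:R - a))%:E)%E.
Proof.
have mf : measurable_fun setT (fun x : T => 2^-1 / 2 * \sum_(c | D c) at_ x c ^+ 2).
  by apply: measurable_funM => //; exact: measurable_sumsq.
have E (x : T) : 4^-1 * \sum_(c | D c) at_ x c ^+ 2 - a =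
   - a + 2^-1 / 2 * \sum_(c | D c) at_ x c ^+ 2 by field.
under eq_integral do rewrite E.
rewrite (integral_lik_fst_expR (f := fun x => - a +
  2^-1 / 2 * \sum_(c | D c) at_ x c ^+ 2)); last exact: measurable_funD.
rewrite integral_expR_shift// gauss_expR_sumsq; last by lra.
rewrite -EFinM lee_fin -expRD ler_expR addrC lerD2r.
rewrite -mulrN ler_piMr//.
have -> : 1 - 2^-1 = 2^-1 :> R by field.
rewrite lnV ?posrE//.
have : ln (1 + 1) <= 1 :> R by apply: le_ln1Dx; lra.
by rewrite -[1 + 1]/(2%:R); lra.
Qed.

(** The multiplier [eta / 32] makes [16 * u ^+ 2] equal to [y = eta ^+ 2 / 64]. The threshold
    contributes [- 2 * y] per coordinate, the decoupled moment at most [y], as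
    [- ln (1 - y) <= 2 * y] for [y < 1/2]. *)
Lemma lik_quad (s s' : C -> C) (D : pred C) (eta : R) :
  cancel s s' -> cancel s' s -> 0 < eta < 1 ->
  (\int[Q]_p (likC p * expR (eta / 32 *
     (\sum_(c | D c && (s c != c)) at_ p.1 c * at_ p.1 (s c) - eta * #|D|%:R)))%:E <=
   (expR (- (#|D|%:R * (eta ^+ 2 / 64))))%:E)%E.
Proof.
move=> sK s'K /andP[e0 e1].
have mf : measurable_fun setT (fun x : T =>
    eta / 32 * \sum_(c | D c && (s c != c)) at_ x c * at_ x (s c)).
  apply: measurable_funM => //.
  exact: (measurable_quad s (fun c => D c && (s c != c))).
have E (x : T) : eta / 32 *
     (\sum_(c | D c && (s c != c)) at_ x c * at_ x (s c) - eta * #|D|%:R) =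
   - (eta / 32 * (eta * #|D|%:R)) +
   eta / 32 * \sum_(c | D c && (s c != c)) at_ x c * at_ x (s c) by ring.
under eq_integral do rewrite E.
rewrite (integral_lik_fst_expR (f := fun x => - (eta / 32 * (eta * #|D|%:R)) +
   eta / 32 * \sum_(c | D c && (s c != c)) at_ x c * at_ x (s c))); last first.
  exact: measurable_funD.
rewrite integral_expR_shift//.
have e2 : 0 <= eta ^+ 2 by exact: sqr_ge0.
have e21 : eta ^+ 2 < 1 by rewrite expr_lt1// ltW.
have u1 : 16 * (eta / 32) ^+ 2 < 1.
  by rewrite (_ : 16 * _ = eta ^+ 2 / 64); [lra|field].
apply: (le_trans (lee_wpmul2l _ (gauss_expR_perm_le D sK s'K u1))).
  by rewrite lee_fin expR_ge0.
rewrite -EFinM lee_fin -expRD ler_expR.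
rewrite (_ : 16 * _ = eta ^+ 2 / 64); last by field.
set y := eta ^+ 2 / 64.
have y0 : 0 <= y by rewrite /y; lra.
have y1 : y < 2^-1 by rewrite /y; lra.
have h : - ln (1 - y) <= y / (1 - y).
  rewrite -lnV ?posrE; last by lra.
  rewrite [X in ln X](_ : _ = 1 + y / (1 - y)); last by field; lra.
  by apply: le_ln1Dx; rewrite (@lt_le_trans _ _ 0)// divr_ge0//; lra.
have h2 : y / (1 - y) <= 2 * y.
  rewrite ler_pdivrMr; last by lra.
  have : 0 <= y * (1 - 2 * y) by rewrite mulr_ge0//; lra.
  by lra.
have D0 : 0 <= #|D|%:R :> R by [].
set k := #|D|%:R in D0 *.
rewrite (_ : _ - _ = k * (- (eta ^+ 2 / 32) - ln (1 - y) / 2)); last by field.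
rewrite -[leRHS]mulrN; apply: ler_wpM2l => //.
have -> : eta ^+ 2 / 32 = 2 * y by rewrite /y; field.
lra.
Qed.

Lemma lik_drift (s s' : C -> C) (D : pred C) (t a : R) :
  cancel s s' -> cancel s' s -> (forall c, q (s c) = q c) ->
  (\int[Q]_p (likC p * expR (drift s D t p.1 p.2 - a))%:E <= (expR (- a))%:E)%E.
Proof.
move=> sK s'K qs.
under eq_integral do rewrite expRD mulrA mulrC EFinM.
rewrite ge0_integralZl_EFin ?expR_ge0//; last 2 first.
- by move=> p _; rewrite lee_fin mulr_ge0 ?lik_ge0 ?expR_ge0.
- apply/measurable_EFinP; apply: measurable_funM.
    by apply/measurable_EFinP; exact: measurable_lik.
  exact: (measurableT_comp (@measurable_expR R) (measurable_drift _ _ _ _)).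
by rewrite (integral_expR_drift q01 D t sK s'K qs) mule1.
Qed.

End chernoff.

Lemma sum_predU (R : realType) (C : finType) (DE DF : pred C) (f : C -> R) :
  (forall c, DE c -> ~~ DF c) ->
  \sum_(c | DE c || DF c) f c = \sum_(c | DE c) f c + \sum_(c | DF c) f c.
Proof.
move=> dis; rewrite (bigID DE)/=; congr (_ + _); apply: eq_bigl => c.
  by case: (DE c); rewrite ?andbF ?andbT.
by case: (boolP (DE c)) => [/dis/negbTE ->|]; rewrite ?andbT.
Qed.

(** * The deterministic comparison of scores *)

Section score_gap.
Context {R : realType} (C : finType) (q : C -> R) (s : C -> C).
Variables (DE DF : pred C) (l1 l2 eta : R) (x w : #|C|.-tuple R).
Hypotheses (disj : forall c, DE c -> ~~ DF c)
  (lamE : forall c, DE c -> lam q c = l1) (lamF : forall c, DF c -> lam q c = l2)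
  (moved : forall c, DF c -> s c != c)
  (l10 : 0 <= l1) (l20 : 0 <= l2) (eta01 : 0 < eta < 1).
Local Notation at_ := (@at_ R C).
Local Notation hE := (#|DE|%:R : R).
Local Notation hF := (#|DF|%:R : R).
Let D c := DE c || DF c.
Let Lam := l1 * #|DE|%:R + l2 * #|DF|%:R.

(** The drift of the identity at [- eta] bounds the true score below by nearly [N2]; the drift of
    [s] at 1 bounds the other score above by [(1/2 - 4 * eta) * Lam + Qd + N2 / 2]. The margin
    [4 * eta] pays [2 * eta] for [Qd], [eta] for the slack of the true score, and [eta] for the two
    factors [1 - eta] that lower [N2 / 2]. Touched edges that [s] fixes contribute squares to [Qd],
    hence their separate hypothesis. *)
Lemma score_gap :
  (1 - eta) * #|DE|%:R <= \sum_(c | DE c) at_ x c ^+ 2 ->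
  (1 - eta) * #|DF|%:R <= \sum_(c | DF c) at_ x c ^+ 2 ->
  drift q id D (- eta) x w < eta ^+ 2 * Lam ->
  \sum_(c | DE c && (s c != c)) at_ x c * at_ x (s c) <= eta * #|DE|%:R ->
  \sum_(c | DF c && (s c != c)) at_ x c * at_ x (s c) <= eta * #|DF|%:R ->
  \sum_(c | DE c && (s c == c)) at_ x c ^+ 2 <= eta * #|DE|%:R ->
  drift q s D 1 x w < (2^-1 - 4 * eta) * Lam ->
  \sum_(c | D c) wgt q c * at_ x c * at_ w (s c) <
  \sum_(c | D c) wgt q c * at_ x c * at_ w c.
Proof.
move=> nE nF dI qE qF fE dS; case/andP: eta01 => e0 e1.
rewrite /drift in dI dS.
set S1 := \sum_(c | D c) wgt q c * at_ x c * at_ w (s c).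
set S0 := \sum_(c | D c) wgt q c * at_ x c * at_ w c.
set N2 := \sum_(c | D c) lam q c * at_ x c ^+ 2 in dI dS.
pose Qd := \sum_(c | D c) lam q c * at_ x c * at_ x (s c).
have dS' : S1 - Qd - N2 / 2 < (2^-1 - 4 * eta) * Lam.
  by move: dS; rewrite big_split/= sumrN -/S1 -/Qd mul1r expr1n mul1r [2^-1 * N2]mulrC.
have dI' : - eta * (S0 - N2) - eta ^+ 2 / 2 * N2 < eta ^+ 2 * Lam.
  have e : \sum_(c | D c) lam q c * at_ x c * at_ x c = N2.
    by apply: eq_bigr => c _; rewrite -mulrA -expr2.
  by move: dI; rewrite big_split/= sumrN -/S0 sqrrN e.
have N2E : N2 = l1 * (\sum_(c | DE c) at_ x c ^+ 2) + l2 * (\sum_(c | DF c) at_ x c ^+ 2).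
  rewrite /N2 /D sum_predU// !mulr_sumr.
  congr (_ + _); apply: eq_bigr => c Dc; first by rewrite lamE.
  by rewrite lamF.
have N2ge : (1 - eta) * Lam <= N2.
  rewrite N2E /Lam mulrDr !(mulrCA (1 - eta)).
  by apply: lerD; apply: ler_wpM2l.
have QdE : Qd = l1 * (\sum_(c | DE c && (s c != c)) at_ x c * at_ x (s c) +
    \sum_(c | DE c && (s c == c)) at_ x c ^+ 2) +
    l2 * (\sum_(c | DF c && (s c != c)) at_ x c * at_ x (s c)).
  rewrite /Qd /D sum_predU//; congr (_ + _).
    rewrite (bigID (fun c => s c != c))/= mulrDr !mulr_sumr; congr (_ + _).
      by apply: eq_bigr => c /andP[Dc _]; rewrite lamE// mulrA.
    under eq_bigl do rewrite negbK.
    by apply: eq_bigr => c /andP[Dc /eqP sc]; rewrite lamE// sc -mulrA expr2.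
  rewrite mulr_sumr; apply: eq_big => c; last by move=> Dc; rewrite lamF// mulrA.
  by case: (boolP (DF c)) => [/moved ->|].
have QdL : Qd <= 2 * eta * Lam.
  rewrite QdE (_ : 2 * eta * Lam = l1 * (eta * hE + eta * hE) + l2 * (2 * eta * hF)).
    apply: lerD; apply: ler_wpM2l => //; first exact: lerD.
    by rewrite (le_trans qF)// -mulrA ler_peMl ?ler1n// mulr_ge0// ltW.
  by rewrite /Lam; ring.
have Lam0 : 0 <= Lam by rewrite addr_ge0// mulr_ge0.
have S0g : N2 - eta / 2 * N2 - eta * Lam < S0.
  rewrite -(ltr_pM2l e0).
  have -> : eta * (N2 - eta / 2 * N2 - eta * Lam) =
    eta * N2 - eta ^+ 2 / 2 * N2 - eta ^+ 2 * Lam by ring.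
  lra.
have h1 : 0 <= (1 - eta) * (N2 - (1 - eta) * Lam).
  by rewrite mulr_ge0// subr_ge0// ltW.
have h2 : 0 <= eta ^+ 2 * Lam by rewrite mulr_ge0// sqr_ge0.
have h3 : (1 - eta) * (N2 - (1 - eta) * Lam) =
  N2 - eta * N2 - Lam + 2 * (eta * Lam) - eta ^+ 2 * Lam by ring.
move: S0g dS' QdL h1 h2; rewrite h3.
have -> : eta / 2 * N2 = eta * N2 / 2 by ring.
have -> : (2^-1 - 4 * eta) * Lam = Lam / 2 - 4 * (eta * Lam) by field.
have -> : 2 * eta * Lam = 2 * (eta * Lam) by ring.
by set a := eta * N2; set b := eta * Lam; set c := eta ^+ 2 * Lam; lra.
Qed.

End score_gap.

(** * The maximum likelihood estimator *)

Section mle.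
Context {R : realType} (n d : nat) (rho r : R).
Local Notation GG := (featured_graph R n d * featured_graph R n d)%type.
Local Notation q := (entry_corr rho r : entry n d -> R).

(** The part of the log-likelihood that depends on [p]: the sums of squares do not, as
    [entry_perm p] permutes the entries of each kind. *)
Definition score (G : GG) (p : 'S_n) : R :=
  \sum_c wgt q c * entry_val G.1 c * entry_val G.2 (entry_perm p c).

(* [mle] is measurable because it factors through [best]. *)
Definition best (G : GG) : {ffun 'S_n -> bool} :=
  [ffun p => [forall p' : 'S_n, score G p' <= score G p]].

Definition mle (G : GG) : 'S_n := odflt 1%g [pick p | best G p].

Lemma mleP G p : score G p <= score G (mle G).
Proof.
rewrite /mle; case: pickP => [p0|h] /=; first by rewrite ffunE => /forallP.
have [p1 _ p1max] := @arg_maxP _ _ _ (1%g : 'S_n) xpredT (score G) isT.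
have := h p1; rewrite ffunE => /negP[]; apply/forallP => p'.
exact: p1max.
Qed.

Lemma measurable_score p : measurable_fun setT (score ^~ p).
Proof.
apply: measurable_sum => c; apply: measurable_funM; first apply: measurable_funM => //.
  exact: (measurableT_comp (measurable_entry_val c) measurable_fst).
exact: (measurableT_comp (measurable_entry_val _) measurable_snd).
Qed.

Lemma measurable_mle : measurable_to_perm mle.
Proof.
move=> t.
have mle_le p p' : measurable [set G | score G p' <= score G p].
  have mB : measurable_fun setT (fun G => score G p - score G p').
    by apply: measurable_funB; exact: measurable_score.
  have := measurable_preimageT mB (measurable_itv `[0, +oo[).
  congr measurable; apply/seteqP; split=> G /=; rewrite in_itv/= andbT subr_ge0//.
pose F (b : {ffun 'S_n -> bool}) := odflt 1%g [pick p | b p].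
rewrite (_ : _ @^-1` _ =
    \big[setU/set0]_(b <- enum [pred b | F b == t]) [set G | forall p, best G p = b p]).
  apply: bigsetU_measurable => b _; apply: measurable_forall => p.
  have mb : measurable [set G | best G p].
    rewrite (_ : [set G | _] = [set G | forall p', score G p' <= score G p]).
      by apply: measurable_forall => p'; exact: mle_le.
    by apply/seteqP; split=> G /=; rewrite ffunE => /forallP.
  case: (b p) => //; move: (measurableC mb); congr measurable.
  by apply/seteqP; split=> G /=; case: (best G p).
rewrite -bigcup_seq; apply/seteqP; split=> G /=.
  by move=> <-; exists (best G) => //=; rewrite mem_enum inE.
move=> [b /=]; rewrite mem_enum inE => /eqP <- bG; rewrite /mle /F.
by congr odflt; apply: eq_pick => p; exact: bG.
Qed.

End mle.

(** * The entries touched by a permutation *)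

Section moved_entries.
Variables (n d : nat).
Local Open Scope set_scope.

(* [touchE M] and [touchF M] are the edges and the features that a permutation
   with support [M] may move. *)
Definition touchE (M : {set 'I_n}) (c : entry n d) : bool :=
  if c is inl e then ~~ (val e \subset ~: M) else false.

Definition touchF (M : {set 'I_n}) (c : entry n d) : bool :=
  if c is inr p then p.1 \in M else false.

Definition supp (s : 'S_n) : {set 'I_n} := [set v | s v != v].

Lemma touch_disj M c : touchE M c -> ~~ touchF M c.
Proof. by case: c. Qed.

Lemma entry_perm_untouched s c :
  ~~ (touchE (supp s) c || touchF (supp s) c) -> entry_perm s c = c.
Proof.
case: c => [e|[u i]] /=; last by rewrite inE negbK => /eqP ->.
rewrite orbF negbK => /fintype.subsetP sub; congr inl; apply/val_inj => /=.
have fixs v : v \in val e -> s v = v.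
  by move=> /sub; rewrite !inE negbK => /eqP.
apply/setP => v; apply/imsetP/idP => [[u ue ->]|ve]; first by rewrite fixs.
by exists v => //; rewrite fixs.
Qed.

Lemma touchF_moved s c : touchF (supp s) c -> entry_perm s c != c.
Proof.
case: c => [//|[u i]] /=; rewrite inE => su.
by apply: contraNneq su => -[->].
Qed.

Lemma card_touchF M : #|touchF M| = (#|M| * d)%N.
Proof.
rewrite -[X in (_ * X)%N]card_ord -cardsT -cardsX -(card_imset _ (@inr_inj (edge n) _)).
apply: eq_card => -[e|[u i]]; rewrite [LHS]unfold_in /=.
  by apply/esym/imsetP => -[].
apply/idP/imsetP => [uM|[[u' i'] + [-> _]]]; last by rewrite !inE => /andP[].
by exists (u, i) => //; rewrite !inE andbT.
Qed.

Lemma card_touchE M : (#|touchE M| + 'C(n - #|M|, 2) = 'C(n, 2))%N.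
Proof.
pose U : {set edge n} := [set e : edge n | val e \subset ~: M].
have cU : #|U| = 'C(n - #|M|, 2).
  rewrite -(card_imset _ val_inj).
  have -> : (n - #|M|)%N = #|~: M| by rewrite -[X in (X - _)%N]card_ord -(cardsC M) addKn.
  rewrite -cards_draws; apply: eq_card => A; rewrite !inE.
  apply/imsetP/andP => [[e + ->]|[sub A2]]; first by rewrite inE => ->; rewrite (valP e).
  by exists (exist _ A A2) => //; rewrite inE.
have cE : #|touchE M| = #|~: U|.
  rewrite -(card_imset _ (@inl_inj _ ('I_n * 'I_d)%type)).
  apply: eq_card => -[e|p]; rewrite [LHS]unfold_in /=.
    rewrite mem_imset; last exact: inl_inj.
    by rewrite !inE.
  by apply/esym/imsetP => -[].
by rewrite cE -cU addnC cardsC card_edge.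
Qed.

(** A fixed edge that contains a moved vertex [u] also contains [s u], hence is the pair of the two;
    such edges are images of vertices of the support. *)
Lemma card_touchE_fixed s :
  (#|[pred c | touchE (supp s) c && (entry_perm s c == c)]| <= #|supp s|)%N.
Proof.
pose f (c : entry n d) : {set 'I_n} := if c is inl e then val e else finset.set0.
have finj : {in [pred c | touchE (supp s) c && (entry_perm s c == c)] &, injective f}.
  move=> [e|p] [e'|p']; rewrite !inE //= => _ _ ee'.
  by congr inl; exact: val_inj.
rewrite -(card_in_imset finj).
apply: (@leq_trans #|(fun u => [set u; s u]) @: supp s|); last exact: leq_imset_card.
apply: subset_leq_card; apply/fintype.subsetP => A /imsetP[[e|p]]; rewrite !inE //=.
move=> /andP[/subsetPn[u ue]]; rewrite !inE negbK => su /eqP[/(congr1 val)/= se] ->.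
apply/imsetP; exists u; rewrite ?inE//.
apply/esym/eqP; rewrite eqEcard (eqP (valP e)) cards2 eq_sym su andbT.
apply/fintype.subsetP => v; rewrite !inE => /orP[/eqP -> //|/eqP ->].
suff : s u \in s @: val e by rewrite se.
exact: imset_f.
Qed.

End moved_entries.

(** * Failure of the estimator as a union of tail events *)

Section mle_failure.
Context {R : realType} (n d : nat) (rho r : R).
Hypotheses (rho01 : 0 < rho < 1) (r01 : 0 < r < 1).
Local Notation q := (entry_corr rho r : entry n d -> R).
Local Notation N := #|entry n d|.
Local Notation T := (N.-tuple R).
Variable eta : R.
Hypothesis eta01 : 0 < eta < 1.

Definition snr (a : R) : R := a ^+ 2 / (1 - a ^+ 2).

(** The sum of [lam] over the touched entries, [Lam] in the comparison of scores. *)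
Definition energy (M : {set 'I_n}) : R :=
  snr rho * #|@touchE n d M|%:R + snr r * #|@touchF n d M|%:R.

(* If all [set_term (supp sg)] and [perm_term sg] are negative, where [sg] relates
   the estimator to the truth, then the truth has the larger score ([score_gap]). *)
Definition set_term (M : {set 'I_n}) (i : 'I_3) (p : T * T) : R :=
  let E := @touchE n d M in let F := @touchF n d M in
  match val i with
  | 0 => eta / 4 * ((1 - eta) * #|E|%:R - \sum_(c | E c) at_ p.1 c ^+ 2)
  | 1 => eta / 4 * ((1 - eta) * #|F|%:R - \sum_(c | F c) at_ p.1 c ^+ 2)
  | _ => drift q id (fun c => E c || F c) (- eta) p.1 p.2 - eta ^+ 2 * energy M
  end.

Definition set_bound (M : {set 'I_n}) (i : 'I_3) : R :=
  match val i with
  | 0 => - (#|@touchE n d M|%:R * (eta ^+ 2 / 8))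
  | 1 => - (#|@touchF n d M|%:R * (eta ^+ 2 / 8))
  | _ => - (eta ^+ 2 * energy M)
  end.

Definition perm_term (sg : 'S_n) (i : 'I_4) (p : T * T) : R :=
  let E := @touchE n d (supp sg) in let F := @touchF n d (supp sg) in
  let s := @entry_perm n d sg in
  match val i with
  | 0 => eta / 32 * (\sum_(c | E c && (s c != c)) at_ p.1 c * at_ p.1 (s c) -
           eta * #|E|%:R)
  | 1 => eta / 32 * (\sum_(c | F c && (s c != c)) at_ p.1 c * at_ p.1 (s c) -
           eta * #|F|%:R)
  | 2 => 4^-1 * (\sum_(c | E c && (s c == c)) at_ p.1 c ^+ 2) - eta / 4 * #|E|%:R
  | _ => drift q s (fun c => E c || F c) 1 p.1 p.2 -
           (2^-1 - 4 * eta) * energy (supp sg)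
  end.

Definition perm_bound (sg : 'S_n) (i : 'I_4) : R :=
  match val i with
  | 0 => - (#|@touchE n d (supp sg)|%:R * (eta ^+ 2 / 64))
  | 1 => - (#|@touchF n d (supp sg)|%:R * (eta ^+ 2 / 64))
  | 2 => #|supp sg|%:R - eta / 4 * #|@touchE n d (supp sg)|%:R
  | _ => - ((2^-1 - 4 * eta) * energy (supp sg))
  end.

Lemma entry_corr01 (c : entry n d) : 0 < q c < 1.
Proof. by case: c. Qed.

Lemma entry_corr_perm (s : 'S_n) (c : entry n d) : q (entry_perm s c) = q c.
Proof. by case: c. Qed.

Lemma snr_ge0 (a : R) : 0 < a < 1 -> 0 <= snr a.
Proof. by move=> a01; rewrite divr_ge0 ?sqr_ge0// ltW// sq_lt1. Qed.

Lemma measurable_set_term M i : measurable_fun setT (set_term M i).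
Proof.
have fst1 (f : T -> R) : measurable_fun setT f ->
    measurable_fun setT (fun p : T * T => f p.1).
  by move=> mf; exact: (measurableT_comp mf measurable_fst).
case: i => [[|[|i]] ilt]; rewrite /set_term/=.
- by apply: measurable_funM => //; apply: measurable_funB => //;
    apply: (fst1 (fun x => \sum_(c | touchE M c) at_ x c ^+ 2)); exact: measurable_sumsq.
- by apply: measurable_funM => //; apply: measurable_funB => //;
    apply: (fst1 (fun x => \sum_(c | touchF M c) at_ x c ^+ 2)); exact: measurable_sumsq.
- by apply: measurable_funB => //; exact: measurable_drift.
Qed.

Lemma measurable_perm_term sg i : measurable_fun setT (perm_term sg i).
Proof.
have fst1 (f : T -> R) : measurable_fun setT f ->
    measurable_fun setT (fun p : T * T => f p.1).
  by move=> mf; exact: (measurableT_comp mf measurable_fst).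
case: i => [[|[|[|i]]] ilt]; rewrite /perm_term/=.
- apply: measurable_funM => //; apply: measurable_funB => //.
  apply: (fst1 (fun x => \sum_(c | touchE (supp sg) c && (entry_perm sg c != c))
    at_ x c * at_ x (entry_perm sg c))).
  exact: (measurable_quad _ (fun c => touchE (supp sg) c && (entry_perm sg c != c))).
- apply: measurable_funM => //; apply: measurable_funB => //.
  apply: (fst1 (fun x => \sum_(c | touchF (supp sg) c && (entry_perm sg c != c))
    at_ x c * at_ x (entry_perm sg c))).
  exact: (measurable_quad _ (fun c => touchF (supp sg) c && (entry_perm sg c != c))).
- apply: measurable_funB => //; apply: measurable_funM => //.
  apply: (fst1 (fun x => \sum_(c | touchE (supp sg) c && (entry_perm sg c == c))
    at_ x c ^+ 2)).
  exact: (measurable_sumsq (fun c => touchE (supp sg) c && (entry_perm sg c == c))).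
- by apply: measurable_funB => //; exact: measurable_drift.
Qed.

Local Notation Q := (@gauss_tuple R N \x @gauss_tuple R N)%E.
Local Notation likC := (lik (fun i => q (enum_val i))).

Lemma set_term_le M i :
  (\int[Q]_p (likC p * expR (set_term M i p))%:E <= (expR (set_bound M i))%:E)%E.
Proof.
have q01 := entry_corr01.
case: i => [[|[|i]] ilt]; rewrite /set_term /set_bound/=.
- exact: lik_sumsq_low.
- exact: lik_sumsq_low.
- exact: (lik_drift q01 (s := id) (s' := id)).
Qed.

Lemma perm_term_le sg i :
  (\int[Q]_p (likC p * expR (perm_term sg i p))%:E <= (expR (perm_bound sg i))%:E)%E.
Proof.
have q01 := entry_corr01.
have sK := @entry_permK n d sg; have s'K := @entry_permKV n d sg.
case: i => [[|[|[|i]]] ilt]; rewrite /perm_term /perm_bound/=.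
- exact: (lik_quad q01 _ sK s'K).
- exact: (lik_quad q01 _ sK s'K).
- apply: (le_trans (lik_sumsq_high q01
    (fun c => touchE (supp sg) c && (entry_perm sg c == c)) _)).
  by rewrite lee_fin ler_expR lerD2r ler_nat; exact: card_touchE_fixed.
- by apply: (lik_drift q01 _ _ _ sK s'K) => c; exact: entry_corr_perm.
Qed.

Variables (s0 : 'S_n) (delta : R).

Let moved (M : {set 'I_n}) : bool := (1 - delta) * n%:R < #|M|%:R.

(** Were all terms negative, the comparison of scores would make the truth strictly better on the
    touched entries. The other entries contribute equally to both scores, so this contradicts the
    maximality of the estimator. *)
Lemma failure_term (p : T * T) :
  overlap R (mle rho r (unaligned s0 p)) s0 < delta -> (0 < n)%N ->
  (exists M i, moved M /\ 0 <= set_term M i p) \/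
  (exists sg i, moved (supp sg) /\ 0 <= perm_term sg i p).
Proof.
move=> ov n0.
set hp := mle rho r (unaligned s0 p) in ov.
(* Products of permutations act left factor first: [sg v] is the preimage under [s0] of [hp v], so
   [sg] fixes exactly the vertices of agreement. *)
pose sg := (hp * s0^-1)%g.
have sgE v : (sg v == v) = (hp v == s0 v).
  by rewrite permM -(inj_eq (@perm_inj _ s0)) permKV.
have nR : 0 < n%:R :> R by rewrite ltr0n.
have mv : moved (supp sg).
  have e : (#|[pred v | hp v == s0 v]| + #|supp sg| = n)%N.
    rewrite -[RHS]card_ord -(cardC [pred v | hp v == s0 v]); congr addn.
    by apply: eq_card => v; rewrite !inE sgE.
  move: ov; rewrite /overlap ltr_pdivrMr// /moved => ov.
  have : #|[pred v | hp v == s0 v]|%:R + #|supp sg|%:R = n%:R :> R.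
    by rewrite -natrD e.
  by move=> e'; move: ov e'; rewrite mulrBl mul1r; lra.
case: (pselect ((exists M i, moved M /\ 0 <= set_term M i p) \/
  (exists sg i, moved (supp sg) /\ 0 <= perm_term sg i p))) => // nh; exfalso.
have hs i : set_term (supp sg) i p < 0.
  by rewrite ltNge; apply/negP => h; apply: nh; left; exists (supp sg), i.
have hp' i : perm_term sg i p < 0.
  by rewrite ltNge; apply/negP => h; apply: nh; right; exists sg, i.
case/andP: (eta01) => e0 e1.
have e4 : 0 < eta / 4 by rewrite divr_gt0.
have e32 : 0 < eta / 32 by rewrite divr_gt0.
have gap : \sum_(c | touchE (supp sg) c || touchF (supp sg) c)
      wgt q c * at_ p.1 c * at_ p.2 (entry_perm sg c) <
    \sum_(c | touchE (supp sg) c || touchF (supp sg) c)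
      wgt q c * at_ p.1 c * at_ p.2 c.
  apply: (@score_gap R _ q (entry_perm sg) (touchE (supp sg)) (touchF (supp sg))
    (snr rho) (snr r) eta p.1 p.2) => //.
  - exact: touch_disj.
  - by case.
  - by case.
  - exact: touchF_moved.
  - exact: snr_ge0.
  - exact: snr_ge0.
  - by have := hs (@Ordinal 3 0 isT); rewrite /set_term/= pmulr_rlt0// subr_lt0 => /ltW.
  - by have := hs (@Ordinal 3 1 isT); rewrite /set_term/= pmulr_rlt0// subr_lt0 => /ltW.
  - by have := hs (@Ordinal 3 2 isT); rewrite /set_term/= subr_lt0.
  - by have := hp' (@Ordinal 4 0 isT); rewrite /perm_term/= pmulr_rlt0// subr_lt0 => /ltW.
  - by have := hp' (@Ordinal 4 1 isT); rewrite /perm_term/= pmulr_rlt0// subr_lt0 => /ltW.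
  - have := hp' (@Ordinal 4 2 isT); rewrite /perm_term/= subr_lt0.
    set S := (X in 4^-1 * X); set h := #|_|%:R => H.
    by move: H; rewrite -mulrA [eta * _]mulrCA ltr_pM2l ?invr_gt0// => /ltW.
  - by have := hp' (@Ordinal 4 3 isT); rewrite /perm_term/= subr_lt0.
have scoreE (t : 'S_n) : score rho r (unaligned s0 p) t =
    \sum_c wgt q c * at_ p.1 c * at_ p.2 (entry_perm (t * s0^-1)%g c).
  by apply: eq_bigr => c _; rewrite !entry_val_mkgraph entry_permM.
have := mleP rho r (unaligned s0 p) s0; rewrite -/hp !scoreE -/sg mulgV.
rewrite leNgt => /negP; apply.
rewrite (bigID (fun c => touchE (supp sg) c || touchF (supp sg) c))/=.
rewrite [ltRHS](bigID (fun c => touchE (supp sg) c || touchF (supp sg) c))/=.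
apply: ltr_leD.
  by under [ltRHS]eq_bigr do rewrite entry_perm1.
rewrite le_eqVlt; apply/orP; left; apply/eqP; apply: eq_bigr => c nc.
by rewrite entry_perm1 entry_perm_untouched.
Qed.

Lemma mle_failure_le dO (Omega : measurableType dO) (P : probability Omega R)
    (G : Omega -> featured_graph R n d * featured_graph R n d) :
  (0 < n)%N -> measurable_fun setT G -> correlated_wigner P rho r s0 G ->
  (P [set w | (overlap R (mle rho r (G w)) s0 < delta)%R] <=
   ((\sum_(M | moved M) \sum_i expR (set_bound M i)) +
    (\sum_(sg | moved (supp sg)) \sum_i expR (perm_bound sg i)))%R%:E)%E.
Proof.
move=> n0 mG cwG.
pose X : set (featured_graph R n d * featured_graph R n d) :=
  [set g | overlap R (mle rho r g) s0 < delta].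
have mX : measurable X.
  exact: (measurable_hatpi (@measurable_mle R n d rho r)
    (fun t => overlap R t s0 < delta)).
have mX' : measurable ((@unaligned R n d s0) @^-1` X).
  exact: (measurable_preimageT (measurable_unaligned _)).
rewrite [leLHS](_ : _ = P (G @^-1` X))//.
have Poo : (P setT < +oo)%E by rewrite probability_setT ltry.
rewrite (wigner_law rho01 r01 mG cwG Poo mX).
pose g (j : ({set 'I_n} * 'I_3) + ('S_n * 'I_4)) (p : T * T) : R :=
  match j with inl a => set_term a.1 a.2 p | inr a => perm_term a.1 a.2 p end.
pose Pj (j : ({set 'I_n} * 'I_3) + ('S_n * 'I_4)) : bool :=
  match j with inl a => moved a.1 | inr a => moved (supp a.1) end.
apply: (le_trans (@union_chernoff R _ q _ Pj g _ mX' _ _)).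
- by case=> a; [exact: measurable_set_term|exact: measurable_perm_term].
- move=> p /failure_term /(_ n0) [[M [i [? ?]]]|[sg [i [? ?]]]].
    by exists (inl (M, i)).
  by exists (inr (sg, i)).
rewrite big_sumType/= EFinD; apply: leeD.
  rewrite -sumEFin; under [leRHS]eq_bigr do rewrite -sumEFin.
  rewrite pair_big/= [leRHS](eq_bigl (fun a => moved a.1)) => [|a]; last first.
    by rewrite andbT.
  by apply: lee_sum => -[M i] _; exact: set_term_le.
rewrite -sumEFin; under [leRHS]eq_bigr do rewrite -sumEFin.
rewrite pair_big/= [leRHS](eq_bigl (fun a => moved (supp a.1))) => [|a]; last first.
  by rewrite andbT.
by apply: lee_sum => -[sg i] _; exact: perm_term_le.
Qed.

End mle_failure.

(** * Summing over sets and permutations *)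

Section failure_sum.
Context {R : realType} (n : nat).

Lemma card_supp_le (M : {set 'I_n}) : (#|[pred s | supp s == M]| <= (#|M|)`!)%N.
Proof.
rewrite -card_perm; apply: subset_leq_card; apply/fintype.subsetP => s.
rewrite !inE => /eqP <-; apply/fintype.subsetP => v; rewrite !inE.
by [].
Qed.

Lemma fact_le_exp (m k : nat) : (k <= m)%N -> (k`! <= m ^ k)%N.
Proof.
elim: k => [//|k IHk] km; rewrite factS expnS leq_mul//.
by rewrite IHk// ltnW.
Qed.

Lemma card_set_ord : #|{: {set 'I_n}}| = (2 ^ n)%N.
Proof. by rewrite -cardsT -powersetT card_powerset cardsT card_ord. Qed.

(** The permutations with a given support of size [k] number at most [k!], so each of the [2 ^ n]
    supports contributes at most 1. *)
Lemma sum_inv_fact_supp_le :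
  \sum_(s : 'S_n) ((#|supp s|)`!%:R)^-1 <= 2 ^+ n :> R.
Proof.
rewrite (partition_big (@supp n) xpredT)//=.
rewrite (_ : 2 ^+ n = \sum_(M : {set 'I_n}) (1 : R)); last first.
  by rewrite sumr_const card_set_ord natrX.
apply: ler_sum => M _.
rewrite (eq_bigr (fun=> (((#|M|)`!)%:R)^-1)) => [|s /eqP -> //].
rewrite sumr_const -[leLHS]mulr_natl ler_pdivrMr ?ltr0n ?fact_gt0// mul1r ler_nat.
exact: card_supp_le.
Qed.

(** [n ^- k] is at most the inverse of [k!], so the sum over permutations also reduces to one over
    supports; the factor [2 ^ n] is absorbed by half of the exponent [2 n]. *)
Lemma failure_sum_le (I J : finType) (A : pred {set 'I_n}) (B : pred 'S_n)
    (a : {set 'I_n} -> I -> R) (b : 'S_n -> J -> R) :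
  (0 < n)%N ->
  (forall M i, A M -> a M i <= - (2 * n%:R)) ->
  (forall s j, B s -> b s j <= - (2 * n%:R) - #|supp s|%:R * ln n%:R) ->
  \sum_(M | A M) \sum_i expR (a M i) + \sum_(s | B s) \sum_j expR (b s j) <=
  (#|I| + #|J|)%:R * expR (- n%:R).
Proof.
move=> n0 aA bB.
have nR : 0 < n%:R :> R by rewrite ltr0n.
pose E : R := expR (- (2 * n%:R)).
have E2 : 2 ^+ n * E <= expR (- n%:R).
  rewrite (_ : expR (- n%:R) = expR n%:R * E); last by rewrite -expRD; congr expR; ring.
  rewrite ler_wpM2r ?expR_ge0//.
  rewrite -[X in expR X]mulr1 expRM_natl lerXn2r ?nnegrE ?expR_ge0//.
  by have := expR_ge1Dx (1 : R); rewrite -[1 + 1]/(2%:R).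
rewrite natrD mulrDl; apply: lerD.
  apply: (@le_trans _ _ (\sum_(M : {set 'I_n}) (#|I|%:R * E))).
    rewrite big_mkcond/=; apply: ler_sum => M _.
    case: ifPn => [AM|_]; last by rewrite mulr_ge0// expR_ge0.
    apply: (@le_trans _ _ (\sum_(i : I) E)).
      by apply: ler_sum => i _; rewrite ler_expR aA.
    by rewrite sumr_const -[leLHS]mulr_natl.
  by rewrite sumr_const card_set_ord -[leLHS]mulr_natl natrX mulrCA ler_wpM2l.
apply: (@le_trans _ _ (\sum_(s : 'S_n) (#|J|%:R * E) * ((#|supp s|)`!%:R)^-1)).
  rewrite big_mkcond/=; apply: ler_sum => s _.
  have f0 : 0 <= ((#|supp s|)`!%:R)^-1 :> R by rewrite invr_ge0.
  case: ifPn => [Bs|_]; last by rewrite !mulr_ge0// expR_ge0.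
  apply: (@le_trans _ _ (\sum_(j : J) (E * ((#|supp s|)`!%:R)^-1))).
    apply: ler_sum => j _; apply: (@le_trans _ _ (expR (- (2 * n%:R) - #|supp s|%:R * ln n%:R))).
      by rewrite ler_expR bB.
    rewrite expRD ler_wpM2l ?expR_ge0//.
    rewrite expRN expRM_natl lnK ?posrE// lef_pV2 ?posrE ?ltr0n ?fact_gt0 ?exprn_gt0//.
    rewrite -natrX ler_nat fact_le_exp//.
    by rewrite -[leqRHS]card_ord max_card.
  by rewrite sumr_const -[leLHS]mulr_natl mulrA.
rewrite -mulr_sumr -mulrA ler_wpM2l//.
apply: le_trans E2; rewrite mulrC ler_wpM2r ?expR_ge0//.
exact: sum_inv_fact_supp_le.
Qed.

End failure_sum.

(** * Lower bounds on the energy *)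

Section energy.
Context {R : realType} (n d : nat) (rho r : R).
Hypotheses (rho01 : 0 < rho < 1) (r01 : 0 < r < 1).

(** With [k] moved vertices, ['C(n, 2) - 'C(n - k, 2)] exceeds the left side by [k (n - k) / 2].
    Only half of [k n] is guaranteed, and the half is attained at [k = n]; this is why [signal]
    counts [n] for the edges but [2 d] for the features. *)
Lemma touchE_ge (M : {set 'I_n}) :
  #|M|%:R * (n%:R - 1) / 2 <= #|@touchE n d M|%:R :> R.
Proof.
have Mn : (#|M| <= n)%N by rewrite -[leqRHS]card_ord max_card.
have C2 (m : nat) : ('C(m, 2))%:R = m%:R * (m%:R - 1) / 2 :> R.
  have : 'C(m, 2)%:R * 2 = m%:R * m.-1%:R :> R.
    by rewrite -!natrM; congr _%:R; rewrite bin2 muln2; case: m => // m;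
      rewrite -[RHS]odd_double_half oddM /= andNb.
  case: m => [|m] /= h; first by rewrite !mul0r.
  rewrite (_ : m.+1%:R - 1 = m%:R :> R); last by rewrite -natr1 addrK.
  by rewrite -h mulfK.
have := congr1 (fun m => m%:R : R) (@card_touchE n d M).
rewrite /= natrD !C2 natrB//.
have k0 : 0 <= #|M|%:R :> R by [].
have kn : #|M|%:R <= n%:R :> R by rewrite ler_nat.
move: k0 kn; set k := #|M|%:R; set m := n%:R => k0 kn h.
have h2 : 0 <= k * (m - k) by rewrite mulr_ge0// subr_ge0.
have -> : #|@touchE n d M|%:R = m * (m - 1) / 2 - (m - k) * (m - k - 1) / 2 :> R.
  by rewrite -h addrK.
rewrite -subr_ge0 (_ : _ - _ = k * (m - k) / 2); last by field.
by rewrite divr_ge0.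
Qed.

Lemma ln_le_snr (a : R) : 0 < a < 1 -> ln (1 / (1 - a ^+ 2)) <= snr a.
Proof.
move=> a01; have k0 := sq_lt1 a01.
rewrite (_ : 1 / (1 - a ^+ 2) = 1 + snr a); last first.
  by rewrite /snr; field; rewrite gt_eqF.
by apply: le_ln1Dx; rewrite (lt_le_trans _ (snr_ge0 a01)) ?ltrN10.
Qed.

(** The factor [1 - n^-1] is the loss from [n] to [n - 1] in the number of edges; on the features,
    where nothing is lost, it is simply dropped. *)
Lemma energy_ge (M : {set 'I_n}) : (0 < n)%N ->
  #|M|%:R / 2 * (1 - n%:R^-1) * signal n d rho r <= energy d rho r M.
Proof.
move=> n0; have nR : 0 < n%:R :> R by rewrite ltr0n.
have n1 : 1 <= n%:R :> R by rewrite ler1n.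
rewrite /energy /signal card_touchF natrM.
have k0 : 0 <= #|M|%:R :> R by [].
have L0 (a : R) : 0 < a < 1 -> 0 <= ln (1 / (1 - a ^+ 2)).
  move=> a01; rewrite ln_ge0// div1r -[leLHS]invr1 lef_pV2 ?posrE ?sq_lt1//.
  by rewrite gerBl sqr_ge0.
rewrite (_ : _ * _ * _ = #|M|%:R * (n%:R - 1) / 2 * ln (1 / (1 - rho ^+ 2)) +
  (1 - n%:R^-1) * (#|M|%:R * d%:R * ln (1 / (1 - r ^+ 2)))); last first.
  by field; rewrite gt_eqF.
apply: lerD.
  rewrite mulrC; apply: ler_pM => //; first exact: L0.
  - by rewrite divr_ge0// mulr_ge0// subr_ge0.
  - exact: ln_le_snr.
  - exact: touchE_ge.
apply: (@le_trans _ _ (#|M|%:R * d%:R * ln (1 / (1 - r ^+ 2)))).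
  have X0 : 0 <= #|M|%:R * d%:R * ln (1 / (1 - r ^+ 2)) by rewrite mulr_ge0// L0.
  by apply: ler_piMl => //; rewrite gerBl invr_ge0 ltW.
by rewrite mulrC ler_wpM2r ?mulr_ge0// ln_le_snr.
Qed.

End energy.

(** * Numerical estimates for the failure probability *)

Section failure_asymptotics.
Context {R : realType}.

(** The coefficient of [k * L * e] that remains in [drift_bound]. *)
Let quad_ge0 (e : R) : 0 < e -> e <= 1 ->
  0 <= 16 / 256 - 9 / 256 * e + e ^+ 2 / 1024.
Proof. by move=> e0 e1; have := sqr_ge0 e; lra. Qed.

(** The right side is [k * L * v * (8 - e) * (4 + e) / 32]. At [v = 1] its gain over [k * L] is
    about [e / 8] in relative terms; about [e / 32] is lost in [v], [e / 32] pays for [2 * N], and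
    the rest is nonnegative by [quad_ge0]. *)
Let drift_bound (e eta L al N k v : R) : eta = e / 64 -> 0 < e -> e <= 1 ->
  0 <= L -> 0 < N -> al * N <= k -> 0 <= k -> 64 <= al * e * L -> 1 - e / 32 <= v ->
  k * L + 2 * N <= (2^-1 - 4 * eta) * (k / 2 * v * ((4 + e) * L)).
Proof.
move=> -> e0 e1 L0 N0 hk k0 hL hv.
have kL : 0 <= k * L by rewrite mulr_ge0.
have h5 : 2 * N <= k * L * (e / 32).
  have a : 0 <= (k - al * N) * (L * e) by rewrite mulr_ge0 ?subr_ge0// mulr_ge0// ltW.
  have b : 0 <= (al * e * L - 64) * N by rewrite mulr_ge0 ?subr_ge0// ltW.
  rewrite -subr_ge0 (_ : _ - _ =
    ((k - al * N) * (L * e) + (al * e * L - 64) * N) / 32); last by field.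
  by rewrite divr_ge0// addr_ge0.
have h6 := mulr_ge0 (mulr_ge0 kL (ltW e0)) (quad_ge0 e0 e1).
have h7 : 0 <= (v - (1 - e / 32)) * (k * L * ((8 - e) * (4 + e))).
  rewrite mulr_ge0 ?subr_ge0//; rewrite mulr_ge0//; rewrite mulr_ge0//.
    by move: e1; clear; lra.
  by move: e0; clear; lra.
rewrite -subr_ge0 (_ : _ - _ = (k * L * (e / 32) - 2 * N) +
  k * L * e * (16 / 256 - 9 / 256 * e + e ^+ 2 / 1024) +
  (v - (1 - e / 32)) * (k * L * ((8 - e) * (4 + e))) / 32); last by field.
have h8 : 0 <= k * L * (e / 32) - 2 * N by rewrite subr_ge0.
have h9 := divr_ge0 h7 (ler0n R 32).
exact: (addr_ge0 (addr_ge0 h8 h6) h9).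
Qed.

(** For [k > (1 - delta) * n] one has [2 * n <= k * L], so an exponent [2 * k * L] covers both the
    sets and the permutations of a given support. The 7 counts three terms per set and four per
    permutation. *)
Lemma failure_asymp (n d : nat) (rho r e delta : R) :
  0 < rho < 1 -> 0 < r < 1 -> 0 < e <= 1 -> 0 < delta < 1 -> (1 < n)%N ->
  let eta := e / 64 in let L := ln n%:R in
  (4 + e) * L <= signal n d rho r ->
  1 <= L -> 2 <= (1 - delta) * L -> 512 / eta ^+ 2 <= L ->
  2 <= eta ^+ 2 * (1 - delta) * L -> 64 <= (1 - delta) * e * L ->
  32 <= e * n%:R -> 128 / eta ^+ 2 * L <= d%:R ->
  forall dO (Omega : measurableType dO) (P : probability Omega R) (s : 'S_n)
    (G : Omega -> featured_graph R n d * featured_graph R n d),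
  measurable_fun setT G -> correlated_wigner P rho r s G ->
  (P [set w | (overlap R (mle rho r (G w)) s < delta)%R] <=
   (7 * expR (- n%:R))%R%:E)%E.
Proof.
move=> rho01 r01 /andP[e0 e1] /andP[d0 d1] n2 eta L sig L1 L2 L3 L4 L5 ne dL
  dO Omega P s G mG cwG.
have n0 : (0 < n)%N by rewrite ltnW.
have nR : 0 < n%:R :> R by rewrite ltr0n.
have etaE : eta = e / 64 by [].
have LE : L = ln n%:R by [].
move: eta L etaE LE sig L1 L2 L3 L4 L5 dL => eta L etaE LE sig L1 L2 L3 L4 L5 dL.
have eta0 : 0 < eta by rewrite etaE divr_gt0.
have eta1 : eta < 1 by rewrite etaE; lra.
have eta01 : 0 < eta < 1 by rewrite eta0.
have eta20 : 0 < eta ^+ 2 by rewrite exprn_gt0.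
have L0 : 0 < L by rewrite (lt_le_trans ltr01).
have al0 : 0 < 1 - delta by rewrite subr_gt0.
(* [n = expR L >= 1 + L ^+ 2 / 2]: the number of vertices dominates [L] by itself, so the edges
   require no assumption like that on [d]. *)
have nL : L ^+ 2 / 2 <= n%:R - 1.
  have := expR_ge1Dxn 1 (ltW L0); rewrite LE lnK ?posrE// -LE.
  by rewrite -[2`!]/2%N; lra.
have nL2 : 2 * L <= (n%:R - 1) * (eta ^+ 2 / 128).
  rewrite ler_pdivrMr// in L3.
  have h : 512 * L <= L * (L * eta ^+ 2) by rewrite mulrC ler_wpM2l// ltW.
  have h2 : L ^+ 2 / 2 * (eta ^+ 2 / 128) <= (n%:R - 1) * (eta ^+ 2 / 128).
    by rewrite ler_wpM2r// divr_ge0// ltW.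
  have h3 : L ^+ 2 / 2 * (eta ^+ 2 / 128) = L * (L * eta ^+ 2) / 256 by field.
  lra.
(* The growth of [d] enters here: [k * d] feature coordinates must yield an exponent [2 * k * L]. *)
have dL2 : 2 * L <= d%:R * (eta ^+ 2 / 64).
  have h : 128 / eta ^+ 2 * L * (eta ^+ 2 / 64) <= d%:R * (eta ^+ 2 / 64).
    by rewrite ler_wpM2r// divr_ge0// ltW.
  have h2 : 128 / eta ^+ 2 * L * (eta ^+ 2 / 64) = 2 * L.
    by field; rewrite gt_eqF.
  lra.
have kL (k : R) : (1 - delta) * n%:R < k -> 2 * n%:R <= k * L.
  move=> hk; apply: (@le_trans _ _ ((1 - delta) * n%:R * L)).
    by rewrite mulrAC ler_wpM2r// ltW.
  by rewrite ler_wpM2r// ltW.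
have hE (M : {set 'I_n}) : #|M|%:R * (2 * L) <= #|@touchE n d M|%:R * (eta ^+ 2 / 64).
  apply: (@le_trans _ _ (#|M|%:R * (n%:R - 1) / 2 * (eta ^+ 2 / 64))).
    rewrite (_ : _ / 2 * _ = #|M|%:R * ((n%:R - 1) * (eta ^+ 2 / 128))); last by field.
    by rewrite ler_wpM2l.
  by rewrite ler_wpM2r ?touchE_ge// divr_ge0// ltW.
have hF (M : {set 'I_n}) : #|M|%:R * (2 * L) <= #|@touchF n d M|%:R * (eta ^+ 2 / 64).
  by rewrite card_touchF natrM -mulrA ler_wpM2l.
have hn : 0 <= 1 - n%:R^-1 :> R by rewrite subr_ge0 invf_le1// ler1n.
have hen (M : {set 'I_n}) :
    #|M|%:R / 2 * (1 - n%:R^-1) * ((4 + e) * L) <= energy d rho r M.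
  apply: le_trans (energy_ge d rho01 r01 M n0).
  by rewrite ler_wpM2l// mulr_ge0.
have ninv : n%:R^-1 <= e / 32 by rewrite invf_ple ?posrE ?divr_gt0// invf_div ler_pdivrMr// mulrC.
have hen2 (M : {set 'I_n}) : #|M|%:R * L <= energy d rho r M.
  apply: le_trans (hen M).
  rewrite (_ : _ * _ * ((4 + e) * L) =
    #|M|%:R * L * ((1 - n%:R^-1) * (4 + e) / 2)); last by ring.
  rewrite ler_peMr ?mulr_ge0 ?(ltW L0)//.
  have : 1 - e / 32 <= 1 - n%:R^-1 by lra.
  set v := 1 - n%:R^-1 => hv.
  have : (1 - e / 32) * (4 + e) <= v * (4 + e) by rewrite ler_wpM2r//; lra.
  have : 0 <= e * (1 - e) by rewrite mulr_ge0//; lra.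
  lra.
apply: (le_trans (mle_failure_le rho01 r01 eta01 _ n0 mG cwG)).
rewrite lee_fin.
have scale (c y k : R) : 0 <= c -> (1 - delta) * n%:R < k -> k * L <= y ->
    c * ((1 - delta) * n%:R * L) <= c * y.
  move=> c0 hk hy; apply: ler_wpM2l => //; apply: le_trans hy.
  by rewrite ler_wpM2r// ltW.
apply: (@le_trans _ _ ((#|'I_3| + #|'I_4|)%:R * expR (- n%:R))); last first.
  by rewrite !card_ord.
apply: failure_sum_le => //.
  move=> M i hM; have hk := kL _ hM.
  case: i => [[|[|i]] ilt]; rewrite /set_bound/= lerN2.
  - rewrite (_ : _ * (eta ^+ 2 / 8) = 8 * (#|@touchE n d M|%:R * (eta ^+ 2 / 64))).
      by have := hE M; lra.
    by field.
  - rewrite (_ : _ * (eta ^+ 2 / 8) = 8 * (#|@touchF n d M|%:R * (eta ^+ 2 / 64))).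
      by have := hF M; lra.
    by field.
  - apply: le_trans (scale _ _ _ (ltW eta20) hM (hen2 M)).
    rewrite (_ : _ * (_ * _ * L) = eta ^+ 2 * (1 - delta) * L * n%:R); last by ring.
    by rewrite ler_pM2r.
move=> sg i hM; have hk := kL _ hM; have := hE (supp sg); have := hF (supp sg).
rewrite -LE -opprD; set k := #|supp sg|%:R in hM hk *.
have k0 : 0 <= k by [].
case: i => [[|[|[|i]]] ilt]; rewrite /perm_bound/= ?lerN2 => h2 h1.
- by lra.
- by lra.
- have h0 : 0 <= #|@touchE n d (supp sg)|%:R :> R by [].
  have h3 : #|@touchE n d (supp sg)|%:R * (eta ^+ 2 / 64) <=
      #|@touchE n d (supp sg)|%:R * (eta / 64).
    by rewrite ler_wpM2l// ler_wpM2r// expr2 ler_piMl// ltW.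
  have h4 : k <= k * L by rewrite ler_peMr.
  rewrite -/k (_ : eta / 4 * _ = 16 * (#|@touchE n d (supp sg)|%:R * (eta / 64))).
    by lra.
  by field.
- have := hen (supp sg); rewrite -/k => hen'.
  have h40 : 0 <= 2^-1 - 4 * eta by rewrite etaE; lra.
  apply: le_trans (ler_wpM2l h40 hen').
  have vge : 1 - e / 32 <= 1 - n%:R^-1 by rewrite lerB.
  rewrite [leLHS]addrC; exact: (drift_bound etaE e0 e1 (ltW L0) nR (ltW hM) k0 L5 vge).
Qed.

End failure_asymptotics.

(** * Possibility *)

Section possibility.
Context {R : realType}.

Lemma near_ln_mul (c a : R) : 0 < c -> \forall n \near \oo, a <= c * ln n%:R.
Proof.
move=> c0; near=> n; rewrite mulrC -ler_pdivrMr//.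
by near: n; exact: near_ln_ge.
Unshelve. all: by end_near. Qed.

Lemma possibility (d : nat -> nat) (rho r : nat -> R)
    (hrho : forall n, 0 < rho n < 1) (hr : forall n, 0 < r n < 1) :
  (fun n => ln n%:R : R) =o_\oo (fun n => (d n)%:R : R) ->
  forall eps : R, 0 < eps ->
  (\forall n \near \oo,
     (4 + eps) * ln n%:R <= signal n (d n) (rho n) (r n)) ->
  exists hatpi : forall n, featured_graph R n (d n) * featured_graph R n (d n) -> 'S_n,
    (forall n, measurable_to_perm (hatpi n)) /\
    forall delta : R, 0 < delta < 1 ->
    forall pistar : forall n, 'S_n,
    forall (dOmega : nat -> measure_display)
      (Omega : forall n, measurableType (dOmega n))
      (P : forall n, probability (Omega n) R)
      (G : forall n, Omega n -> featured_graph R n (d n) * featured_graph R n (d n)),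
    (forall n, measurable_fun setT (G n)) ->
    (forall n, correlated_wigner (P n) (rho n) (r n) (pistar n) (G n)) ->
    P n [set w | delta <= overlap R (hatpi n (G n w)) (pistar n)]
      @[n --> \oo] --> 1%E.
Proof.
move=> lnd eps eps0 hsig.
exists (fun n => @mle R n (d n) (rho n) (r n)); split.
  by move=> n; exact: measurable_mle.
move=> delta d01 pistar dOmega Omega P G mG cwG.
have al0 : 0 < 1 - delta by rewrite subr_gt0; case/andP: d01.
(* The numerical bounds need [e <= 1], and the hypothesis on the signal is weaker for a smaller
   constant. *)
pose e := Num.min eps 1.
have e0 : 0 < e by rewrite lt_min eps0 ltr01.
have e1 : e <= 1 by rewrite ge_min lexx orbT.
have eta20 : 0 < (e / 64) ^+ 2 by rewrite exprn_gt0// divr_gt0.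
have lnd' : \forall n \near \oo,
    `|ln n%:R : R| <= (e / 64) ^+ 2 / 128 * `|(d n)%:R : R|.
  by move/eqoP : lnd => /(_ _ _); apply; rewrite divr_gt0.
have key : \forall n \near \oo, (P n [set w |
    (overlap R (mle (rho n) (r n) (G n w)) (pistar n) < delta)%R] <=
    (7 * expR (- n%:R))%R%:E)%E.
  near=> n.
  have n2 : (1 < n)%N by near: n; exists 2%N.
  have L1 : 1 <= ln (n%:R : R) by near: n; exact: near_ln_ge.
  apply: (@failure_asymp R n (d n) (rho n) (r n) e) => //.
  - by rewrite e0.
  - apply: (@le_trans _ _ ((4 + eps) * ln n%:R)); last by near: n.
    rewrite ler_wpM2r ?(le_trans ler01)// lerD2l ge_min lexx//.
  - by near: n; apply: near_ln_mul.
  - by near: n; exact: near_ln_ge.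
  - by near: n; apply: near_ln_mul; rewrite mulr_gt0.
  - by near: n; apply: near_ln_mul; rewrite mulr_gt0.
  - rewrite mulrC -ler_pdivrMr//; near: n; exact: nbhs_infty_ger.
  - rewrite mulrC -ler_pdivlMr ?divr_gt0// invf_div mulrC.
    have : `|ln n%:R : R| <= (e / 64) ^+ 2 / 128 * `|(d n)%:R : R|.
      by near: n.
    by rewrite ger0_norm ?(le_trans ler01)// ger0_norm.
have key2 : \forall n \near \oo,
    ((1 - 7 * @harmonic R n)%:E <= P n [set w |
      (delta <= overlap R (mle (rho n) (r n) (G n w)) (pistar n))%R] <= 1)%E.
  near=> n.
  have keyn : (P n [set w |
    (overlap R (mle (rho n) (r n) (G n w)) (pistar n) < delta)%R] <=
    (7 * expR (- n%:R))%R%:E)%E by near: n.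
  pose S := [set w | overlap R (mle (rho n) (r n) (G n w)) (pistar n) < delta].
  have mS : measurable S.
    apply: (measurable_preimageT (mG n) (A := [set g |
      overlap R (mle (rho n) (r n) g) (pistar n) < delta])).
    exact: (measurable_hatpi (@measurable_mle R n (d n) (rho n) (r n))
      (fun t => overlap R t (pistar n) < delta)).
  have -> : [set w | delta <= overlap R (mle (rho n) (r n) (G n w)) (pistar n)] = ~` S.
    by apply/seteqP; split=> w /=; rewrite leNgt => /negP.
  rewrite probability_le1 ?andbT; last exact: measurableC.
  rewrite probability_setC// EFinB leeB//.
  apply: (@le_trans _ _ (7 * expR (- n%:R))%:E) => //.
  by rewrite lee_fin ler_wpM2l// /harmonic/= -natr1 addrC expR_Nnat_le.
apply: (squeeze_cvge key2); last exact: cvg_cst.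
apply: cvg_EFin; first by near=> n.
rewrite [X in _ --> X](_ : _ = 1 - 7 * 0); last by rewrite mulr0 subr0.
by apply: cvgB; [exact: cvg_cst | apply: cvgMl_tmp; exact: cvg_harmonic].
Unshelve. all: by end_near. Qed.

End possibility.

Theorem theorem1 (R : realType) (d : nat -> nat) (rho r : nat -> R)
    (hrho : forall n, 0 < rho n < 1) (hr : forall n, 0 < r n < 1) :
  (* Possibility *)
  ((fun n => ln n%:R : R) =o_\oo (fun n => (d n)%:R : R) ->
   forall eps : R, 0 < eps ->
   (\forall n \near \oo,
      (4 + eps) * ln n%:R <= signal n (d n) (rho n) (r n)) ->
   exists hatpi : forall n, featured_graph R n (d n) * featured_graph R n (d n) -> 'S_n,
     (forall n, measurable_to_perm (hatpi n)) /\
     forall delta : R, 0 < delta < 1 ->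
     forall pistar : forall n, 'S_n,
     forall (dOmega : nat -> measure_display)
       (Omega : forall n, measurableType (dOmega n))
       (P : forall n, probability (Omega n) R)
       (G : forall n, Omega n -> featured_graph R n (d n) * featured_graph R n (d n)),
     (forall n, measurable_fun setT (G n)) ->
     (forall n, correlated_wigner (P n) (rho n) (r n) (pistar n) (G n)) ->
     P n [set w | delta <= overlap R (hatpi n (G n w)) (pistar n)]
       @[n --> \oo] --> 1%E)
  /\
  (* Impossibility *)
  (forall delta : R, 0 < delta < 1 ->
   forall c : R,
   (\forall n \near \oo,
      signal n (d n) (rho n) (r n) <= c * ln n%:R) ->
   forall hatpi : forall n, featured_graph R n (d n) * featured_graph R n (d n) -> 'S_n,
   (forall n, measurable_to_perm (hatpi n)) ->
   forall (dOmega : nat -> measure_display)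
     (Omega : forall n, measurableType (dOmega n))
     (P : forall n, probability (Omega n) R)
     (pistar : forall n, Omega n -> 'S_n)
     (G : forall n, Omega n -> featured_graph R n (d n) * featured_graph R n (d n)),
   (forall n, measurable_fun setT (G n)) ->
   (forall n, uniform_perm (P n) (pistar n)) ->
   (forall n s, correlated_wigner
      (cond_prob (P n) (pistar n @^-1` [set s])) (rho n) (r n) s (G n)) ->
   \forall n \near \oo,
     ((1 - c / (4 * delta))%R%:E <=
      P n [set w | (overlap R (hatpi n (G n w)) (pistar n w) < delta)%R])%E).
Proof.
by split; [exact: possibility | exact: impossibility].
Qed.
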